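(* Let $x\in{}^{\omega}2$. If $x$ is $ITRM$-random in the measure sense, then $x$ is totally incompressible. Likewise, if $x$ is $ITRM$-random in the meager sense, then $x$ is totally incompressible.
   Context: Reals are elements of ${}^{\omega}2$. An Infinite Time Register Machine ($ITRM$) is a register machine with finitely many registers, each holding a natural number, running an ordinary finite register machine program along ordinal time; at limit times the active program line is the $\liminf$ of the earlier program lines, and each register content is the $\liminf$ of its earlier contents if this is finite, and $0$ otherwise. With an oracle $y \in {}^{\omega}2$, the program may query the bit $y(k)$ for the content $k$ of a register. $P^{y}(n)\downarrow = m$ means that program $P$ with oracle $y$, started with $n$ in the first register and $0$ in all others, halts with $m$ in the first register; $P^{y}\downarrow=m$ means the same with all registers initially $0$. A set $X\subseteq{}^{\omega}2$ is $ITRM$-decidable iff there is an $ITRM$-program $P$ such that, for all $y \in {}^{\omega}2$, $P^{y}\downarrow=1$ if $y\in X$ and $P^{y}\downarrow=0$ if $y\notin X$. A real $x$ is $ITRM$-random in the measure sense iff there is no $ITRM$-decidable set $X$ of Lebesgue measure $0$ with $x\in X$. A real $x$ is $ITRM$-random in the meager sense iff there is no $ITRM$-decidable meager set $X$ with $x\in X$. For $x\in{}^{\omega}2$ and $n\in\omega$, $x_{\setminus n}$ is $x$ with its $n$th bit deleted: $x_{\setminus n}(k)=x(k)$ for $k<n$ and $x_{\setminus n}(k)=x(k+1)$ for $k\ge n$. A real $x$ is $ITRM$-autoreducible iff there is an $ITRM$-program $P$ such that $P^{x_{\setminus n}}(n)\downarrow = x(n)$ for all $n\in\omega$. $x$ is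 totally incompressible iff it is not $ITRM$-autoreducible. *)

(* Defs.v *)
From HB Require Import structures.
From mathcomp Require Import all_boot all_order all_algebra.
From mathcomp Require Import all_classical all_reals all_analysis.
From mathcomp Require Import wochoice.

Set Implicit Arguments.
Unset Strict Implicit.
Unset Printing Implicit Defensive.

Import Order.TTheory GRing.Theory Num.Theory.

Local Open Scope classical_set_scope.

Inductive instr : Type :=
| Zero (i : nat)
| Succ (i : nat)
| Transfer (i j : nat)
| Oracle (i : nat)
| Jump (i j q : nat).

(* [Oracle i] replaces the content k of R_i by the bit y(k). [Jump i j q]
   jumps to line q if R_i = R_j. The machine halts on reaching a line outside
   the program.

   A program mentions finitely many registers only; the others keep their
   initial content, so registers can be indexed by all of [nat]. *)
Definition program := seq instr.

Record config := Config { line : nat; regs : nat -> nat }.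

Definition halted (P : program) (c : config) : Prop := size P <= line c.

(* A halted configuration is kept unchanged: a machine that has halted is
   regarded as staying in its final configuration for ever. *)
Definition step (P : program) (y : cantor_space) (c : config) : config :=
  let: Config l r := c in
  match onth P l with
  | None => c
  | Some (Zero i) => Config l.+1 [eta r with i |-> 0]
  | Some (Succ i) => Config l.+1 [eta r with i |-> (r i).+1]
  | Some (Transfer i j) => Config l.+1 [eta r with j |-> r i]
  | Some (Oracle i) => Config l.+1 [eta r with i |-> nat_of_bool (y (r i))]
  | Some (Jump i j q) => Config (if r i == r j then q else l.+1) r
  end.

(* An initial segment of the ordinals is represented by a type [W] with a
   reflexive well-order [le]. *)
Section OrdinalTime.
Context {W : Type} (le : rel W).

Definition before (v w : W) : Prop := le v w /\ v <> w.

Definition is_first (w : W) : Prop := forall v, ~ before v w.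

Definition is_succ (v w : W) : Prop :=
  before v w /\ ~ exists u, before v u /\ before u w.

Definition is_limit (w : W) : Prop :=
  ~ is_first w /\ forall v, ~ is_succ v w.

(* [liminf_before f w m]: the supremum over [v < w] of the infima of [f] on
   [v, w) is finite and equal to [m]. *)
Definition liminf_before (f : W -> nat) (w : W) (m : nat) : Prop :=
  supremums
    [set k | exists2 v, before v w &
             infimums (f @` [set u | le v u /\ before u w]) k] m.

Definition reg_limit (f : W -> nat) (w : W) (m : nat) : Prop :=
  liminf_before f w m \/ (~ (exists k, liminf_before f w k) /\ m = 0).

Record computation (P : program) (y : cantor_space) (c0 : config)
    (C : W -> config) : Prop := Computation {
  comp_first : forall w, is_first w -> C w = c0;
  comp_succ : forall v w, is_succ v w -> C w = step P y (C v);
  comp_limit : forall w, is_limit w ->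
    liminf_before (fun v => line (C v)) w (line (C w)) /\
    forall i, reg_limit (fun v => regs (C v) i) w (regs (C w) i) }.

End OrdinalTime.

Definition init (n : nat) : config := Config 0 [eta (fun=> 0) with 0 |-> n].

(* [yields P y n m] is P^y(n)\downarrow = m; P^y\downarrow = m is
   [yields P y 0 m], since then all registers are initially 0. *)
Definition yields (P : program) (y : cantor_space) (n m : nat) : Prop :=
  exists (W : Type) (le : rel W) (C : W -> config) (w : W),
    [/\ well_order le, computation le P y (init n) C,
        halted P (C w) & regs (C w) 0 = m].

Definition ITRM_decidable (X : set cantor_space) : Prop :=
  exists P : program, forall y : cantor_space,
    (X y -> yields P y 0 1) /\ (~ X y -> yields P y 0 0).

Definition cylinder (s : seq bool) : set cantor_space :=
  [set x | forall i, i < size s -> x i = nth false s i].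

(* The outer measure inducing Lebesgue (fair-coin) measure, for which the
   cylinder of [s] has measure 2 ^ - size s. *)
Definition lebesgue_outer (R : realType) (X : set cantor_space) : \bar R :=
  ereal_inf [set (\sum_(0 <= k <oo) ((2^-1 : R) ^+ size (s k))%:E)%E
            | s in [set s : nat -> seq bool | X `<=` \bigcup_k cylinder (s k)]].

(* Sets of outer measure 0 are Caratheodory measurable, so this says that X is
   measurable of measure 0. *)
Definition lebesgue_null (R : realType) (X : set cantor_space) : Prop :=
  lebesgue_outer R X = 0%E.

Definition nowhere_dense (T : topologicalType) (A : set T) : Prop :=
  (closure A)° = set0.

Definition meager (T : topologicalType) (X : set T) : Prop :=
  exists2 F : nat -> set T, (forall k, nowhere_dense (F k)) & X = \bigcup_k F k.

Definition ITRM_random_measure (R : realType) (x : cantor_space) : Prop :=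
  ~ exists X : set cantor_space,
      [/\ ITRM_decidable X, lebesgue_null R X & X x].

Definition ITRM_random_meager (x : cantor_space) : Prop :=
  ~ exists X : set cantor_space,
      [/\ ITRM_decidable X, meager X & X x].

Definition delete_bit (x : cantor_space) (n : nat) : cantor_space :=
  fun k => if k < n then x k else x k.+1.

Definition ITRM_autoreducible (x : cantor_space) : Prop :=
  exists P : program, forall n : nat,
    yields P (delete_bit x n) n (nat_of_bool (x n)).

Definition totally_incompressible (x : cantor_space) : Prop :=
  ~ ITRM_autoreducible x.

(* Main.v *)
Require Import Defs.
From HB Require Import structures.
From mathcomp Require Import all_boot all_order all_algebra.
From mathcomp Require Import all_classical all_reals all_analysis.
From mathcomp Require Import wochoice zify.

(** Let [P] witness that [x] is autoreducible. The set [X] of all [y] from which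
    [P] recovers every bit [y n] out of [y] without its [n]th bit contains [x],
    and no [y] in [X] has a neighbour in [X] differing from it in one bit.

    [X] is decidable: it is the halting set of a machine running [P] on all [n]
    in turn, and halting problems of infinite time register machines are
    decidable. Indeed a run does not halt iff it returns to some earlier
    configuration without any register, or the line, having been smaller in
    between. Such a loop is found by keeping the configurations that have not
    been undercut, which form a chain, on a stack coded by a natural number. As
    the stack must not overflow when registers do, there is one stack for every
    set of registers, holding the configurations which are 0 on that set.

    [X] is null and meager: the countable chain condition for measure and
    category yields a countable stage at which the runs from all [y] outside a
    small set have halted or looped, so that [X] is measurable, resp. has the
    Baire property. If [X] were not small, it would have density more than 1/2,
    resp. be comeager, in some cylinder, and so would its image under the flip
    of a bit beyond that cylinder; but these two sets are disjoint. *)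

Set Implicit Arguments.
Unset Strict Implicit.
Unset Printing Implicit Defensive.

Import Order.TTheory.

Local Open Scope classical_set_scope.

(** * Well-orders and inferior limits *)

(** A single run halts at a countable stage, but no countable stage need serve all oracles, so [X]
    is at first only a union of omega_1 many measurable sets; hence the stabilization up to a small
    set. Measure, category and single runs are treated at once by [frame]: on the one-point space,
    where small means empty, the same argument says that every run of length omega_1 loops.

    [yields] quantifies over arbitrary well-ordered types, so runs to be compared live over
    different time types; the relation [sametime] takes the place of comparing ordinals.

    At limits a stack code is a liminf of numbers, not of sets. The rule for pushing makes it the
    code of the elements that are present from some time on, unless it overflows. Overflow, the
    obstacle for the stacks, is what lets the check of all bits come to an end: the bit counter
    returns to 0 when it has run through all of them.

    Both machines are written as simultaneous register updates; the compiled programs agree with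
    them at limits because between two updates a register shows only its old or its new value. *)

Section WellOrder.
Context {W : Type} {le : rel W} (wo : well_order le).
Local Notation "v ≼ w" := (is_true (le v w)) (at level 70).
Local Notation "v ≺ w" := (before le v w) (at level 70).

Lemma wo_min (A : W -> Prop) :
  (exists w, A w) -> exists2 z, A z & forall x, A x -> z ≼ x.
Proof.
move=> [w Aw].
have [|z [[zA zmin] _]] := @wo (fun x => `[< A x >]).
  by exists w; apply/asboolP.
exists z; first exact/asboolP.
by move=> x Ax; apply: zmin; apply/asboolP.
Qed.

Lemma wo_total x y : x ≼ y \/ y ≼ x.
Proof.
have [|z [-> | ->] zmin] := @wo_min (fun z => z = x \/ z = y).
- by exists x; left.
- by left; apply: zmin; right.
- by right; apply: zmin; left.
Qed.

Lemma wo_refl x : x ≼ x.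
Proof. by case: (wo_total x x). Qed.

(** [well_order] asks only that every inhabited set have a unique minimum; antisymmetry is
    uniqueness for the set with elements [x] and [y]. *)
Lemma wo_anti x y : x ≼ y -> y ≼ x -> x = y.
Proof.
move=> xy yx.
have [|z [_ zuniq]] := @wo (fun u => `[< u = x \/ u = y >]).
  by exists x; apply/asboolP; left.
rewrite -[x]zuniq; last first.
  by split; [apply/asboolP; left | move=> u /asboolP[->//|->//]; exact: wo_refl].
rewrite -[y]zuniq //.
by split; [apply/asboolP; right | move=> u /asboolP[->//|->//]; exact: wo_refl].
Qed.

Lemma wo_trans x y z : x ≼ y -> y ≼ z -> x ≼ z.
Proof.
move=> xy yz.
have [|u uA umin] := @wo_min (fun u => [\/ u = x, u = y | u = z]).
  by exists x; apply: Or31.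
have ux := umin x (Or31 _ _ erefl); have uy := umin y (Or32 _ _ erefl).
have uz := umin z (Or33 _ _ erefl).
case: uA => E; rewrite E in ux uy uz => //.
- by rewrite (wo_anti xy ux).
- by rewrite -(wo_anti yz uy).
Qed.

Lemma beforeW x y : x ≺ y -> x ≼ y. Proof. by case. Qed.

Lemma before_irr x : ~ x ≺ x. Proof. by case. Qed.

Lemma le_before x y : x ≼ y -> x = y \/ x ≺ y.
Proof. by move=> xy; have [->|] := EM (x = y); [left|right]. Qed.

Lemma le_before_trans x y z : x ≼ y -> y ≺ z -> x ≺ z.
Proof.
move=> xy [yz nyz]; split; first exact: wo_trans yz.
by move=> xz; apply: nyz; apply: wo_anti; rewrite // -xz.
Qed.

Lemma before_le_trans x y z : x ≺ y -> y ≼ z -> x ≺ z.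
Proof.
move=> [xy nxy] yz; split; first exact: wo_trans yz.
by move=> xz; apply: nxy; apply: wo_anti; rewrite // xz.
Qed.

Lemma before_trans x y z : x ≺ y -> y ≺ z -> x ≺ z.
Proof. by move=> /beforeW; exact: le_before_trans. Qed.

Lemma before_le_false x y : x ≺ y -> y ≼ x -> False.
Proof. by move=> /before_le_trans h /h /before_irr. Qed.

Lemma le_or_before x y : x ≼ y \/ y ≺ x.
Proof.
have [|] := wo_total x y; first by left.
by move=> /le_before[->|]; [left; exact: wo_refl | right].
Qed.

Lemma nle_before x y : ~ x ≼ y -> y ≺ x.
Proof. by case: (le_or_before x y). Qed.

Lemma nbefore_le x y : ~ x ≺ y -> y ≼ x.
Proof. by case: (le_or_before y x). Qed.

Lemma wo_max x y : exists z, x ≼ z /\ y ≼ z.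
Proof. by case: (wo_total x y); [exists y | exists x]; split=> //; exact: wo_refl. Qed.

Lemma wo_ind (Q : W -> Prop) :
  (forall w, (forall v, v ≺ w -> Q v) -> Q w) -> forall w, Q w.
Proof.
move=> H w; apply: contrapT => nQw.
have [|z nQz zmin] := @wo_min (fun u => ~ Q u); first by exists w.
by apply: nQz; apply: H => v vz; apply: contrapT => /zmin /(before_le_false vz).
Qed.

Lemma before_wf : well_founded (before le).
Proof. by move=> w; elim/wo_ind: w => w IH; constructor. Qed.

Lemma first_ex (w : W) : exists2 a, is_first le a & forall x, a ≼ x.
Proof.
have [|z _ zmin] := @wo_min (fun=> True); first by exists w.
exists z; last by move=> x; exact: zmin.
by move=> v vz; exact: before_le_false vz (zmin v I).
Qed.

Lemma first_le a x : is_first le a -> a ≼ x.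
Proof. by move=> fa; apply: nbefore_le; exact: fa. Qed.

Lemma first_uniq a b : is_first le a -> is_first le b -> a = b.
Proof. by move=> fa fb; apply: wo_anti; exact: first_le. Qed.

Lemma succ_le v s x : is_succ le v s -> v ≺ x -> s ≼ x.
Proof. by move=> [_ n] vx; apply: nbefore_le => xs; apply: n; exists x. Qed.

Lemma before_succ v s x : is_succ le v s -> x ≺ s -> x ≼ v.
Proof. by move=> [_ n] xs; apply: nbefore_le => vx; apply: n; exists x. Qed.

Lemma succ_ex v w : v ≺ w -> exists2 s, is_succ le v s & s ≼ w.
Proof.
move=> vw; have [|z vz zmin] := @wo_min (fun u => v ≺ u); first by exists w.
exists z; last exact: zmin.
by split=> // -[u [/zmin zu /before_le_false]]; exact.
Qed.

Lemma succ_uniq v s t : is_succ le v s -> is_succ le v t -> s = t.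
Proof.
by move=> vs vt; apply: wo_anti; [apply: (succ_le vs _)|apply: (succ_le vt _)];
  case: vs vt => [? _] [? _].
Qed.

Lemma succ_inj v u s : is_succ le v s -> is_succ le u s -> v = u.
Proof.
by move=> vs us; apply: wo_anti; [apply: (before_succ us _)|apply: (before_succ vs _)];
  case: vs us => [? _] [? _].
Qed.

Lemma wo_cases w : [\/ is_first le w, exists v, is_succ le v w | is_limit le w].
Proof.
have [fw|nfw] := EM (is_first le w); first exact: Or31.
have [sw|nsw] := EM (exists v, is_succ le v w); first exact: Or32.
by apply: Or33; split=> // v sv; apply: nsw; exists v.
Qed.

Lemma succ_not_limit v w : is_succ le v w -> is_limit le w -> False.
Proof. by move=> vw [_] /(_ _ vw). Qed.

Lemma limit_ex w : is_limit le w -> exists v, v ≺ w.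
Proof. by move=> [nf _]; apply: contrapT => n; apply: nf => v vw; apply: n; exists v. Qed.

Lemma limit_succ w v s : is_limit le w -> v ≺ w -> is_succ le v s -> s ≺ w.
Proof.
move=> lw vw vs; have [E|//] := le_before (succ_le vs vw).
by rewrite E in vs; case: lw => _ /(_ _ vs).
Qed.

Lemma limit_dense w v : is_limit le w -> v ≺ w -> exists2 u, v ≺ u & u ≺ w.
Proof.
move=> lw vw; have [s vs sw] := succ_ex vw.
by exists s; [case: vs | exact: limit_succ vs].
Qed.

Lemma limitI w : (exists v, v ≺ w) ->
  (forall v, v ≺ w -> exists2 u, v ≺ u & u ≺ w) -> is_limit le w.
Proof.
move=> [v vw] H; split; first by move=> /(_ _ vw).
by move=> u uw; case: (uw) => /H[x ux xw] []; exists x.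
Qed.

Lemma sup_ex (A : W -> Prop) b : (forall x, A x -> x ≼ b) ->
  exists s, [/\ s ≼ b, forall x, A x -> x ≼ s &
    forall t, t ≺ s -> exists2 x, A x & t ≺ x].
Proof.
move=> Ab; have [|s sub smin] := @wo_min (fun s => forall x, A x -> x ≼ s).
  by exists b.
exists s; split=> //; first exact: smin.
move=> t ts; apply: contrapT => n; apply: (before_le_false ts); apply: smin.
by move=> x Ax; apply: nbefore_le => tx; apply: n; exists x.
Qed.

Definition evt (w : W) (Q : W -> Prop) :=
  exists2 v, v ≺ w & forall u, v ≼ u -> u ≺ w -> Q u.
Definition cof (w : W) (Q : W -> Prop) :=
  forall v, v ≺ w -> exists u, [/\ v ≼ u, u ≺ w & Q u].

Lemma evtI w (Q R : W -> Prop) : evt w Q -> evt w R -> evt w (fun u => Q u /\ R u).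
Proof.
move=> [v vw vQ] [v' vw' vR]; have [vv|vv] := wo_total v v'.
  by exists v' => // u u1 u2; split; [apply: vQ => //; exact: wo_trans u1 | exact: vR].
by exists v => // u u1 u2; split; [exact: vQ | apply: vR => //; exact: wo_trans u1].
Qed.

Lemma evt_mono w (Q R : W -> Prop) :
  (forall u, u ≺ w -> Q u -> R u) -> evt w Q -> evt w R.
Proof. by move=> QR [v vw vQ]; exists v => // u vu uw; apply: QR => //; exact: vQ. Qed.

Lemma cof_mono w (Q R : W -> Prop) :
  (forall u, u ≺ w -> Q u -> R u) -> cof w Q -> cof w R.
Proof.
by move=> QR cQ v /cQ[u [vu uw Qu]]; exists u; split=> //; exact: QR.
Qed.

Lemma evt_cof w (Q R : W -> Prop) : evt w Q -> cof w R ->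
  exists2 u, u ≺ w & Q u /\ R u.
Proof. by move=> [v vw vQ] /(_ _ vw)[u [vu uw Ru]]; exists u => //; split=> //; exact: vQ. Qed.

Lemma evt_cofI w (Q R : W -> Prop) : evt w Q -> cof w R ->
  cof w (fun u => Q u /\ R u).
Proof.
move=> [v vw vQ] cR t tw; have [vt|tv] := wo_total v t.
  by have [u [tu uw Ru]] := cR _ tw; exists u; split=> //; split=> //; apply: vQ => //; exact: wo_trans tu.
by have [u [vu uw Ru]] := cR _ vw; exists u; split=> //; [exact: wo_trans vu | split=> //; exact: vQ].
Qed.

Lemma not_evt w Q : ~ evt w Q -> cof w (fun u => ~ Q u).
Proof.
move=> nQ v vw; apply: contrapT => n; apply: nQ; exists v => // u vu uw.
by apply: contrapT => nQu; apply: n; exists u.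
Qed.

(** The limit rule for registers with its quantifiers exposed: a finite liminf of naturals is
    attained cofinally, and the second case is overflow. In this form it transfers between time
    types and shows its measurability. *)
Definition rlim (f : W -> nat) (w : W) (m : nat) :=
  (evt w (fun u => m <= f u) /\ cof w (fun u => f u = m)) \/
  (m = 0 /\ forall k, evt w (fun u => k <= f u)).

(** Infima over final segments below [w] are minima, and a finite supremum of naturals is attained.
    Without any time before [w] the supremum would be that of the empty set, which is 0. *)
Lemma liminf_beforeP f w m : (exists v, v ≺ w) -> liminf_before le f w m <->
  evt w (fun u => m <= f u) /\ cof w (fun u => f u = m).
Proof.
move=> [v0 v0w]; rewrite /liminf_before /supremums /infimums.
set I := fun v => f @` [set u | le v u /\ before le u w].
set A := [set k | _].
have infP v k : v ≺ w -> (I v) k -> lbound (I v) k -> A k.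
  move=> vw Ik lk; exists v => //; split=> // x; exact.
have Aex v : v ≺ w -> exists2 k, A k & exists u, [/\ v ≼ u, u ≺ w, f u = k & forall u', v ≼ u' -> u' ≺ w -> k <= f u'].
  move=> vw.
  have ex : exists k, `[< exists u, [/\ v ≼ u, u ≺ w & f u = k] >].
    by exists (f v); apply/asboolP; exists v; split=> //; exact: wo_refl.
  have [k /asboolP[u [vu uw fu]] kmin] := ex_minnP ex.
  have kle u' : v ≼ u' -> u' ≺ w -> k <= f u'.
    by move=> vu' uw'; apply: kmin; apply/asboolP; exists u'.
  exists k; last by exists u.
  apply: (infP v) => //; first by exists u.
  by move=> _ [u' [vu' uw'] <-]; rewrite leEnat; exact: kle.
have Ale k v : A k -> v ≺ w -> exists u, [/\ v ≼ u, u ≺ w & k <= f u].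
  move=> [v' v'w [lk _]] vw; have [vv|vv] := wo_total v v'.
    by exists v'; split=> //; rewrite -leEnat; apply: lk; exists v' => //; split=> //; exact: wo_refl.
  by exists v; split=> //; [exact: wo_refl | rewrite -leEnat; apply: lk; exists v].
split.
  move=> [ubm lbm].
  (* Otherwise [m] is 0, which forces an element of the inhabited set [A] to be 0, or the
     predecessor of [m] is already an upper bound. *)
  have Am : A m.
    apply: contrapT => nA.
    have [m0|] := posnP m.
      have [k Ak _] := Aex _ v0w; have := ubm _ Ak; rewrite leEnat m0 leqn0 => /eqP k0.
      by apply: nA; rewrite m0 -k0.
    case: m ubm lbm nA => // m ubm lbm nA _.
    have /lbm : ubound A m.
      move=> k Ak; have := ubm _ Ak; rewrite !leEnat leq_eqVlt => /orP[/eqP E|//].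
      by rewrite E in Ak.
    by rewrite leEnat ltnn.
  split.
    case: Am => v vw [lm _]; exists v => // u vu uw.
    by rewrite -leEnat; apply: lm; exists u.
  move=> v vw; case: Am => v' v'w [lm _].
  have [v'' [v1 v2 v''w]] : exists v'', [/\ v ≼ v'', v' ≼ v'' & v'' ≺ w].
    by case: (wo_total v v') => h; [exists v' | exists v]; split=> //; exact: wo_refl.
  have [k Ak [u [vu uw fu _]]] := Aex _ v''w.
  exists u; split=> //; first exact: wo_trans vu.
  apply/eqP; rewrite eqn_leq; apply/andP; split.
    by rewrite fu; have := ubm _ Ak; rewrite leEnat.
  by rewrite -leEnat; apply: lm; exists u => //; split=> //; exact: wo_trans vu.
move=> [[v vw vm] cm]; split.
  move=> k [v' v'w [lk _]]; have [u [vu uw <-]] := cm _ v'w.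
  by apply: lk; exists u.
move=> x; apply; have [u [vu uw fu]] := cm _ vw.
apply: (infP v) => //; first by exists u.
by move=> _ [u' [vu' uw'] <-]; rewrite leEnat; exact: vm.
Qed.

Lemma rlim_ex f w : (exists v, v ≺ w) -> exists m, rlim f w m.
Proof.
move=> [v0 v0w]; have [inf|] := EM (forall k, evt w (fun u => k <= f u)).
  by exists 0; right.
move=> /existsNP[k nk].
have ex : exists k, `[< ~ evt w (fun u => k <= f u) >] by exists k; apply/asboolP.
(* The least bound that is not eventually respected is the successor of the liminf. *)
have [[|m] /asboolP nm mmin] := ex_minnP ex.
  by case: nm; exists v0.
have em : evt w (fun u => m <= f u).
  by apply: contrapT => /asboolP/mmin; rewrite ltnn.
exists m; left; split=> //.
have := evt_cofI em (not_evt nm); apply: cof_mono => u _ [h1 /negP].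
by rewrite -leqNgt => h2; apply/eqP; rewrite eqn_leq h1 h2.
Qed.

Lemma rlim_uniq f w m n : (exists v, v ≺ w) -> rlim f w m -> rlim f w n -> m = n.
Proof.
move=> [v0 v0w].
have aux a b : rlim f w a -> rlim f w b -> a <= b.
  move=> [[ea ca]|[-> ia]] // [[eb cb]|[-> ib]].
    by have [u _ [h <-]] := evt_cof ea cb.
  by have [u _ [h1 h2]] := evt_cof (ib a.+1) ca; rewrite h2 ltnn in h1.
by move=> h1 h2; apply/eqP; rewrite eqn_leq !aux.
Qed.

Lemma reg_limitP f w m : (exists v, v ≺ w) -> reg_limit le f w m <-> rlim f w m.
Proof.
move=> exw; rewrite /reg_limit /rlim; split.
  move=> [/(liminf_beforeP _ _ exw)|[nex ->]]; first by left.
  have [k [rk|[_ rk]]] := rlim_ex f exw; last by right.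
  by case: nex; exists k; apply/liminf_beforeP.
move=> [/(liminf_beforeP _ _ exw)|[-> ik]]; first by left.
right; split=> // -[k /(liminf_beforeP _ _ exw)[_ ck]].
by have [u _ [h1 h2]] := evt_cof (ik k.+1) ck; rewrite h2 ltnn in h1.
Qed.

Lemma rlim_eq f g w m : evt w (fun u => f u = g u) -> rlim f w m -> rlim g w m.
Proof.
move=> fg [[e c]|[-> i]]; [left; split | right; split=> //].
- by apply: evt_mono (evtI fg e) => u _ [<-].
- by apply: cof_mono (evt_cofI fg c) => u _ [<-].
- by move=> k; apply: evt_mono (evtI fg (i k)) => u _ [<-].
Qed.

Lemma rlim_const f w m k : (exists v, v ≺ w) ->
  evt w (fun u => f u = k) -> rlim f w m -> m = k.
Proof.
move=> exw fk rm; apply: (rlim_uniq exw rm); left; split.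
  by apply: evt_mono fk => u _ E; rewrite E.
by move=> v vw; case: fk => v' v'w h; case: (wo_total v v') => vv;
  [exists v' | exists v]; split=> //; rewrite ?h //; exact: wo_refl.
Qed.

End WellOrder.

Arguments evt {W} le w Q.
Arguments cof {W} le w Q.
Arguments rlim {W} le f w m.

(** * Transfinite runs *)

Definition state := nat -> nat.

(** No initial state is prescribed and nothing is asked before [a]: the tail of a run is a run, so a
    loop can be replayed from any of its returns. *)
Record rrun {W : Type} (le : rel W) (F : state -> state) (C : W -> state) (a : W)
    : Prop := RRun {
  rrun_succ : forall v w, le a v -> is_succ le v w -> C w = F (C v);
  rrun_lim : forall w, before le a w -> is_limit le w ->
    forall i, rlim le (fun v => C v i) w (C w i) }.

Section RunExistence.
Context {W : Type} {le : rel W} (wo : well_order le).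

Lemma wo_rec (S : Type) (x0 : S) (G : W -> (W -> S) -> S) :
  (forall w g g', (forall v, before le v w -> g v = g' v) -> G w g = G w g') ->
  exists C : W -> S, forall w, C w = G w C.
Proof.
move=> Gext.
pose ext w (g : forall v, before le v w -> S) : W -> S :=
  fun v => if pselect (before le v w) is left H then g v H else x0.
pose D := Fix (before_wf wo) (fun=> S) (fun w g => G w (ext w g)).
exists D => w; rewrite /D Fix_eq; last first.
  move=> x f g fg; apply: Gext => v vx; rewrite /ext.
  by case: pselect => // H; rewrite fg.
by apply: Gext => v vw; rewrite /ext; case: pselect.
Qed.

Lemma rrun_ex (F : state -> state) (r0 : state) :
  exists C : W -> state, (forall w, is_first le w -> C w = r0) /\
    forall a, rrun le F C a.
Proof.
pose G w (g : W -> state) : state :=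
  if pselect (is_first le w) then r0 else
  if pselect (exists v, is_succ le v w) is left H then F (g (projT1 (cid H)))
  else fun i => xget 0 [set m | rlim le (fun v => g v i) w m].
have [|C CE] := @wo_rec state r0 G.
  move=> w g g' gg; rewrite /G; case: pselect => // nf; case: pselect => [H|nsw].
    by case: (cid H) => v [vw ?] /=; rewrite gg.
  have [v vw] : exists v, before le v w.
    by apply: contrapT => n; apply: nf => v vw; apply: n; exists v.
  apply/funext => i; congr xget; apply/seteqP; split => m /=; apply: (rlim_eq wo);
    by exists v => // u _ uw; rewrite gg.
exists C; split=> [w fw|a]; first by rewrite CE /G; case: pselect.
split=> [v w av vw|w aw lw i].
  rewrite CE /G; case: pselect => [/(_ v)[]|nf]; first by case: vw.
  case: pselect => [H|[]]; last by exists v.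
  by case: (cid H) => v' /= v'w; rewrite (succ_inj wo vw v'w).
rewrite CE /G; case: pselect => [/(_ _ aw) //|nf].
case: pselect => [[v vw]|nsw]; first by case: (succ_not_limit vw lw).
have [m rm] := rlim_ex wo (fun v => C v i) (limit_ex lw).
by case: xgetP => [x _ //|/(_ m)].
Qed.

End RunExistence.

(** * Comparing runs over different time types *)

Section Comparison.
Context {W1 W2 : Type} {le1 : rel W1} {le2 : rel W2}.
Hypotheses (wo1 : well_order le1) (wo2 : well_order le2).
Variables (a : W1) (b : W2).

(** [u] comes as long after [a] as [v] comes after [b]. *)
Inductive sametime : W1 -> W2 -> Prop :=
  Sametime u v of
    (forall u', le1 a u' -> before le1 u' u ->
       exists v', [/\ le2 b v', before le2 v' v & sametime u' v']) &
    (forall v', le2 b v' -> before le2 v' v ->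
       exists u', [/\ le1 a u', before le1 u' u & sametime u' v']) :
  sametime u v.

Lemma sametimeE u v : sametime u v ->
  (forall u', le1 a u' -> before le1 u' u ->
       exists v', [/\ le2 b v', before le2 v' v & sametime u' v']) /\
  (forall v', le2 b v' -> before le2 v' v ->
       exists u', [/\ le1 a u', before le1 u' u & sametime u' v']).
Proof. by case. Qed.

(** Comparability of well-orders, by induction on both arguments: if neither time outruns the other,
    their segments correspond and the constructor applies. *)
Lemma sametime_total u v : [\/ sametime u v,
  exists v', [/\ le2 b v', before le2 v' v & sametime u v'] |
  exists u', [/\ le1 a u', before le1 u' u & sametime u' v]].
Proof.
move: v; elim/(@wo_ind _ _ wo1): u => u IHu; elim/(@wo_ind _ _ wo2) => v IHv.
have [h|n1] := EM (exists v', [/\ le2 b v', before le2 v' v & sametime u v']).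
  exact: Or32.
have [h|n2] := EM (exists u', [/\ le1 a u', before le1 u' u & sametime u' v]).
  exact: Or33.
apply: Or31; constructor=> [u' au u'u|v' bv v'v].
  case: (IHu _ u'u v) => [h|//|[u2 [au2 u2u' h]]]; case: n2.
    by exists u'.
  by exists u2; split=> //; exact: (before_trans wo1 u2u').
case: (IHv _ v'v) => [h|[v2 [bv2 v2v' h]]|//]; case: n1.
  by exists v'.
by exists v2; split=> //; exact: (before_trans wo2 v2v').
Qed.

Lemma sametime_uniq u v v' : le2 b v -> le2 b v' ->
  sametime u v -> sametime u v' -> v = v'.
Proof.
have aux x : (forall v v', le2 b v -> le2 b v' -> sametime x v -> sametime x v' ->
    ~ before le2 v v').
  elim/(@wo_ind _ _ wo1): x => x IH y y' by_ by' xy xy' yy'.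
  have [_ /(_ _ by_ yy')[x' [ax' x'x x'y]]] := sametimeE xy'.
  have [/(_ _ ax' x'x)[y2 [by2 y2y x'y2]] _] := sametimeE xy.
  exact: (IH _ x'x _ _ by2 by_ x'y2 x'y).
move=> bv bv' uv uv'; apply: (wo_anti wo2); apply: (nbefore_le wo2); exact: (aux u).
Qed.

Lemma sametime_mono u v u' v' : le1 a u -> le2 b v -> sametime u v -> sametime u' v' ->
  before le1 u u' -> before le2 v v'.
Proof.
move=> au bv uv /sametimeE[/(_ u au) h _] /h[v2 [bv2 v2v' uv2]].
by rewrite (sametime_uniq bv bv2 uv uv2).
Qed.

Lemma sametime_mono_inv u v u' v' : le1 a u -> le1 a u' -> le2 b v -> le2 b v' ->
  sametime u v -> sametime u' v' -> before le2 v v' -> before le1 u u'.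
Proof.
move=> au au' bv bv' uv uv' vv'.
have [h|//] := le_or_before wo1 u' u; have [E|u'u] := le_before h.
  rewrite E in uv'; case: vv' => _; case.
  exact: (sametime_uniq bv bv' uv uv').
by case: (before_irr (before_trans wo2 vv' (sametime_mono au' bv' uv' uv u'u))).
Qed.

Lemma sametime_start u v : sametime u v -> u = a -> le2 b v -> v = b.
Proof.
move=> /sametimeE[_ h] E bv; apply: contrapT => nvb.
have [u' [au' u'a _]] := h b (wo_refl wo2 b) (conj bv (fun E => nvb (esym E))).
by rewrite E in u'a; exact: (before_le_false wo1 u'a).
Qed.

Section Evt.
Variables (u : W1) (v : W2).
Hypotheses (au : before le1 a u) (bv : before le2 b v) (uv : sametime u v).
Variables (Q1 : W1 -> Prop) (Q2 : W2 -> Prop).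
Hypothesis Q12 : forall u' v', le1 a u' -> before le1 u' u -> le2 b v' ->
  sametime u' v' -> Q1 u' -> Q2 v'.

Lemma sametime_evt : evt le1 u Q1 -> evt le2 v Q2.
Proof.
move=> [t tu tQ].
have [s [ts as_ su]] : exists s, [/\ le1 t s, le1 a s & before le1 s u].
  by case: (wo_total wo1 t a) => h; [exists a|exists t]; split=> //; exact: wo_refl.
have [h1 h2] := sametimeE uv; have [s' [bs' s'v ss']] := h1 _ as_ su.
exists s' => // y s'y yv; have by_ := wo_trans wo2 bs' s'y.
have [x [ax xu xy]] := h2 _ by_ yv.
apply: (Q12 ax xu by_ xy); apply: tQ => //; apply: (wo_trans wo1 ts).
apply: (nbefore_le wo1) => xs.
by case: (before_le_false wo2 (sametime_mono ax by_ xy ss' xs)).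
Qed.

Lemma sametime_cof : cof le1 u Q1 -> cof le2 v Q2.
Proof.
move=> cQ t tv.
have [s [ts bs sv]] : exists s, [/\ le2 t s, le2 b s & before le2 s v].
  by case: (wo_total wo2 t b) => h; [exists b|exists t]; split=> //; exact: wo_refl.
have [h1 h2] := sametimeE uv; have [s' [as' s'u ss']] := h2 _ bs sv.
have [x [s'x xu Qx]] := cQ _ s'u; have ax := wo_trans wo1 as' s'x.
have [y [by_ yv xy]] := h1 _ ax xu.
exists y; split=> //; last exact: (Q12 ax).
apply: (wo_trans wo2 ts); apply: (nbefore_le wo2) => ys.
by case: (before_le_false wo1 (sametime_mono_inv ax as' by_ bs xy ss' ys)).
Qed.

End Evt.

(** Determinism across time types. The correspondence takes successors to successors and limits to
    limits, and by [sametime_evt] and [sametime_cof] the liminf rule sees the same data on both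
    sides. *)
Lemma sametime_state F C1 C2 : rrun le1 F C1 a -> rrun le2 F C2 b -> C1 a = C2 b ->
  forall u v, le1 a u -> le2 b v -> sametime u v -> C1 u = C2 v.
Proof.
move=> r1 r2 C12; elim/(@wo_ind _ _ wo1) => u IH v au bv uv.
have [E|au'] := le_before au.
  by rewrite (sametime_start uv _ bv) // -E.
have [h1 h2] := sametimeE uv.
have bv' : before le2 b v.
  by have [v' [/(le_before_trans wo2) h v'v _]] := h1 _ (wo_refl wo1 a) au'; exact: h.
case: (@wo_cases _ le1 u) => [fu|[p pu]|lu]; first by case: (fu _ au').
  have ap := before_succ wo1 pu au'.
  have [q [bq qv pq]] := h1 _ ap (proj1 pu).
  have sq : is_succ le2 q v.
    split=> // -[x [qx xv]]; have bx := wo_trans wo2 bq (beforeW qx).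
    have [y [ay yu yx]] := h2 _ bx xv.
    have py := sametime_mono_inv ap ay bq bx pq yx qx.
    exact: (before_le_false wo1 py (before_succ wo1 pu yu)).
  by rewrite (rrun_succ r1 ap pu) (rrun_succ r2 bq sq); congr F; apply: IH => //; case: pu.
have lv : is_limit le2 v.
  apply: (limitI (le := le2)); first by exists b.
  move=> x xv.
  have [s [xs bs sv]] : exists s, [/\ le2 x s, le2 b s & before le2 s v].
    by case: (wo_total wo2 x b) => h; [exists b|exists x]; split=> //; exact: wo_refl.
  have [y [ay yu yx]] := h2 _ bs sv.
  have [z yz zu] := limit_dense wo1 lu yu; have az := wo_trans wo1 ay (beforeW yz).
  have [t [bt tv zt]] := h1 _ az zu.
  by exists t => //; exact: (le_before_trans wo2 xs (sametime_mono ay bs yx zt yz)).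
apply/funext => i.
have exv : exists x, before le2 x v by exists b.
have ri := rrun_lim r1 au' lu i.
have rv := rrun_lim r2 bv' lv i.
have IH' x y : le1 a x -> before le1 x u -> le2 b y -> sametime x y -> C1 x i = C2 y i.
  by move=> ax xu by_ xy; rewrite (IH _ xu _ ax by_ xy).
have rv' : rlim le2 (fun v => C2 v i) v (C1 u i); last first.
  exact: (rlim_uniq exv rv' rv).
case: ri => [[e c]|[E i1]]; [left; split | right; split=> // k].
- apply: (sametime_evt au' uv _ e) => x y ax xu by_ xy.
  by rewrite (IH' _ _ ax xu by_ xy).
- apply: (sametime_cof bv' uv _ c) => x y ax xu by_ xy.
  by rewrite (IH' _ _ ax xu by_ xy).
- apply: (sametime_evt au' uv _ (i1 k)) => x y ax xu by_ xy.
  by rewrite (IH' _ _ ax xu by_ xy).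
Qed.

End Comparison.

Definition loop {W : Type} (le : rel W) (C : W -> state) (s t : W) :=
  [/\ before le s t, C s = C t &
      forall u, le s u -> le u t -> forall i, C s i <= C u i].

Section Loop.
Context {W : Type} {le : rel W} (wo : well_order le).
Variables (F : state -> state) (C : W -> state).

(** The state at a limit of repetitions is again [C s], as no register has been
    smaller. *)
Lemma loop_forever s t : rrun le F C s -> loop le C s t ->
  forall w, le s w -> exists u, [/\ le s u, before le u t & C w = C u].
Proof.
move=> rC [st Cst Cge] w sw.
(* [V] collects the returns to [C s] up to [w] with nothing undercut so far; its supremum [m] is
   itself a return. From [m] on the run repeats the one from [s], so [w] lies at most one period
   beyond [m], or there would be a later return. *)
pose V x := [/\ le s x, le x w, C x = C s &
  forall u, le s u -> le u x -> forall i, C s i <= C u i].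
have Vs : V s.
  split=> //; [exact: wo_refl | move=> u su us i].
  by rewrite (wo_anti wo su us).
have [|m [mw Vm mdense]] := sup_ex wo (A := V) (b := w); first by move=> x [].
have VM : V m.
  have sm := Vm _ Vs.
  have [Vm'|nVm] := EM (V m); first by [].
  have dense x : before le x m -> exists2 y, V y & before le x y /\ before le y m.
    move=> /mdense[y Vy xy]; exists y => //; split=> //.
    by have [E|//] := le_before (Vm _ Vy); rewrite E in Vy.
  have sm' : before le s m.
    by have [E|//] := le_before sm; rewrite E in Vs.
  have lm : is_limit le m.
    apply: (limitI (le := le)); first by exists s.
    by move=> x /dense[y _ [xy ym]]; exists y.
  have Cge' u : le s u -> before le u m -> forall i, C s i <= C u i.
    by move=> su /dense[y [_ _ _ h] [uy _]]; exact: h (beforeW uy).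
  have Cm : C m = C s.
    apply/funext => i.
    apply: (rlim_uniq _ (rrun_lim rC sm' lm i)); first by exists s.
    left; split; first by exists s => // u su um; exact: Cge'.
    by move=> x /dense[y [_ _ Cy _] [xy ym]]; exists y; split; rewrite ?Cy //; exact: beforeW.
  split=> // u su um i; have [->|um'] := le_before um; last exact: Cge'.
  by rewrite Cm.
have [sm _ Cm Cgem] := VM.
have rm : rrun le F C m.
  split=> [v x mv vx|x mx lx i]; first by apply: (rrun_succ rC) vx; exact: (wo_trans wo sm).
  by apply: (rrun_lim rC) lx i; exact: (le_before_trans wo sm).
have inst := sametime_state wo wo rm rC Cm.
case: (sametime_total wo wo m s w t) => [h|[u [su ut h]]|[t' [mt' t'w h]]].
- have := inst _ _ mw (beforeW st) h; rewrite -Cst => E.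
  by exists s; split=> //; exact: wo_refl.
- by exists u; split=> //; exact: inst.
- have Ct' : C t' = C s by rewrite (inst _ _ mt' (beforeW st) h).
  have mt'' : before le m t'.
    have [E|//] := le_before mt'; rewrite -E in h.
    have E' := sametime_start wo wo h erefl (beforeW st).
    by rewrite E' in st; case: (before_irr st).
  have Vt' : V t'.
    split=> //; [exact: (wo_trans wo sm)|exact: beforeW|].
    move=> u su ut' i; have [um|mu] := wo_total wo u m; first exact: Cgem.
    have [->|ut''] := le_before ut'; first by rewrite Ct'.
    have [h1 _] := sametimeE h; have [u' [su' u't uu']] := h1 _ mu ut''.
    by rewrite (inst _ _ mu su' uu'); apply: Cge => //; exact: beforeW.
  by case: (before_le_false wo mt'' (Vm _ Vt')).
Qed.

End Loop.

(** This makes a loop a certificate of non-halting: a run from the same state over another time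
    type, however long, meets only states seen before [t]. If [w'] lies beyond the loop, the loop is
    carried over along [sametime] and repeats there for ever. *)
Lemma loop_capture {W W' : Type} {le : rel W} {le' : rel W'} F C C' a a' s t w' :
  well_order le -> well_order le' ->
  rrun le F C a -> rrun le' F C' a' -> C a = C' a' ->
  le a s -> loop le C s t -> le' a' w' ->
  exists u, [/\ le a u, before le u t & C u = C' w'].
Proof.
move=> wo wo' r r' Ca as_ L aw'; have [st Cst Cge] := L.
have at_ := wo_trans wo as_ (beforeW st).
have inst := sametime_state wo wo' r r' Ca.
case: (sametime_total wo wo' a a' t w') => [h|[t' [at' t'w' h]]|[u [au ut h]]].
- by exists s; split=> //; rewrite Cst; exact: inst.
- have [h1 h2] := sametimeE h; have [s' [as' s't' ss']] := h1 _ as_ st.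
  have L' : loop le' C' s' t'.
    split=> //; first by rewrite -(inst _ _ as_ as' ss') -(inst _ _ at_ at' h).
    move=> u s'u ut' i; have [->|ut''] := le_before ut'.
      by rewrite -(inst _ _ as_ as' ss') -(inst _ _ at_ at' h) Cst.
    have au := wo_trans wo' as' s'u.
    have [x [ax xt xu]] := h2 _ au ut''.
    rewrite -(inst _ _ as_ as' ss') -(inst _ _ ax au xu); apply: Cge; last exact: beforeW.
    apply: (nbefore_le wo) => xs.
    by case: (before_le_false wo' (sametime_mono wo wo' ax au xu ss' xs)).
  have rs' : rrun le' F C' s'.
    split=> [v x mv vx|x mx lx i]; first by apply: (rrun_succ r') vx; exact: (wo_trans wo' as').
    by apply: (rrun_lim r') lx i; exact: (le_before_trans wo' as').
  have [|u [s'u ut' ->]] := loop_forever wo' rs' L' (w := w').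
    exact: (wo_trans wo' (beforeW s't') (beforeW t'w')).
  have au := wo_trans wo' as' s'u.
  have [x [ax xt xu]] := h2 _ au ut'.
  by exists x; split=> //; exact: inst.
- by exists u; split=> //; exact: inst.
Qed.

(** * Stabilization of runs up to small sets *)

Section SubOrder.
Context {W : Type} {le : rel W} (wo : well_order le) (M : W -> Prop).

Definition subord : rel {w | M w} := fun x y => le (sval x) (sval y).

Lemma sval_inj_prop (x y : {w | M w}) : sval x = sval y -> x = y.
Proof. by case: x y => x Mx [y My] /= E; subst y; congr exist; exact: Prop_irrelevance. Qed.

Lemma subord_before x y : before subord x y <-> before le (sval x) (sval y).
Proof.
split=> -[h n]; split=> // E; apply: n; first exact: sval_inj_prop.
by rewrite E.
Qed.

Lemma subord_wo : well_order subord.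
Proof.
move=> A [[w Mw] Aw].
have [|z [Mz Az] zmin] := @wo_min _ _ wo (fun w => exists H : M w, exist M w H \in A).
  by exists w, Mw.
exists (exist M z Mz); split.
  by split=> // -[x Mx] Ax; apply: zmin; exists Mx.
move=> [x Mx] [Ax xmin]; apply: sval_inj_prop => /=; apply: (wo_anti wo).
  by apply: zmin; exists Mx.
exact: (xmin _ Az).
Qed.

End SubOrder.

(** What is needed of the order type omega_1. *)
Record omega1 {W : Type} (le : rel W) : Prop := Omega1 {
  om_wo : well_order le;
  om_inh : inhabited W;
  om_enum : forall w, exists e : nat -> W, forall v, before le v w -> exists n, e n = v;
  om_bdd : forall s : nat -> W, exists b, forall n, before le (s n) b }.

(** Take the points of a well-ordered Cantor space with countable initial segment. An unbounded
    sequence among them would yield an enumeration of them all; by diagonalization some point is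
    missed, and the least point outside has only enumerated predecessors, hence belongs to them
    after all. *)
Lemma omega1_ex : exists (W : Type) (le : rel W), omega1 le.
Proof.
have [le wo] := well_ordering_principle cantor_space.
have unc (f : nat -> cantor_space) : exists y, forall n, f n <> y.
  exists (fun n => ~~ f n n) => n E; have := congr1 (fun g => g n) E => /=.
  by case: (f n n).
pose M a := exists e : nat -> cantor_space, forall v, before le v a -> exists n, e n = v.
exists {a | M a}, (subord (le := le) (M := M)).
have [a0 fa _] := first_ex wo (fun=> false).
have Ma0 : M a0 by exists (fun=> fun=> false) => v /fa.
split; first exact: (subord_wo wo).
- exact: (inhabits (exist M a0 Ma0)).
- move=> [w Mw]; have [e he] := Mw.
  exists (fun n => if pselect (M (e n)) is left H then exist M _ H else exist M w Mw).
  move=> [v Mv] /(subord_before (M := M)) /= /he[n En]; exists n.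
  by case: pselect => [H|]; [exact: sval_inj_prop | rewrite En].
- move=> s; apply: contrapT => nb.
  have nb' (b : {a | M a}) : exists n, le (sval b) (sval (s n)).
    apply: contrapT => n; apply: nb; exists b => k; apply/(subord_before (M := M)).
    by apply: (nle_before wo) => h; apply: n; exists k.
  have ex n : exists e : nat -> cantor_space,
    forall v, before le v (sval (s n)) -> exists k, e k = v by exact: (svalP (s n)).
  have [e he] := choice ex.
  (* Index [k] = 0 stands for [s n] itself, [k'.+1] for its predecessor number [k']. *)
  pose E (m : nat) := if @unpickle (nat * nat)%type m is Some (n, k)
    then (if k is k'.+1 then e n k' else sval (s n)) else a0.
  have EM v : M v -> exists m, E m = v.
    move=> Mv; have [n /= vn] := nb' (exist M v Mv).
    have [->|/he[k <-]] := le_before vn.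
      by exists (pickle (n, 0)); rewrite /E pickleK.
    by exists (pickle (n, k.+1)); rewrite /E pickleK.
  have [y Ey] := unc E.
  have [|z nMz zmin] := @wo_min _ _ wo (fun z => ~ M z).
    by exists y => /EM[m /Ey].
  apply: nMz; exists E => v vz; apply: EM; apply: contrapT => /zmin.
  exact: (before_le_false wo vz).
Qed.

Section Omega1.
Context {W : Type} {le : rel W} (om : omega1 le).
Let wo := om_wo om.

Lemma om_bound w (I : countType) (g : W -> I -> W) : exists b,
  before le w b /\ forall u i, le u w -> before le (g u i) b.
Proof.
have [e he] := om_enum om w.
pose s (m : nat) := if @unpickle (nat * I)%type m is Some (n, i)
  then (if n is n'.+1 then g (e n') i else g w i) else w.
have [b hb] := om_bdd om s.
have [b' hb'] := om_bdd om (fun=> w).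
have [c [bc bc']] := wo_max wo b b'.
exists c; split; first exact: (before_le_trans wo (hb' 0)).
move=> u i /(@le_before _ le)[->|/he[n <-]]; apply: (before_le_trans wo _ bc).
  by have := hb (pickle (0, i)); rewrite /s pickleK.
by have := hb (pickle (n.+1, i)); rewrite /s pickleK.
Qed.

Lemma om_sup (s : nat -> W) : (forall n, before le (s n) (s n.+1)) ->
  exists l, [/\ is_limit le l, forall n, before le (s n) l &
    forall t, before le t l -> exists n, before le t (s n)].
Proof.
move=> sinc; have [b hb] := om_bdd om s.
have [|l [_ sl lmin]] := sup_ex wo (A := fun x => exists n, x = s n) (b := b).
  by move=> _ [n ->]; case: (hb n).
have sl' n : before le (s n) l.
  by apply: (before_le_trans wo (sinc n)); apply: sl; exists n.+1.
have lmin' t : before le t l -> exists n, before le t (s n).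
  by move=> /lmin[_ [n ->] tn]; exists n.
exists l; split=> //; apply: limitI; first by exists (s 0).
by move=> v /lmin'[n vn]; exists (s n).
Qed.

Lemma om_next (Q : W -> Prop) : (forall w, exists2 v, Q v & before le w v) ->
  forall w, exists s : nat -> W, [/\ before le w (s 0), forall n, Q (s n) &
    forall n, before le (s n) (s n.+1)].
Proof.
move=> Qunb w; have ex v : exists u, Q u /\ before le v u.
  by have [u Qu vu] := Qunb v; exists u.
have [f hf] := choice ex.
exists (fun n => iter n.+1 f w); split=> [|n|n]; by [case: (hf w)|case: (hf (iter n f w))|case: (hf (iter n.+1 f w))].
Qed.

End Omega1.

(** Common abstraction of Lebesgue measure and Baire category: a sigma-algebra
    [meas] with a sigma-ideal [small], such that a set which is not small is [big]
    in one of countably many basic sets. *)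
Record frame (T : Type) := Frame {
  meas : set T -> Prop;
  small : set T -> Prop;
  basic : countType;
  big : set T -> basic -> Prop;
  measC : forall A, meas A -> meas (~` A);
  meas_bigcup : forall A : nat -> set T, (forall n, meas (A n)) -> meas (\bigcup_n A n);
  small_meas : forall A, small A -> meas A;
  small0 : small set0;
  small_sub : forall A B, A `<=` B -> small B -> small A;
  small_bigcup : forall A : nat -> set T, (forall n, small (A n)) -> small (\bigcup_n A n);
  big_mono : forall A B s, small (A `\` B) -> big A s -> big B s;
  big_meet : forall A B s, meas A -> big A s -> big B s ->
    exists x, A x /\ B x;
  big_ex : forall A, meas A -> ~ small A -> exists s, big A s }.

(** On one point, small means empty, so a statement up to a small set becomes an outright one;
    [run_loops] uses this instance for a single run of length omega_1. *)
Lemma unit_frame : exists fr : frame unit, (forall A, meas fr A) /\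
  forall A, small fr A -> ~ A tt.
Proof.
have h1 : ~ (@set0 unit) tt by [].
have h2 (A B : set unit) : A `<=` B -> ~ B tt -> ~ A tt by move=> AB nB /AB.
have h3 (A : nat -> set unit) : (forall n, ~ A n tt) -> ~ (\bigcup_n A n) tt.
  by move=> nA [n _ /nA].
have h4 (A B : set unit) (s : unit) : ~ (A `\` B) tt -> A tt -> B tt.
  by move=> nAB At; apply: contrapT => nB; exact: nAB.
have h5 (A B : set unit) (s : unit) : True -> A tt -> B tt -> exists x, A x /\ B x.
  by move=> _ At Bt; exists tt.
have h6 (A : set unit) : True -> ~ ~ A tt -> exists s : unit, A tt.
  by move=> _ /contrapT At; exists tt.
by exists (@Frame unit (fun=> True) (fun A => ~ A tt) unit (fun A _ => A tt)
  (fun _ _ => I) (fun _ _ => I) (fun _ _ => I) h1 h2 h3 h4 h5 h6).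
Qed.

Section Frame.
Context {T : Type} (fr : frame T).
Local Notation meas := (meas fr).
Local Notation small := (small fr).

Lemma meas_ext (A B : set T) : (forall x, A x <-> B x) -> meas A -> meas B.
Proof. by move=> AB; have -> : A = B by apply/funext => x; apply/propext. Qed.

Lemma meas_ex (I : countType) (A : I -> T -> Prop) :
  (forall i, meas [set x | A i x]) -> meas [set x | exists i, A i x].
Proof.
move=> mA.
pose B (n : nat) : set T := if unpickle n is Some i then [set x | A i x] else set0.
apply: (@meas_ext (\bigcup_n B n)).
  move=> x; split=> [[n _]|[i Aix]]; last by exists (pickle i); rewrite // /B pickleK.
  by rewrite /B; case: unpickle => // i; exists i.
apply: meas_bigcup => n; rewrite /B; case: unpickle => [i|]; first exact: mA.
exact/small_meas/small0.
Qed.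

Lemma meas_all (I : countType) (A : I -> T -> Prop) :
  (forall i, meas [set x | A i x]) -> meas [set x | forall i, A i x].
Proof.
move=> mA; apply: (@meas_ext (~` [set x | exists i, ~ A i x])).
  move=> x; split=> [n i|n [i]]; last by [].
  by apply: contrapT => nA; apply: n; exists i.
by apply: measC; apply: meas_ex => i; exact: measC (mA i).
Qed.

Lemma meas_cst (P : Prop) : meas [set _ | P].
Proof.
have [p|n] := EM P.
  apply: (@meas_ext (~` set0)); last exact/measC/small_meas/small0.
  by move=> x; split=> // _ [].
by apply: (@meas_ext set0); [by [] | exact/small_meas/small0].
Qed.

Lemma meas_and (A B : T -> Prop) : meas [set x | A x] -> meas [set x | B x] ->
  meas [set x | A x /\ B x].
Proof.
move=> mA mB.
apply: (@meas_ext [set x | forall b : bool, if b then A x else B x]).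
  by move=> x; split=> [h|[a b] []//]; split; [exact: (h true)|exact: (h false)].
by apply: meas_all => -[].
Qed.

Lemma meas_or (A B : T -> Prop) : meas [set x | A x] -> meas [set x | B x] ->
  meas [set x | A x \/ B x].
Proof.
move=> mA mB.
apply: (@meas_ext [set x | exists b : bool, if b then A x else B x]).
  by move=> x; split=> [[[]]|[a|b]]; [left|right|exists true|exists false].
by apply: meas_ex => -[].
Qed.

Lemma meas_imp (P : Prop) (A : T -> Prop) : (P -> meas [set x | A x]) ->
  meas [set x | P -> A x].
Proof.
move=> mA; have [p|n] := EM P.
  by apply: (@meas_ext [set x | A x]) (mA p) => x; split=> [h _ //|h]; exact: (h p).
by apply: (@meas_ext [set _ | True]) (meas_cst True) => x; split=> [_ /n|].
Qed.

Lemma small_ex (I : countType) (A : I -> T -> Prop) :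
  (forall i, small [set x | A i x]) -> small [set x | exists i, A i x].
Proof.
move=> mA.
pose B (n : nat) : set T := if unpickle n is Some i then [set x | A i x] else set0.
apply: (@small_sub _ _ _ (\bigcup_n B n)).
  by move=> x [i Aix]; exists (pickle i); rewrite // /B pickleK.
apply: small_bigcup => n; rewrite /B; case: unpickle => [i|]; first exact: mA.
exact: small0.
Qed.

Lemma small_or (A B : T -> Prop) : small [set x | A x] -> small [set x | B x] ->
  small [set x | A x \/ B x].
Proof.
move=> mA mB.
apply: (@small_sub _ _ _ [set x | exists b : bool, if b then A x else B x]).
  by move=> x [a|b]; [exists true|exists false].
by apply: small_ex => -[].
Qed.

Context {W : Type} {le : rel W} (om : omega1 le).
Let wo := om_wo om.

Lemma meas_all_seg w (A : W -> T -> Prop) :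
  (forall u, before le u w -> meas [set x | A u x]) ->
  meas [set x | forall u, before le u w -> A u x].
Proof.
move=> mA; have [e he] := om_enum om w.
apply: (@meas_ext [set x | forall n, before le (e n) w -> A (e n) x]).
  by move=> x; split=> h; [move=> u uw; have [n En] := he _ uw; rewrite -En in uw *; exact: h
    | move=> n /h].
by apply: meas_all => n; apply: meas_imp; exact: mA.
Qed.

Lemma meas_ex_seg w (A : W -> T -> Prop) :
  (forall u, before le u w -> meas [set x | A u x]) ->
  meas [set x | exists2 u, before le u w & A u x].
Proof.
move=> mA; apply: (@meas_ext (~` [set x | forall u, before le u w -> ~ A u x])).
  move=> x; split=> [n|[u uw Au] /(_ u uw)//].
  by apply: contrapT => n'; apply: n => u uw Au; apply: n'; exists u.
by apply: measC; apply: meas_all_seg => u /mA; exact: measC.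
Qed.

Lemma small_ex_seg w (A : W -> T -> Prop) :
  (forall u, before le u w -> small [set x | A u x]) ->
  small [set x | exists2 u, before le u w & A u x].
Proof.
move=> mA; have [e he] := om_enum om w.
apply: (@small_sub _ _ _ [set x | exists n, before le (e n) w /\ A (e n) x]).
  by move=> x [u uw Au]; have [n En] := he _ uw; exists n; rewrite En.
apply: small_ex => n; have [h|h] := EM (before le (e n) w).
  by apply: small_sub (mA _ h) => x [].
by apply: small_sub (small0 fr) => x [/h].
Qed.

(** The countable chain condition, for increasing omega_1-sequences. *)
Lemma ccc (Cl : W -> Prop) (A : W -> set T) :
  (forall w, Cl w -> meas (A w)) ->
  (forall u w, Cl u -> Cl w -> before le u w -> small (A u `\` A w)) ->
  exists b, forall u w, Cl u -> Cl w -> le b u -> small (A w `\` A u).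
Proof.
move=> mA Ainc; have [w0] := om_inh om.
(* [t s] is a stage at which the set is already big in [s], if there is one. Beyond these countably
   many stages a growth [A w] minus [A u] that is not small would be big in some [s], as [A u]
   already is, and so would meet [A u]. *)
have ex (s : basic fr) : exists t, (exists2 w, Cl w & big (A w) s) -> Cl t /\ big (A t) s.
  have [[w Cw Aw]|n] := EM (exists2 w, Cl w & big (A w) s); first by exists w.
  by exists w0 => /n.
have [t ht] := choice ex.
have [b [_ hb]] := om_bound om w0 (fun=> t).
exists b => u w Cu Cw bu; apply: contrapT => ns.
have mD : meas (A w `\` A u).
  apply: (@meas_ext [set x | A w x /\ ~ A u x]); first by [].
  by apply: meas_and; [exact: mA | exact/measC/mA].
have [s bs] := big_ex mD ns.
have bw : big (A w) s.
  apply: big_mono bs; have -> : (A w `\` A u) `\` A w = set0; last exact: small0.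
  by apply/seteqP; split=> x // -[[]].
have [|Ct bt] := ht s; first by exists w.
have tu : before le (t s) u by apply: (before_le_trans wo) bu; apply: (hb w0); exact: wo_refl.
have [x [[_ nx] /nx]] := big_meet mD bs (big_mono (Ainc _ _ Ct Cu tu) bt).
by [].
Qed.

Variables (a : W) (D : T -> W -> state).
Hypothesis Dmeas : forall w i k, meas [set x | D x w i = k].
Hypothesis Dlim : forall x w, before le a w -> is_limit le w ->
  forall i, rlim le (fun v => D x v i) w (D x w i).

Lemma meas_state (P : nat -> Prop) w i : meas [set x | P (D x w i)].
Proof.
apply: (@meas_ext [set x | exists k, D x w i = k /\ P k]).
  by move=> x; split=> [[_ [<-]]//|Px]; exists (D x w i).
by apply: meas_ex => k; apply: meas_and; [exact: Dmeas|exact: meas_cst].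
Qed.

Let B i k b c := [set x | forall u, before le u c -> le b u -> k <= D x u i].

(** For fixed [b], the set of [x] for which a register stays above [k] from [b] up
    to [w] decreases with [w], hence is eventually constant up to small sets. On the
    closed unbounded set of times that dominate all these stages, the state is
    nondecreasing, hence eventually constant, up to small sets. *)
Lemma stabilize : exists Cl : W -> Prop,
  [/\ forall w, exists2 v, Cl v & before le w v,
      forall (s : nat -> W) l, (forall n, Cl (s n)) -> (forall n, before le (s n) l) ->
        (forall t, before le t l -> exists n, before le t (s n)) -> Cl l,
      forall w, Cl w -> is_limit le w /\ before le a w &
      forall u w, Cl u -> Cl w -> before le u w ->
        small [set x | ~ loop le (D x) u w] ].
Proof.
have mB i k b c : meas (B i k b c).
  apply: meas_all_seg => u _; apply: meas_imp => _.
  exact: (meas_state (fun m => k <= m)).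
(* [B] shrinks as its end grows, so [ccc] is applied to the complements. *)
have ex (p : W * (nat * nat)) : exists g, forall u w, le g u ->
    small (B p.2.1 p.2.2 p.1 u `\` B p.2.1 p.2.2 p.1 w).
  case: p => b [i k] /=.
  have [||g hg] := @ccc (fun=> True) (fun c => ~` B i k b c).
  - by move=> w _; exact: measC.
  - move=> u w _ _ uw; apply: small_sub (small0 fr) => x [nB] /contrapT Bw.
    by apply: nB => v vu bv; apply: Bw => //; exact: (before_trans wo vu).
  - exists g => u w gu; apply: small_sub (hg u w I I gu) => x [Bu nBw].
    by split.
have [g hg] := choice ex.
pose Cl1 w := [/\ is_limit le w, before le a w &
  forall b p, before le b w -> before le (g (b, p)) w].
have Cl1_unb w : exists2 v, Cl1 v & before le w v.
  have ex2 v : exists c, before le v c /\ forall u p, le u v -> before le (g (u, p)) c.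
    exact: (om_bound om v (fun u p => g (u, p))).
  have [h hh] := choice ex2.
  have [w' [ww' aw']] := wo_max wo w a.
  have [|l [ll sl lmin]] := om_sup om (s := fun n => iter n h w').
    by move=> n; case: (hh (iter n h w')).
  exists l; last exact: (le_before_trans wo ww' (sl 0)).
  split=> //; first exact: (le_before_trans wo aw' (sl 0)).
  move=> b p /lmin[n bn]; apply: (before_trans wo _ (sl n.+1)).
  by case: (hh (iter n h w')) => _; apply; exact: beforeW.
have Cl1_closed (s : nat -> W) l : (forall n, Cl1 (s n)) -> (forall n, before le (s n) l) ->
    (forall t, before le t l -> exists n, before le t (s n)) -> Cl1 l.
  move=> Cs sl lmin; split.
  - apply: limitI; first by exists (s 0).
    by move=> v /lmin[n vn]; exists (s n).
  - by apply: (before_trans wo _ (sl 0)); case: (Cs 0).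
  - move=> b p /lmin[n bn]; apply: (before_trans wo _ (sl n)).
    by case: (Cs n) => _ _; apply.
have Cl1_good u w : Cl1 u -> Cl1 w -> before le u w ->
    small [set x | ~ forall i v, le u v -> le v w -> D x u i <= D x v i].
  (* [B] constrains only times strictly before its end; an end [w'] beyond [w] covers [w] itself. *)
  move=> Cu _ uw; have [w' Cw' ww'] := Cl1_unb w.
  have h : small [set x | exists2 b, before le b u & exists p : nat * nat,
      B p.1 p.2 b u x /\ ~ B p.1 p.2 b w' x].
    apply: small_ex_seg => b bu; apply: small_ex => p.
    apply: (small_sub _ (hg (b, p) u w' _)); first by [].
    by apply: beforeW; case: Cu => _ _; apply.
  apply: small_sub h => x nx; apply: contrapT => h; apply: nx => i v uv vw.
  have [lu au _] := Cu.
  have [[[b bu eb] _]|[-> _]//] := Dlim x au lu i.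
  have Bu : B i (D x u i) b u x by move=> y yu by_; exact: eb.
  have Bw : B i (D x u i) b w' x.
    by apply: contrapT => nB; apply: h; exists b => //; exists (i, D x u i).
  apply: Bw; first exact: (le_before_trans wo vw).
  exact: (wo_trans wo (beforeW bu)).
have ex3 (p : nat * nat) : exists b, forall u w, Cl1 u -> Cl1 w -> le b u ->
    small [set x | p.2 <= D x w p.1 /\ ~ (p.2 <= D x u p.1)].
  apply: (@ccc Cl1 (fun w => [set x | p.2 <= D x w p.1])).
    by move=> w _; exact: (meas_state (fun m => p.2 <= m)).
  move=> u w Cu Cw uw; apply: small_sub (Cl1_good _ _ Cu Cw uw) => x [pu npw] h.
  apply: npw; apply: (leq_trans pu); apply: h; first exact: beforeW.
  exact: wo_refl.
have [b hb] := choice ex3.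
have [c [_ hc]] := om_bound om a (fun=> b).
have hc' p : before le (b p) c by apply: (hc a); exact: wo_refl.
exists (fun w => Cl1 w /\ before le c w); split.
- move=> w; have [v [wv cv]] := wo_max wo w c; have [u Cu vu] := Cl1_unb v.
  by exists u; [split=> //|]; exact: (le_before_trans wo _ vu).
- move=> s l Cs sl lmin; split; first by apply: (Cl1_closed s) => // n; case: (Cs n).
  by apply: (before_trans wo _ (sl 0)); case: (Cs 0).
- by move=> w [[]].
- move=> u w [Cu cu] [Cw cw] uw.
  have h1 := Cl1_good _ _ Cu Cw uw.
  have h2 : small [set x | exists p : nat * nat, p.2 <= D x w p.1 /\ ~ (p.2 <= D x u p.1)].
    apply: small_ex => p; apply: hb => //.
    exact: beforeW (before_trans wo (hc' p) cu).
  apply: small_sub (small_or h1 h2) => x nL; apply: contrapT => /not_orP[/contrapT h3 h4].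
  apply: nL; split=> //; last by move=> v uv vw i; exact: h3.
  apply/funext => i; apply/eqP; rewrite eqn_leq h3 //=; last 2 first.
    exact: beforeW.
    exact: wo_refl.
  by apply: contrapT => n; apply: h4; exists (i, D x w i).
Qed.

End Frame.

Lemma run_loops {W : Type} {le : rel W} (om : omega1 le) (a : W) F (C : W -> state) :
  rrun le F C a -> exists Cl : W -> Prop,
  [/\ forall w, exists2 v, Cl v & before le w v,
      forall (s : nat -> W) l, (forall n, Cl (s n)) -> (forall n, before le (s n) l) ->
        (forall t, before le t l -> exists n, before le t (s n)) -> Cl l,
      forall w, Cl w -> is_limit le w /\ before le a w &
      forall u w, Cl u -> Cl w -> before le u w -> loop le C u w ].
Proof.
move=> rC; have [fr [frm frs]] := unit_frame.
have [||Cl [unb clo lim L]] := @stabilize _ fr _ _ om a (fun=> C).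
- by move=> *; exact: frm.
- by move=> _ w aw lw i; exact: (rrun_lim rC).
exists Cl; split=> // u w Cu Cw uw.
by apply: contrapT => nL; apply: (frs _ (L _ _ Cu Cw uw)).
Qed.

(** * Compiling register updates into programs *)

(** Expressions over a list of natural number variables (de Bruijn indices);
    [Rec n a b] iterates [b], whose variables 0 and 1 are the accumulator and
    the loop counter. *)
Inductive expr : Type :=
| Var (i : nat)
| Nil0
| Suc (e : expr)
| Orc (e : expr)
| Ifeq (a b c d : expr)
| Rec (n a b : expr).

Fixpoint eval (y : cantor_space) (env : seq nat) (e : expr) : nat :=
  match e with
  | Var i => nth 0 env i
  | Nil0 => 0
  | Suc e => (eval y env e).+1
  | Orc e => nat_of_bool (y (eval y env e))
  | Ifeq a b c d => if eval y env a == eval y env b then eval y env c else eval y env d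
  | Rec n a b => iteri (eval y env n) (fun i acc => eval y [:: acc, i & env] b) (eval y env a)
  end.

Fixpoint csize (e : expr) : nat :=
  match e with
  | Var _ | Nil0 => 1
  | Suc e | Orc e => (csize e).+1
  | Ifeq a b c d => csize a + csize b + (csize d + (csize c).+2)
  | Rec n a b => csize n + csize a + (csize b).+4.+2
  end.

(** [comp vs s o e], placed at line [o], computes [e] into register [s], the
    variables being held by the registers [vs]. *)
Fixpoint comp (vs : seq nat) (s o : nat) (e : expr) : program :=
  match e with
  | Var i => [:: if i < size vs then Transfer (nth 0 vs i) s else Zero s]
  | Nil0 => [:: Zero s]
  | Suc e => comp vs s o e ++ [:: Succ s]
  | Orc e => comp vs s o e ++ [:: Oracle s]
  | Ifeq a b c d =>
      let o1 := o + csize a in let o2 := o1 + csize b in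
      let o3 := o2.+1 + csize d in
      comp vs s o a ++ comp vs s.+1 o1 b ++ Jump s s.+1 o3.+1 ::
      comp vs s o2.+1 d ++ Jump s s (o3.+1 + csize c) :: comp vs s o3.+1 c
  | Rec n a b =>
      let o1 := o + csize n in let o2 := (o1 + csize a).+1 in
      let o3 := o2.+1 + csize b in
      comp vs s o n ++ comp vs s.+1 o1 a ++ Zero s.+2 :: Jump s.+2 s o3.+3 ::
      comp [:: s.+1, s.+2 & vs] s.+3 o2.+1 b ++
      [:: Transfer s.+3 s.+1; Succ s.+2; Jump s s o2; Transfer s.+1 s]
  end.

Lemma size_comp e vs s o : size (comp vs s o e) = csize e.
Proof.
elim: e vs s o => //= [e IH|e IH|a IHa b IHb c IHc d IHd|n IHn a IHa b IHb] vs s o;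
  rewrite !size_cat /= ?size_cat /= ?IH ?IHa ?IHb ?IHc ?IHd ?IHn; lia.
Qed.

Definition code_at (Q : program) (o : nat) (p : program) :=
  forall i, i < size p -> onth Q (o + i) = onth p i.

Lemma onth_cat (T : Type) (p q : seq T) i :
  onth (p ++ q) i = if i < size p then onth p i else onth q (i - size p).
Proof. by elim: p i => [|x p IH] [|i] //=; rewrite IH. Qed.

Lemma code_at_cat Q o p q : code_at Q o (p ++ q) ->
  code_at Q o p /\ code_at Q (o + size p) q.
Proof.
move=> h; split=> i ip.
  by rewrite h ?size_cat ?onth_cat ?ip //; lia.
rewrite -addnA h ?size_cat ?onth_cat; last by lia.
by rewrite ltnNge leq_addr /= addKn.
Qed.

Lemma code_at_cons Q o x p : code_at Q o (x :: p) -> onth Q o = Some x /\ code_at Q o.+1 p.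
Proof.
move=> h; split; first by have := h 0 isT; rewrite addn0.
by move=> i ip; have := h i.+1 ip; rewrite addnS addSn.
Qed.

Section Reach.
Variables (Q : program) (y : cantor_space).

Definition reach (I : config -> Prop) (c c' : config) :=
  exists2 k, iter k (step Q y) c = c' & forall j, j < k -> I (iter j (step Q y) c).

Lemma reach_refl I c : reach I c c.
Proof. by exists 0. Qed.

Lemma reach_trans I c1 c2 c3 : reach I c1 c2 -> reach I c2 c3 -> reach I c1 c3.
Proof.
move=> [k <- Hk] [l <- Hl]; exists (k + l); first by rewrite addnC iterD.
move=> j jkl; have [/Hk//|kj] := ltnP j k.
rewrite -(subnK kj) iterD; apply: Hl; lia.
Qed.

Lemma reach_mono (I J : config -> Prop) c c' :
  (forall c, I c -> J c) -> reach I c c' -> reach J c c'.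
Proof. by move=> IJ [k E H]; exists k => // j /H /IJ. Qed.

Lemma reach1 (I : config -> Prop) o r c : I (Config o r) ->
  step Q y (Config o r) = c -> reach I (Config o r) c.
Proof. by move=> Ic E; exists 1 => //= -[]. Qed.

(** Intermediate configurations matter, since later limits take the liminf over them too. So each
    piece of code is tracked with the lines it visits and the registers it leaves alone. *)
Definition block (lo hi s : nat) (r : nat -> nat) (c : config) :=
  lo <= line c < hi /\ forall i, i < s -> regs c i = r i.

Lemma block_mono lo hi s r lo' hi' s' r' c :
  lo' <= lo -> hi <= hi' -> s' <= s -> (forall i, i < s' -> r i = r' i) ->
  block lo hi s r c -> block lo' hi' s' r' c.
Proof.
move=> h1 h2 h3 h4 [/andP[h5 h6] h7]; split; first by apply/andP; split; lia.
by move=> i is'; rewrite h7 ?h4 //; lia.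
Qed.

Lemma map_agree (r r' : nat -> nat) s vs : all (fun v => v < s) vs ->
  (forall i, i < s -> r i = r' i) -> map r vs = map r' vs.
Proof.
by move=> /allP vs_s rr; apply/eq_in_map => v /vs_s /rr.
Qed.

(** Registers below [s] are preserved, [s] receives the value, and those above are scratch: [Ifeq]
    puts its second operand into [s.+1], and [Rec] keeps its bound in [s], the accumulator in [s.+1]
    and the counter in [s.+2]. *)
Lemma comp_correct e vs s o r : code_at Q o (comp vs s o e) ->
  all (fun v => v < s) vs ->
  exists r', [/\ reach (block o (o + csize e) s r) (Config o r) (Config (o + csize e) r'),
    forall i, i < s -> r' i = r i & r' s = eval y (map r vs) e].
Proof.
elim: e vs s o r => [i|||||] /=.
- move=> vs s o r /code_at_cons[h _] vs_s.
  exists [eta r with s |-> nth 0 (map r vs) i]; split=> /=; last by rewrite eqxx.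
    apply: reach1.
      by split=> //=; rewrite leqnn addn1 ltnSn.
    rewrite /step h addn1; case: ltnP => isz; congr Config; apply/funext => j /=.
      by rewrite (nth_map 0).
    by rewrite nth_default // size_map.
  by move=> j js; rewrite ltn_eqF.
- move=> vs s o r /code_at_cons[h _] vs_s.
  exists [eta r with s |-> 0]; split=> /=; last by rewrite eqxx.
    apply: reach1; last by rewrite /step h addn1.
    by split=> //=; rewrite leqnn addn1 ltnSn.
  by move=> j js; rewrite ltn_eqF.
- move=> e IH vs s o r /code_at_cat[h1 /code_at_cons[]]; rewrite size_comp => h2 _ vs_s.
  have [r1 [R1 r1s r1E]] := IH _ _ _ r h1 vs_s.
  exists [eta r1 with s |-> (r1 s).+1]; split=> /=; last by rewrite eqxx r1E.
    apply: (reach_trans (c2 := Config (o + csize e) r1)).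
      by apply: reach_mono R1 => c; apply: block_mono => //; lia.
    apply: reach1; last by rewrite /step h2 addnS.
    by split=> //=; lia.
  by move=> j js; rewrite ltn_eqF // r1s.
- move=> e IH vs s o r /code_at_cat[h1 /code_at_cons[]]; rewrite size_comp => h2 _ vs_s.
  have [r1 [R1 r1s r1E]] := IH _ _ _ r h1 vs_s.
  exists [eta r1 with s |-> nat_of_bool (y (r1 s))]; split=> /=; last by rewrite eqxx r1E.
    apply: (reach_trans (c2 := Config (o + csize e) r1)).
      by apply: reach_mono R1 => c; apply: block_mono => //; lia.
    apply: reach1; last by rewrite /step h2 addnS.
    by split=> //=; lia.
  by move=> j js; rewrite ltn_eqF // r1s.
- move=> a IHa b IHb c IHc d IHd vs s o r.
  move=> /code_at_cat[ha]; rewrite size_comp => /code_at_cat[hb]; rewrite size_comp.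
  move=> /code_at_cons[hj] /code_at_cat[hd]; rewrite size_comp => /code_at_cons[hj' hc] vs_s.
  set o1 := o + csize a in ha hb hj hd hj' hc *.
  set o2 := o1 + csize b in ha hb hj hd hj' hc *.
  set o3 := o2.+1 + csize d in ha hb hj hd hj' hc *.
  have vs_s' : all (fun v => v < s.+1) vs by apply: sub_all vs_s => v; lia.
  have [r1 [R1 r1s r1E]] := IHa _ _ _ r ha vs_s.
  have [r2 [R2 r2s r2E]] := IHb _ _ _ r1 hb vs_s'.
  set hi := o + _.
  have hiE : hi = o3.+1 + csize c by rewrite /hi /o3 /o2 /o1; lia.
  have r2r i : i < s -> r2 i = r i by move=> is_; rewrite r2s ?r1s //; lia.
  have R12 : reach (block o hi s r) (Config o r) (Config o2 r2).
    apply: (reach_trans (c2 := Config o1 r1)).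
      apply: reach_mono R1 => x; apply: block_mono => //; rewrite hiE /o3 /o2; lia.
    apply: reach_mono R2 => x; apply: block_mono => //; rewrite ?hiE /o3 /o2 /o1; lia.
  have jump l q r' : o <= l < hi -> (forall i, i < s -> r' i = r i) ->
      step Q y (Config l r') = Config q r' ->
      reach (block o hi s r) (Config l r') (Config q r').
    by move=> lhi r'r E; apply: reach1.
  have evb : r2 s.+1 = eval y (map r vs) b by rewrite r2E (map_agree vs_s r1s).
  have eva : r2 s = eval y (map r vs) a by rewrite r2s.
  case: eqP => E.
    have [r3 [R3 r3s r3E]] := IHc _ _ _ r2 hc vs_s.
    exists r3; split.
    + apply: (reach_trans R12); apply: (reach_trans (c2 := Config o3.+1 r2)).
        apply: jump => //.
          by rewrite hiE /o3 /o2 /o1; lia.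
        by rewrite /step hj eva evb E eqxx.
      rewrite hiE; apply: reach_mono R3 => x; apply: block_mono => //; rewrite /o3 /o2 /o1; lia.
    + by move=> i is_; rewrite r3s // r2r.
    + by rewrite r3E (map_agree vs_s r2r).
  have [r3 [R3 r3s r3E]] := IHd _ _ _ r2 hd vs_s.
  exists r3; split.
  + apply: (reach_trans R12); apply: (reach_trans (c2 := Config o2.+1 r2)).
      apply: jump => //.
        by rewrite hiE /o3 /o2 /o1; lia.
      by rewrite /step hj eva evb; case: eqP.
    apply: (reach_trans (c2 := Config o3 r3)).
      apply: reach_mono R3 => x; apply: block_mono => //; rewrite ?hiE /o3 /o2 /o1; lia.
    apply: jump => //.
    + by rewrite hiE /o3 /o2 /o1; lia.
    + by move=> i is_; rewrite r3s // r2r.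
    + by rewrite /step hj' eqxx hiE.
  + by move=> i is_; rewrite r3s // r2r.
  + by rewrite r3E (map_agree vs_s r2r).
- move=> n IHn a IHa b IHb vs s o r.
  move=> /code_at_cat[hn]; rewrite size_comp => /code_at_cat[ha]; rewrite size_comp.
  move=> /code_at_cons[hz] /code_at_cons[hj] /code_at_cat[hb]; rewrite size_comp.
  set o1 := o + csize n in hn ha hz hj hb *.
  set o2 := (o1 + csize a).+1 in hn ha hz hj hb *.
  set o3 := o2.+1 + csize b in hn ha hz hj hb *.
  move=> /code_at_cons[ht] /code_at_cons[hs] /code_at_cons[hj'] /code_at_cons[ht' _] vs_s.
  have vs_s' : all (fun v => v < s.+1) vs by apply: sub_all vs_s => v; lia.
  have [r1 [R1 r1s r1E]] := IHn _ _ _ r hn vs_s.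
  have [r2 [R2 r2s r2E]] := IHa _ _ _ r1 ha vs_s'.
  set hi := o + _.
  have hiE : hi = o3.+4 by rewrite /hi /o3 /o2 /o1; lia.
  set J := block o hi s r.
  have st l q r' r'' : o <= l < hi -> (forall i, i < s -> r' i = r i) ->
      step Q y (Config l r') = Config q r'' ->
      reach J (Config l r') (Config q r'').
    by move=> lhi r'r E; apply: reach1.
  set f := fun i acc => eval y [:: acc, i & map r vs] b.
  set N := eval y (map r vs) n; set A := eval y (map r vs) a.
  have loopP k : k <= N -> exists rk, [/\ reach J (Config o r) (Config o2 rk),
      forall i, i < s -> rk i = r i, rk s = N, rk s.+2 = k & rk s.+1 = iteri k f A].
    elim: k => [_|k IHk kN].
      exists [eta r2 with s.+2 |-> 0].
      have r2r i : i < s -> r2 i = r i by move=> is_; rewrite r2s ?r1s //; lia.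
      split=> /=.
      - apply: (reach_trans (c2 := Config o1 r1)).
          by apply: reach_mono R1 => x; apply: block_mono => //; rewrite hiE /o3 /o2; lia.
        apply: (reach_trans (c2 := Config (o1 + csize a) r2)).
          by apply: reach_mono R2 => x; apply: block_mono => //; rewrite ?hiE /o3 /o2 /o1; lia.
        by apply: st => //; [rewrite hiE /o3 /o2 /o1; lia | rewrite /step hz].
      - by move=> i is_; rewrite ltn_eqF; [exact: r2r | lia].
      - by rewrite ltn_eqF ?r2s.
      - by rewrite eqxx.
      - by rewrite ltn_eqF // r2E (map_agree vs_s r1s).
    have [rk [Rk rkr rkN rkk rkA]] := IHk (ltnW kN).
    have vsb : all (fun v => v < s.+3) [:: s.+1, s.+2 & vs].
      by rewrite /= ltnSn ltnS leqnSn /=; apply: sub_all vs_s => v; lia.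
    have [r3 [R3 r3s r3E]] := IHb _ _ _ rk hb vsb.
    have r3r i : i < s -> r3 i = r i by move=> is_; rewrite r3s ?rkr //; lia.
    pose r4 := [eta r3 with s.+1 |-> r3 s.+3]; pose r5 := [eta r4 with s.+2 |-> (r4 s.+2).+1].
    have r4r i : i < s -> r4 i = r i.
      by move=> is_; rewrite /r4 /= ltn_eqF ?r3r //; lia.
    have r5r i : i < s -> r5 i = r i.
      by move=> is_; rewrite /r5 /= ltn_eqF ?[LHS]r4r //; lia.
    have r5s2 : r5 s.+2 = k.+1.
      by rewrite /r5 /= eqxx gtn_eqF // r3s // rkk.
    have r5s1 : r5 s.+1 = iteri k.+1 f A.
      rewrite /r5 /= ltn_eqF // eqxx r3E /f /= rkA rkk.
      by rewrite (map_agree vs_s rkr).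
    have r5s : r5 s = N.
      rewrite /r5 /r4 /=.
      have -> : (s == s.+2) = false by lia.
      have -> : (s == s.+1) = false by lia.
      by rewrite r3s ?rkN //; lia.
    exists r5; split=> //.
    apply: (reach_trans Rk); apply: (reach_trans (c2 := Config o2.+1 rk)).
      apply: st => //; first by rewrite hiE /o3 /o2 /o1; lia.
      by rewrite /step hj rkk rkN ltn_eqF.
    apply: (reach_trans (c2 := Config o3 r3)).
      by apply: reach_mono R3 => x; apply: block_mono => //;
        rewrite ?hiE /o3 /o2 /o1 ?rkr //; lia.
    apply: (reach_trans (c2 := Config o3.+1 r4)).
      by apply: st => //; [rewrite hiE /o3 /o2 /o1; lia | rewrite /step ht].
    apply: (reach_trans (c2 := Config o3.+2 r5)).
      by apply: st => //; [rewrite hiE /o3 /o2 /o1; lia | rewrite /step hs].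
    apply: st => //; first by rewrite hiE /o3 /o2 /o1; lia.
    by rewrite /step hj' eqxx.
  have [rk [Rk rkr rkN rkk rkA]] := loopP N (leqnn _).
  exists [eta rk with s |-> rk s.+1]; split=> /=; last by rewrite eqxx rkA.
    apply: (reach_trans Rk); apply: (reach_trans (c2 := Config o3.+3 rk)).
      apply: st => //; first by rewrite hiE /o3 /o2 /o1; lia.
      by rewrite /step hj rkk rkN eqxx.
    apply: st => //; first by rewrite hiE /o3 /o2 /o1; lia.
    by rewrite /step ht' hiE.
  by move=> i is_; rewrite ltn_eqF // rkr.
Qed.

End Reach.

Fixpoint blocks (vs : seq nat) (s o : nat) (fs : seq expr) : program :=
  if fs is f :: fs' then comp vs s o f ++ blocks vs s.+1 (o + csize f) fs' else [::].

Definition blocks_size (fs : seq expr) := sumn (map csize fs).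

Lemma size_blocks vs s o fs : size (blocks vs s o fs) = blocks_size fs.
Proof.
by elim: fs s o => //= f fs IH s o; rewrite size_cat size_comp IH.
Qed.

Lemma blocks_correct Q y vs fs s o r : code_at Q o (blocks vs s o fs) ->
  all (fun v => v < s) vs ->
  exists r', [/\ reach Q y (block o (o + blocks_size fs) s r) (Config o r)
      (Config (o + blocks_size fs) r'),
    forall i, i < s -> r' i = r i &
    forall k, k < size fs -> r' (s + k) = eval y (map r vs) (nth Nil0 fs k)].
Proof.
elim: fs s o r => [|f fs IH] s o r /=.
  by move=> _ _; exists r; split=> //; rewrite /blocks_size /= addn0; exact: reach_refl.
move=> /code_at_cat[hf]; rewrite size_comp => hfs vs_s.
have vs_s' : all (fun v => v < s.+1) vs by apply: sub_all vs_s => v; lia.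
have [r1 [R1 r1s r1E]] := comp_correct y r hf vs_s.
have [r2 [R2 r2s r2E]] := IH _ _ r1 hfs vs_s'.
have Eo : o + blocks_size (f :: fs) = o + csize f + blocks_size fs.
  by rewrite /blocks_size /= addnA.
exists r2; rewrite Eo; split.
- apply: (reach_trans (c2 := Config (o + csize f) r1)).
    by apply: reach_mono R1 => x; apply: block_mono => //; lia.
  by apply: reach_mono R2 => x; apply: block_mono => //; lia.
- by move=> i is_; rewrite r2s ?r1s //; lia.
- move=> [|k] kfs; first by rewrite addn0 r2s // r1E.
  by rewrite addnS -addSn r2E // (map_agree vs_s r1s).
Qed.

Definition mstep (y : cantor_space) (fs : seq expr) (r : state) : state :=
  fun i => if i < size fs then eval y (mkseq r (size fs)) (nth Nil0 fs i) else 0.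

(** Register 1 is the halting flag. All new values are computed before the
    first one is stored, and line 0 is the least line of the loop, so that the
    machine is at line 0 at every limit time. Register [size fs] stays 0. *)
Definition machine (fs : seq expr) : program :=
  let D := size fs in
  let o := 2 + blocks_size fs in
  Jump 1 D 2 :: Jump 0 0 (o + D.+1) ::
  blocks (iota 0 D) D.+1 2 fs ++
  mkseq (fun k => Transfer (D.+1 + k) k) D ++ [:: Jump 0 0 0].

Lemma size_machine fs : size (machine fs) = 2 + blocks_size fs + (size fs).+1.
Proof.
by rewrite /machine /= !size_cat size_blocks size_mkseq /=; lia.
Qed.

Section Machine.
Variables (y : cantor_space) (fs : seq expr).
Let D := size fs.
Let Q := machine fs.

Lemma onth_nth (T : Type) (x0 : T) s i : i < size s -> onth s i = Some (nth x0 s i).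
Proof. by elim: s i => [|x s IH] [|i] //=; exact: IH. Qed.

Lemma macro_step r : r D = 0 -> r 1 = 0 ->
  exists k r', [/\ iter k.+1 (step Q y) (Config 0 r) = Config 0 r',
    forall i, i < D -> r' i = mstep y fs r i, r' D = 0 &
    forall j, j <= k -> let c := iter j (step Q y) (Config 0 r) in
      [/\ 0 < j -> 0 < line c, regs c D = 0 &
        forall i, i < D -> regs c i = r i \/ regs c i = mstep y fs r i] ].
Proof.
move=> rD r1.
have hQ : code_at Q 0 Q by move=> i _.
have [h0 /code_at_cons[_ /code_at_cat[hb]]] := code_at_cons hQ.
rewrite size_blocks => /code_at_cat[ht]; rewrite size_mkseq => /code_at_cons[hj _].
have vs_s : all (fun v => v < D.+1) (iota 0 D).
  by apply/allP => v; rewrite mem_iota => /andP[_]; rewrite add0n; lia.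
have [ra [Ra ras raE]] := blocks_correct y r hb vs_s.
set o := 2 + blocks_size fs in hb ht hj Ra.
pose I (c : config) := [/\ 0 < line c, regs c D = 0 &
  forall i, i < D -> regs c i = r i \/ regs c i = mstep y fs r i].
have Ra' : reach Q y I (Config 2 r) (Config o ra).
  apply: reach_mono Ra => c [lc cE]; split; [lia|by rewrite cE|].
  by move=> i iD; left; rewrite cE //; lia.
have T k : k <= D -> exists rk, [/\ reach Q y I (Config 2 r) (Config (o + k) rk),
    rk D = 0, forall i, i < k -> rk i = mstep y fs r i,
    forall i, k <= i -> i < D -> rk i = r i &
    forall i, D < i -> rk i = ra i].
  elim: k => [_|k IH kD].
    exists ra; rewrite addn0; split=> // [|i _ iD]; first by rewrite ras.
    by rewrite ras //; lia.
  have [rk [Rk rkD rk1 rk2 rk3]] := IH (ltnW kD).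
  have hk : onth Q (o + k) = Some (Transfer (D.+1 + k) k).
    by rewrite ht ?size_mkseq // (onth_nth (Zero 0)) ?size_mkseq // nth_mkseq.
  exists [eta rk with k |-> rk (D.+1 + k)]; split=> /=.
  - apply: (reach_trans Rk); apply: reach1; last by rewrite /step hk addnS.
    split=> //=.
    move=> i iD; have [ik|ki] := ltnP i k; first by right; exact: rk1.
    by left; exact: rk2.
  - by rewrite gtn_eqF.
  - move=> i; rewrite ltnS leq_eqVlt => /orP[/eqP ->|ik]; last by rewrite ltn_eqF // rk1.
    by rewrite eqxx rk3 ?raE // /mstep ?kD //; lia.
  - by move=> i ki iD; rewrite gtn_eqF // rk2 //; lia.
  - by move=> i Di; rewrite gtn_eqF ?rk3 //; lia.
have [rk [[k Ek Hk] rkD rkE _ _]] := T D (leqnn _).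
have E0 : step Q y (Config 0 r) = Config 2 r by rewrite /step h0 rD r1 eqxx.
(* The pass takes one step for the entry test, [k] for evaluating and transferring, and one for the
   jump back. *)
exists k.+1, rk; split=> //.
  by rewrite iterSr E0 iterS Ek /step hj eqxx.
move=> [|j] jk.
  by split=> // i iD; left.
rewrite iterSr E0; have [jk'|jk'] := ltnP j k; first by case: (Hk j jk').
have -> : j = k by lia.
rewrite Ek; split=> //=.
by move=> i iD; right; exact: rkE.
Qed.

Lemma machine_halts r : r D = 0 -> r 1 <> 0 ->
  halted Q (step Q y (step Q y (Config 0 r))) /\
  regs (step Q y (step Q y (Config 0 r))) 0 = r 0.
Proof.
move=> rD /eqP r1; rewrite /halted size_machine /=.
by rewrite rD (negbTE r1) /= eqxx.
Qed.

End Machine.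

(** * Computations of programs as runs of states *)

Definition encode (c : config) : state := fun i => if i is j.+1 then regs c j else line c.
Definition decode (r : state) : config := Config (r 0) (fun i => r i.+1).

Lemma encodeK c : decode (encode c) = c.
Proof. by case: c. Qed.

Lemma decodeK r : encode (decode r) = r.
Proof. by apply/funext => -[]. Qed.

Definition pstep (P : program) (y : cantor_space) (r : state) : state :=
  encode (step P y (decode r)).

Definition target (x : instr) := if x is Jump _ _ q then q else 0.
(** [comp_limit] has no overflow clause for lines. They stay below the program length and the jump
    targets, so their liminf is finite and the line can be treated as one more register. *)
Definition max_line (P : program) := foldr (fun x m => maxn (target x) m) (size P) P.

Lemma onth_bounds (P : program) l x : onth P l = Some x ->
  l < size P /\ target x <= max_line P.
Proof.
rewrite /max_line; move: {2}(size P) => N.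
elim: P l => [|z P IH] [|l] //= => [[->]|/IH[h1 h2]]; first by split=> //; rewrite leq_max leqnn.
by split=> //; rewrite leq_max h2 orbT.
Qed.

Lemma size_max_line P : size P <= max_line P.
Proof.
rewrite /max_line; move: (size P) => N.
by elim: P => //= x P IH; rewrite leq_max IH orbT.
Qed.

Lemma step_line P y c : line c <= max_line P -> line (step P y c) <= max_line P.
Proof.
case: c => l r lP; rewrite /step; case E : (onth P l) => [x|//].
have [lsz tx] := onth_bounds E; have h := leq_trans lsz (size_max_line P).
by case: x E tx => [i|i|i j|i|i j q] E tx //=; case: ifP.
Qed.

Section Computation.
Context {W : Type} {le : rel W} (wo : well_order le).
Variables (P : program) (y : cantor_space) (c0 : config).

Lemma rlim_max_line (f : W -> nat) w m B : (forall v, before le v w -> f v <= B) ->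
  (exists v, before le v w) ->
  rlim le f w m -> m <= B /\ liminf_before le f w m.
Proof.
move=> fB [v vw] [ec|[_ i]]; last first.
  by have [u uw /(_ u (wo_refl wo u) uw)] := i B.+1; rewrite ltnNge fB.
split; last by apply/(liminf_beforeP wo) => //; exists v.
by case: ec => _ /(_ _ vw)[u [_ uw <-]]; exact: fB.
Qed.

Lemma rrun_computation (C : W -> state) a : is_first le a -> decode (C a) = c0 ->
  line c0 <= max_line P -> rrun le (pstep P y) C a ->
  computation le P y c0 (fun w => decode (C w)).
Proof.
move=> fa Ca c0P rC; have ale w := @first_le _ _ wo a w fa.
have lineP w : C w 0 <= max_line P.
  elim/(@wo_ind _ _ wo): w => w IH.
  case: (@wo_cases _ le w) => [fw|[v vw]|lw].
  - by rewrite (first_uniq wo fw fa); have -> : C a 0 = line c0 by rewrite -Ca.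
  - rewrite (rrun_succ rC (ale v) vw).
    exact: (@step_line P y (decode (C v)) (IH v (proj1 vw))).
  - have [v vw] := limit_ex lw.
    have [|||//] := @rlim_max_line (fun v => C v 0) w (C w 0) (max_line P).
    + exact: IH.
    + by exists v.
    + by apply: (rrun_lim rC) => //; exact: (le_before_trans wo (ale v)).
split.
- by move=> w fw; rewrite (first_uniq wo fw fa).
- by move=> v w vw; rewrite (rrun_succ rC (ale v) vw) encodeK.
- move=> w lw; have [v vw] := limit_ex lw.
  have aw := le_before_trans wo (ale v) vw.
  split; last first.
    by move=> i; apply/(reg_limitP wo); [exists v|exact: (rrun_lim rC)].
  have [|||//] := @rlim_max_line (fun v => C v 0) w (C w 0) (max_line P).
  + by move=> u _; exact: lineP.
  + by exists v.
  + exact: (rrun_lim rC).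
Qed.

Lemma computation_rrun (C : W -> config) a : is_first le a ->
  computation le P y c0 C -> C a = c0 /\ rrun le (pstep P y) (fun w => encode (C w)) a.
Proof.
move=> fa cC; split; first exact: (comp_first cC).
split=> [v w _ vw|w aw lw i].
  by rewrite (comp_succ cC vw) /pstep encodeK.
have exw : exists v, before le v w by exists a.
have [lin reg] := comp_limit cC lw.
case: i => [|i] /=; last exact/(reg_limitP wo _ _ exw).
by left; apply/(liminf_beforeP wo).
Qed.

Lemma computation_ex : line c0 <= max_line P -> inhabited W ->
  exists C, computation le P y c0 C.
Proof.
move=> c0P [w0]; have [C [Cf rC]] := rrun_ex wo (pstep P y) (encode c0).
have [a fa _] := first_ex wo w0.
exists (fun w => decode (C w)); apply: rrun_computation (rC a) => //.
by rewrite Cf // encodeK.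
Qed.

End Computation.

Section Interval.
Context {W : Type} {le : rel W} (wo : well_order le) (a b : W) (ab : le a b).
Let M w := le a w /\ le w b.
Let so : rel {w | M w} := subord (le := le) (M := M).
Let Ma : M a := conj (wo_refl wo a) ab.

(** Gives a stage of a longer run a first time of its own, as [computation] requires; one simulation
    inside a long run thus becomes a computation. The interval is convex, so its successors and its
    limits beyond [a] are those of the whole order. *)
Lemma rrun_interval F C : rrun le F C a ->
  is_first so (exist M a Ma) /\ rrun so F (fun w => C (sval w)) (exist M a Ma).
Proof.
move=> rC.
have sb (x y : {w | M w}) : before so x y <-> before le (sval x) (sval y).
  exact: subord_before.
have seg (w : {w | M w}) v : le a v -> le v (sval w) -> M v.
  by move=> av vw; split=> //; apply: (wo_trans wo vw); case: (svalP w).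
split.
  by move=> [v [av vb]] /sb /= /(before_le_false wo); exact.
split=> [v w av [/sb vw nvw]|w /sb aw lw i].
  apply: (rrun_succ rC); first by case: (svalP v).
  split=> // -[u [vu uw]]; apply: nvw.
  have Mu : M u.
    by apply: (seg w) => //; [case: (svalP v) => h _; exact: (wo_trans wo h (beforeW vu))|exact: beforeW].
  by exists (exist M u Mu); split; exact/sb.
have lw' : is_limit le (sval w).
  apply: limitI; first by exists a.
  move=> v vw; have [va|av] := wo_total wo v a.
    have /(limit_dense (subord_wo wo (M := M)) lw)[u /sb au /sb uw] : before so (exist M a Ma) w by exact/sb.
    by exists (sval u) => //; exact: (le_before_trans wo va).
  have Mv : M v by apply: (seg w) => //; exact: beforeW.
  have /(limit_dense (subord_wo wo (M := M)) lw)[u /sb vu /sb uw] : before so (exist M v Mv) w by exact/sb.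
  by exists (sval u).
have evt_sub (Q : W -> Prop) : evt le (sval w) Q -> evt so w (fun u => Q (sval u)).
  move=> [v vw vQ]; have [c [vc cw ac]] : exists c, [/\ le v c, before le c (sval w) & le a c].
    by case: (wo_total wo v a) => h; [exists a|exists v]; split=> //; exact: wo_refl.
  have Mc : M c by apply: (seg w) => //; exact: beforeW.
  exists (exist M c Mc); first exact/sb.
  by move=> u cu /sb uw; apply: vQ => //; exact: (wo_trans wo vc cu).
have cof_sub (Q : W -> Prop) : cof le (sval w) Q -> cof so w (fun u => Q (sval u)).
  move=> cQ v /sb vw; have [u [vu uw Qu]] := cQ _ vw.
  have Mu : M u.
    by apply: (seg w) => //; [case: (svalP v) => h _; exact: (wo_trans wo h vu)|exact: beforeW].
  by exists (exist M u Mu); split=> //; exact/sb.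
case: (rrun_lim rC aw lw' i) => [[e c]|[E h]]; [left; split | right; split=> // k].
- exact: evt_sub e.
- exact: cof_sub c.
- exact: evt_sub (h k).
Qed.

End Interval.

Definition mrun {W : Type} (le : rel W) (F : state -> state) (C : W -> state) :=
  exists a, [/\ is_first le a, C a = (fun=> 0) & rrun le F C a].

(** * Sampling a machine at the heads of its loop *)

Section Heads.
Variables (y : cantor_space) (fs : seq expr) (fs1 : 1 < size fs).
Let D := size fs.
Let Q := machine fs.
Context {W : Type} {le : rel W} (om : omega1 le).
Let wo := om_wo om.
Variable C : W -> config.
Hypothesis cC : computation le Q y (init 0) C.

Definition head w := line (C w) = 0.
Definition unflagged w := forall v, before le v w -> head v -> regs (C v) 1 = 0.

Let sc_ex : exists sc : W -> W, forall v, is_succ le v (sc v).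
Proof.
have ex v : exists s, is_succ le v s.
  have [b hb] := om_bdd om (fun=> v).
  by have [s] := succ_ex wo (hb 0); exists s.
by have [f hf] := choice ex; exists f.
Qed.
Let sc := projT1 (cid sc_ex).
Let scP v : is_succ le v (sc v). Proof. exact: (projT2 (cid sc_ex)). Qed.

Lemma C_iter j v : C (iter j sc v) = iter j (step Q y) (C v).
Proof. by elim: j => //= j IH; rewrite (comp_succ cC (scP _)) IH. Qed.

Lemma iter_sc_limit w v j : is_limit le w -> before le v w -> before le (iter j sc v) w.
Proof. by move=> lw vw; elim: j => //= j IH; exact: (limit_succ wo lw IH (scP _)). Qed.

Lemma iter_sc_lt v j k : j < k -> before le (iter j sc v) (iter k sc v).
Proof.
elim: k => // k IH; rewrite ltnS leq_eqVlt => /orP[/eqP->|/IH h] /=.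
  by case: (scP (iter k sc v)).
by apply: (before_trans wo h); case: (scP (iter k sc v)).
Qed.

Lemma iter_sc_le v j k : j <= k -> le (iter j sc v) (iter k sc v).
Proof.
rewrite leq_eqVlt => /orP[/eqP->|/(iter_sc_lt v)]; [exact: wo_refl|exact: beforeW].
Qed.

Lemma iter_sc_between v x j : le v x -> before le x (iter j sc v) ->
  exists2 i, i < j & x = iter i sc v.
Proof.
move=> vx; elim: j => [/(before_le_false wo)/(_ vx)//|j IH] /= xj.
have [E|/IH[i ij ->]] := le_before (before_succ wo (scP _) xj); first by exists j.
by exists i => //; exact: ltnW.
Qed.

Definition steady m j := j = 0 \/ regs (C m) 1 = 0 /\
  forall i, 0 < i -> i <= j -> 0 < line (C (iter i sc m)).

Lemma config_eta c : c = Config (line c) (regs c). Proof. by case: c. Qed.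

Lemma next_head_iter m : head m -> regs (C m) D = 0 -> regs (C m) 1 = 0 -> exists k,
  let n := iter k.+1 sc m in [/\ head n, regs (C n) D = 0,
    forall i, i < D -> regs (C n) i = mstep y fs (regs (C m)) i &
    forall j, j <= k -> let x := iter j sc m in [/\ 0 < j -> 0 < line (C x), regs (C x) D = 0 &
      forall i, i < D -> regs (C x) i = regs (C m) i \/ regs (C x) i = regs (C n) i] ].
Proof.
move=> hm mD m1; have [k [r' [Er rE rD rj]]] := macro_step y mD m1.
have Cm : C m = Config 0 (regs (C m)) by rewrite [LHS]config_eta hm.
exists k; have Cn : C (iter k.+1 sc m) = Config 0 r' by rewrite C_iter Cm.
split; rewrite ?/head ?Cn //.
move=> j /rj; rewrite -Cm -C_iter => -[h1 h2 h3]; split=> // i iD.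
by case: (h3 i iD) => ->; [left|right; rewrite /= rE].
Qed.

(** At a limit, passes have been completed cofinally often, and as 0 is the least line the liminf of
    the lines is 0: limits are heads. Other times are finitely many steps into a pass. Register [D]
    survives limits because it is constantly 0. *)
Lemma prev_head w : unflagged w -> exists m j,
  [/\ w = iter j sc m, head m, regs (C m) D = 0 & steady m j].
Proof.
elim/(@wo_ind _ _ wo): w => w IH Uw.
have Uv v : before le v w -> unflagged v.
  by move=> vw u uv; apply: Uw; exact: (before_trans wo uv).
case: (@wo_cases _ le w) => [fw|[v vw]|lw].
- exists w, 0; split=> //; try by left.
    by rewrite /head (comp_first cC fw).
  by rewrite (comp_first cC fw) /= /D; case: (size fs) fs1.
- have vw' : before le v w by case: vw.
  have [m [j [Ev hm mD st]]] := IH _ vw' (Uv _ vw').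
  have mv : le m v by rewrite Ev; exact: (iter_sc_le m (leq0n j)).
  have m1 : regs (C m) 1 = 0 by apply: Uw => //; exact: (le_before_trans wo mv).
  have Ew : w = iter j.+1 sc m by rewrite /= -Ev; exact: (succ_uniq wo vw (scP v)).
  have [hw|nhw] := EM (head w); last first.
    exists m, j.+1; split=> //; right; split=> // i i0.
    rewrite leq_eqVlt => /orP[/eqP->|ij]; first by rewrite -Ew lt0n; exact/eqP.
    by case: st => [j0|[_ h]]; [lia|exact: h].
  have [k [hn nD _ hk]] := next_head_iter hm mD m1.
  exists w, 0; split=> //; last by left.
  have -> : w = iter k.+1 sc m; last by [].
  rewrite Ew; congr (iter _ sc m); apply/eqP; rewrite eqn_leq; apply/andP; split.
    rewrite leqNgt; apply/negP => kj.
    case: st => [j0|[_ /(_ k.+1 isT)]]; first by lia.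
    by rewrite (hn : line _ = 0) => /(_ kj).
  rewrite leqNgt; apply/negP => jk; have [/(_ isT)] := hk j.+1 jk.
  by rewrite -Ew (hw : line _ = 0).
- have bel v : before le v w -> regs (C v) D = 0 /\ exists n, [/\ before le v n, before le n w & head n].
    move=> vw; have [m [j [Ev hm mD st]]] := IH _ vw (Uv _ vw).
    have mv : le m v by rewrite Ev; exact: (iter_sc_le m (leq0n j)).
    have m1 : regs (C m) 1 = 0 by apply: Uw => //; exact: (le_before_trans wo mv).
    have [k [hn nD _ hk]] := next_head_iter hm mD m1.
    have jk : j <= k.
      rewrite leqNgt; apply/negP => kj.
      case: st => [j0|[_ /(_ k.+1 isT kj)]]; first by lia.
      by rewrite (hn : line _ = 0).
    split; first by rewrite Ev; case: (hk j jk).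
    exists (iter k.+1 sc m); split=> //; first by rewrite Ev; exact: iter_sc_lt.
    by apply: iter_sc_limit => //; exact: (le_before_trans wo mv).
  have [lin reg] := comp_limit cC lw; have exw := limit_ex lw.
  exists w, 0; split=> //; last by left.
    move/(liminf_beforeP wo _ _ exw): lin => [[v vw ev] _].
    have [_ [n [vn nw hn]]] := bel _ vw.
    by have := ev _ (beforeW vn) nw; rewrite (hn : line _ = 0) leqn0 => /eqP.
  apply: (rlim_const wo exw _ ((reg_limitP wo _ _ exw).1 (reg D))).
  by case: exw => v vw; exists v => // u _ uw; case: (bel u uw).
Qed.

Lemma head_D w : unflagged w -> head w -> regs (C w) D = 0.
Proof.
move=> Uw hw; have [m [j [Ew hm mD [j0|[m1 st]]]]] := prev_head Uw.
  by rewrite Ew j0.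
case: j Ew st => [->//|j] Ew /(_ j.+1 isT (leqnn _)).
by rewrite -Ew (hw : line _ = 0).
Qed.

Lemma next_head m w : before le m w -> head m -> unflagged w -> is_limit le w \/ head w ->
  exists n, [/\ before le m n /\ head n, le n w /\ (is_limit le w -> before le n w),
    forall x, le m x -> before le x n -> head x -> x = m,
    forall i, i < D -> regs (C n) i = mstep y fs (regs (C m)) i &
    forall x, le m x -> before le x n -> forall i, i < D ->
      regs (C x) i = regs (C m) i \/ regs (C x) i = regs (C n) i].
Proof.
move=> mw hm Uw lhw; have m1 := Uw _ mw hm.
have Um : unflagged m by move=> v vm; apply: Uw; exact: (before_trans wo vm).
have [k [hn nD nE hk]] := next_head_iter hm (head_D Um hm) m1.
exists (iter k.+1 sc m); split=> //.
- by split=> //; exact: (iter_sc_lt m (ltn0Sn k)).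
- split; last by move=> lw; exact: iter_sc_limit.
  apply: (nbefore_le wo) => /iter_sc_between[|i ik Ew]; first exact: beforeW.
  case: lhw => [lw|hw].
    by have h := iter_sc_limit i lw mw; rewrite -Ew in h; case: (before_irr h).
  case: i ik Ew => [_ Ew|i ik Ew]; first by case: (before_irr (le := le) (x := m)); rewrite -{2}[m]Ew.
  by have [/(_ isT)] := hk i.+1 ik; rewrite -Ew (hw : line _ = 0).
- move=> x mx /(iter_sc_between mx)[[//|i] ik ->] hx.
  by have [/(_ isT)] := hk i.+1 ik; rewrite (hx : line _ = 0).
- by move=> x mx /(iter_sc_between mx)[i ik ->]; case: (hk i ik).
Qed.

Lemma head_below v : unflagged v -> exists m, [/\ head m, le m v &
  forall x, head x -> le x v -> le x m].
Proof.
move=> Uv; have [m [j [Ev hm _ st]]] := prev_head Uv; exists m.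
split=> //; first by rewrite Ev; exact: (iter_sc_le m (leq0n j)).
move=> x hx xv; apply: (nbefore_le wo) => mx.
have : before le x (iter j.+1 sc m).
  by apply: (le_before_trans wo xv); rewrite Ev; exact: iter_sc_lt.
move=> /(iter_sc_between (beforeW mx))[[_ Ex|i ij Ex]].
  by case: (before_irr (le := le) (x := m)); rewrite -{2}[m]Ex.
case: st => [j0|[_ /(_ i.+1 isT)]]; first by lia.
by rewrite -Ex (hx : line _ = 0) => /(_ ij).
Qed.

Definition live w := head w /\ unflagged w.
Definition visible (r : state) : state := fun i => if i < D then r i else 0.
Let so : rel {w | live w} := subord (le := le) (M := live).
Let C' (w : {w | live w}) : state := visible (regs (C (sval w))).

Lemma mstep_visible r : mstep y fs (visible r) = mstep y fs r.
Proof.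
apply/funext => i; rewrite /mstep; case: ifP => // _; congr eval.
by apply/eq_in_map => j; rewrite mem_iota /visible add0n => /andP[_ ->].
Qed.

(** Between two heads a register shows only the values it has at these heads, so eventual lower
    bounds and cofinal values are the same for heads as for all times. [visible] discards the
    scratch registers, which do not follow [mstep]. *)
Lemma heads_mrun : mrun so (mstep y fs) C'.
Proof.
have sb (x z : {w | live w}) : before so x z <-> before le (sval x) (sval z).
  exact: subord_before.
have [w0] := om_inh om; have [a fa _] := first_ex wo w0.
have La : live a by split; [rewrite /head (comp_first cC fa)|move=> v /fa].
exists (exist _ a La); split.
- by move=> v /sb /fa.
- by apply/funext => i; rewrite /C' /visible /= (comp_first cC fa) /=; case: i => [|i]; case: ifP.
split=> [v w _ [/sb vw nvw]|w /sb aw lw i].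
  have [[hv Uv] [hw Uw]] := (svalP v, svalP w).
  have [n [[vn hn] [nw _] _ nE _]] := next_head vw hv Uw (or_intror hw).
  have Ln : live n.
    by split=> // u un; apply: Uw; exact: (before_le_trans wo un).
  have {nw} : n = sval w.
    have [//|nw'] := le_before nw.
    by case: nvw; exists (exist _ n Ln); split; exact/sb.
  rewrite /C' mstep_visible => <-; apply/funext => j; rewrite /visible.
  by case: ifP => [/nE//|]; rewrite /mstep => ->.
have [hw Uw] := svalP w.
have Uv v : before le v (sval w) -> unflagged v.
  by move=> vw u uv; apply: Uw; exact: (before_trans wo uv).
have lw' : is_limit le (sval w).
  case: (@wo_cases _ le (sval w)) => [/(_ _ aw)//|[v vw]|//].
  have vw' : before le v (sval w) by case: vw.
  have [m [hm mv mmax]] := head_below (Uv _ vw').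
  have mw := le_before_trans wo mv vw'.
  have Lm : live m by split=> //; exact: Uv.
  have /(limit_dense (subord_wo wo (M := live)) lw)[u /sb mu /sb uw] :
    before so (exist _ m Lm) w by exact/sb.
  have [hu _] := svalP u.
  by case: (before_le_false wo mu); apply: mmax => //; exact: (before_succ wo vw uw).
have exw := limit_ex lw'.
have up v : before le v (sval w) -> exists m : {w | live w}, le v (sval m) /\ before so m w.
  move=> vw; have [m [hm mv mmax]] := head_below (Uv _ vw).
  have mw := le_before_trans wo mv vw.
  have [n [[mn hn] [_ /(_ lw') nw] _ _ _]] := next_head mw hm Uw (or_introl lw').
  have Ln : live n by split=> //; exact: Uv.
  exists (exist _ n Ln); split; last exact/sb.
  by apply: (nbefore_le wo) => /= nv; apply: (before_le_false wo mn); apply: mmax => //; exact: beforeW.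
have evt_sub (R : W -> Prop) : evt le (sval w) R -> evt so w (fun u => R (sval u)).
  move=> [v vw vR]; have [m [vm mw]] := up _ vw; exists m => // u mu /sb uw.
  by apply: vR => //; exact: (wo_trans wo vm mu).
have rl : rlim so (fun v => regs (C (sval v)) i) w (regs (C (sval w)) i) \/ D <= i.
  have [|iD] := leqP D i; [by right|left].
  have /(reg_limitP wo _ _ exw)[[e c]|[E h]] := (comp_limit cC lw').2 i.
  - left; split; first exact: (evt_sub _ e).
    move=> v /sb vw; have [u [vu uw Eu]] := c _ vw.
    have [m [hm mu mmax]] := head_below (Uv _ uw).
    have mw := le_before_trans wo mu uw.
    have Lm : live m by split=> //; exact: Uv.
    have [n [[mn hn] [_ /(_ lw') nw] _ _ nval]] := next_head mw hm Uw (or_introl lw').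
    have Ln : live n by split=> //; exact: Uv.
    have un : before le u n.
      apply: (nle_before wo) => nu; apply: (before_le_false wo mn).
      exact: mmax.
    have vm : le (sval v) m by apply: mmax => //; case: (svalP v).
    case: (nval u mu un i iD) => E.
      by exists (exist _ m Lm); split=> //; [exact/sb|rewrite /= -E].
    exists (exist _ n Ln); split=> //; [|exact/sb|by rewrite /= -E].
    exact: (wo_trans wo vm (beforeW mn)).
  - by right; split=> // k; exact: (evt_sub _ (h k)).
rewrite /C' /visible; have [rl'|Di] := rl; case: ltnP => // Di'.
- left; split; first by exists (exist _ a La) => //; exact/sb.
  by move=> v vw; exists v; split=> //; exact: (wo_refl (subord_wo wo (M := live))).
- by rewrite leqNgt Di' in Di.
- left; split; first by exists (exist _ a La) => //; exact/sb.
  by move=> v vw; exists v; split=> //; exact: (wo_refl (subord_wo wo (M := live))).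
Qed.

Lemma heads_omega1 : (forall w, head w -> regs (C w) 1 = 0) -> omega1 so.
Proof.
move=> nf; have U w : unflagged w by move=> v _; exact: nf.
have sb (x z : {w | live w}) : before so x z <-> before le (sval x) (sval z).
  exact: subord_before.
have [w0] := om_inh om; have [a fa _] := first_ex wo w0.
have La : live a by split; [rewrite /head (comp_first cC fa)|].
split; first exact: (subord_wo wo).
- exact: (inhabits (exist _ a La)).
- move=> w; have [e he] := om_enum om (sval w).
  exists (fun n => if pselect (live (e n)) is left H then exist _ _ H else exist _ a La).
  move=> v /sb /he[n En]; exists n; apply: sval_inj_prop.
  by case: pselect => //=; rewrite En => /(_ (svalP v)).
- move=> s; have [b hb] := om_bdd om (fun n => sval (s n)).
  have [m [hm mb mmax]] := head_below (U b).
  have [b' hb'] := om_bdd om (fun=> m).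
  have mD := head_D (U m) hm.
  have [k [hn _ _ _]] := next_head_iter hm mD (nf _ hm).
  have Ln : live (iter k.+1 sc m) by split.
  exists (exist _ _ Ln) => n; apply/sb => /=.
  apply: (le_before_trans wo _ (iter_sc_lt m (ltn0Sn k))).
  by apply: mmax; [case: (svalP (s n))|exact: beforeW].
Qed.

End Heads.

(** The heads up to the first flagged one form a time type of unknown length, so correctness of the
    answer is asked over every well-order. If no head were flagged, the heads would again satisfy
    [omega1], so only there the flag has to be known to rise. *)
Theorem machine_yields (y : cantor_space) (fs : seq expr) (v : nat) : 1 < size fs ->
  (forall (W : Type) (le : rel W) C, well_order le -> mrun le (mstep y fs) C ->
    forall w, C w 1 <> 0 -> (forall u, before le u w -> C u 1 = 0) -> C w 0 = v) ->
  (forall (W : Type) (le : rel W) C, omega1 le -> mrun le (mstep y fs) C ->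
    exists w, C w 1 <> 0) ->
  yields (machine fs) y 0 v.
Proof.
move=> fs1 hA hB; have [W [le om]] := omega1_ex; have wo := om_wo om.
have [C cC] := @computation_ex W le wo (machine fs) y (init 0) (leq0n _) (om_inh om).
have [w hw w1] : exists2 w, head C w & regs (C w) 1 <> 0.
  apply: contrapT => n.
  have nf w : head C w -> regs (C w) 1 = 0.
    by move=> hw; apply: contrapT => w1; apply: n; exists w.
  have [w] := hB _ _ _ (heads_omega1 fs1 om cC nf) (heads_mrun fs1 om cC).
  by apply; rewrite /visible fs1; apply: nf; case: (svalP w).
have [|z [hz z1] zmin] := @wo_min _ _ wo (fun w => head C w /\ regs (C w) 1 <> 0).
  by exists w.
have Uz : unflagged (le := le) C z.
  move=> u uz hu; apply: contrapT => u1.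
  exact: (before_le_false wo uz (zmin u (conj hu u1))).
have Lz : live (le := le) C z by [].
have fs0 : 0 < size fs by case: (size fs) fs1.
have E : regs (C z) 0 = v.
  have := hA _ _ _ (subord_wo wo (M := live (le := le) C)) (heads_mrun fs1 om cC) (exist _ z Lz).
  rewrite /visible /= fs1 fs0; apply=> // u /subord_before uz.
  have [hu _] := svalP u; exact: Uz uz hu.
have zD := head_D fs1 om cC Uz hz.
have sucex u : exists s, is_succ le u s.
  have [b hb] := om_bdd om (fun=> u).
  by have [s us _] := succ_ex wo (hb 0); exists s.
(* From a flagged head two jumps lead out of the program, so the machine has halted at [t]. *)
have [s zs] := sucex z; have [t st] := sucex s.
have [h1 h2] := machine_halts y zD z1.
exists W, le, C, t; split=> //.
  rewrite (comp_succ cC st) (comp_succ cC zs).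
  by rewrite (config_eta (C z)) (hz : line _ = 0).
by rewrite (comp_succ cC st) (comp_succ cC zs) (config_eta (C z)) (hz : line _ = 0) h2.
Qed.

(** * Stacks of configurations *)

(** The finite set of natural numbers with binary representation [S]. *)
Definition mem (S d : nat) : bool := odd (iter d half S).

Lemma memS S d : mem S d.+1 = mem S./2 d.
Proof. by rewrite /mem iterSr. Qed.

Lemma mem0 d : mem 0 d = false.
Proof. by elim: d => // d; rewrite memS. Qed.

Lemma mem_add S m d : ~~ mem S m -> mem (S + 2 ^ m) d = (d == m) || mem S d.
Proof.
elim: m S d => [|m IH] S d.
  rewrite /mem /= expn0 addn1 => So.
  case: d => [|d]; first by rewrite /= So.
  by rewrite !iterSr /= uphalf_half (negbTE So).
rewrite memS => /IH h; have E : (S + 2 ^ m.+1)./2 = S./2 + 2 ^ m.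
  by rewrite expnS; lia.
case: d => [|d]; last by rewrite !memS E h eqSS.
by rewrite /mem /= expnS oddD mul2n odd_double addbF.
Qed.

Lemma mem_lt S d : mem S d -> d < S.
Proof.
elim: d S => [|d IH] S; first by case: S.
by rewrite memS => /IH; lia.
Qed.

(** Inclusion of finite sets entails the order of their codes; through this the numerical liminf of
    a stack controls its elements. *)
Lemma mem_sub_le A B : (forall d, mem A d -> mem B d) -> A <= B.
Proof.
elim/ltn_ind: A B => A IH B AB; have [->//|A0] := posnP A.
have h : A./2 <= B./2 by apply: IH; [lia|move=> d; rewrite -!memS; exact: AB].
have := AB 0; rewrite /mem /= => h0.
have [|nA] := boolP (odd A); first by move=> oA; have := h0 oA; lia.
by lia.
Qed.

Lemma mem_ext A B : (forall d, mem A d = mem B d) -> A = B.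
Proof.
by move=> AB; apply/eqP; rewrite eqn_leq !mem_sub_le // => d; rewrite AB.
Qed.

Definition mkset (n : nat) (P : pred nat) := \sum_(d < n | P d) 2 ^ d.

Lemma mksetS n P : mkset n.+1 P = mkset n P + (if P n then 2 ^ n else 0).
Proof. by rewrite /mkset big_mkcond big_ord_recr /= -big_mkcond. Qed.

Lemma mem_mkset n P d : mem (mkset n P) d = (d < n) && P d.
Proof.
elim: n d => [|n IH] d; first by rewrite /mkset big_ord0 mem0.
rewrite mksetS; case: ifP => Pn.
  rewrite mem_add; last by rewrite IH ltnn.
  rewrite IH ltnS (leq_eqVlt d n).
  by have [->|_] := eqVneq d n; rewrite ?Pn.
rewrite addn0 IH ltnS (leq_eqVlt d n); have [->|//] := eqVneq d n.
by rewrite Pn !andbF.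
Qed.

Lemma mkset_lt n P : mkset n P < 2 ^ n.
Proof.
elim: n => [|n IH]; first by rewrite /mkset big_ord0.
by rewrite mksetS expnS; case: ifP; lia.
Qed.

Lemma mem_bound S n : (forall d, mem S d -> d < n) -> S <= mkset n predT.
Proof. by move=> Sn; apply: mem_sub_le => d /Sn dn; rewrite mem_mkset dn. Qed.

Definition filt (S m : nat) := mkset S (fun d => mem S d && (d %| m)).

Lemma mem_filt S m d : mem (filt S m) d = mem S d && (d %| m).
Proof.
rewrite mem_mkset andbA; case: (boolP (mem S d)) => [/mem_lt ->//|].
by rewrite andbF.
Qed.

(** Euclid's construction of ever larger primes. Some primes are skipped; only distinctness matters
    for coding. *)
Fixpoint pr (j : nat) : nat := if j is j'.+1 then pdiv (pr j')`!.+1 else 2.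

Lemma pr_prime j : prime (pr j).
Proof. by case: j => //= j; apply: pdiv_prime; rewrite ltnS fact_gt0. Qed.

Lemma pr_lt i j : i < j -> pr i < pr j.
Proof.
have prS k : pr k < pr k.+1.
  rewrite ltnNge; apply/negP => h.
  have d1 : pr k.+1 %| (pr k)`! by apply: dvdn_fact; rewrite h prime_gt0 ?pr_prime.
  have d2 : pr k.+1 %| (pr k)`!.+1 by exact: pdiv_dvd.
  have := pr_prime k.+1; suff -> : pr k.+1 = 1 by [].
  by apply/eqP; rewrite -dvdn1; have := dvdn_sub d2 d1; rewrite subSnn.
elim: j => // j IH; rewrite ltnS leq_eqVlt => /orP[/eqP->//|/IH h].
exact: ltn_trans h (prS j).
Qed.

Lemma pr_inj i j : pr i = pr j -> i = j.
Proof.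
by move=> E; have [h|h|//] := ltngtP i j; have := pr_lt h; rewrite E ltnn.
Qed.

(** Pointwise comparison of states becomes divisibility of codes. *)
Definition code (K : nat) (g : state) : nat := \prod_(j < K) pr j ^ g j.

Lemma code_gt0 K g : 0 < code K g.
Proof. by apply: prodn_gt0 => j; rewrite expn_gt0 prime_gt0 ?pr_prime. Qed.

Lemma logn_code K g i : i < K -> logn (pr i) (code K g) = g i.
Proof.
have aux n : logn (pr i) (code n g) = if i < n then g i else 0.
  elim: n => [|n IH]; first by rewrite /code big_ord0 logn1.
  rewrite /code big_ord_recr /= -/(code n g) lognM ?code_gt0 ?expn_gt0 ?prime_gt0 ?pr_prime //.
  rewrite IH lognX logn_prime ?pr_prime // ltnS (leq_eqVlt i n).
  have [->|ni] := eqVneq i n; first by rewrite ltnn eqxx muln1.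
  suff -> : (pr i == pr n) = false by rewrite muln0 addn0.
  by apply/eqP => /pr_inj /eqP; rewrite (negbTE ni).
by rewrite aux => ->.
Qed.

Lemma code_dvd K g g' : reflect (forall j, j < K -> g j <= g' j) (code K g %| code K g').
Proof.
apply: (iffP idP) => [h j jK|h].
  by rewrite -(logn_code g jK) -(logn_code g' jK) dvdn_leq_log ?code_gt0.
rewrite /code; elim: K h => [|K IH] h; first by rewrite big_ord0 dvd1n.
by rewrite !big_ord_recr /= dvdn_mul ?dvdn_exp2l ?h // IH // => j jK; apply: h; lia.
Qed.

Definition vanish (K t : nat) (g : state) := \sum_(j < K | mem t j) g j == 0.

Lemma vanishP K t g : reflect (forall j, j < K -> mem t j -> g j = 0) (vanish K t g).
Proof.
rewrite /vanish sum_nat_eq0; apply: (iffP forallP) => h.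
  by move=> j jK tj; have /implyP/(_ tj)/eqP := h (Ordinal jK).
by move=> j; apply/implyP => tj; rewrite h.
Qed.

(** Elements not below the current state are removed; the state itself is
    pushed only if nothing was removed, so that after every removal the set
    consists of elements that survived it. *)
Definition upd (K t S : nat) (g : state) : nat :=
  let m := code K g in
  if vanish K t g && (filt S m == S) then S + 2 ^ m else filt S m.

(** * Invariants of a stack along a run *)

Section Stack.
Context {W : Type} {le : rel W} (wo : well_order le).
Variables (K t : nat) (g : W -> state) (S : W -> nat).
Local Notation m w := (code K (g w)).
Hypothesis S_first : forall w, is_first le w -> S w = 0.
Hypothesis S_succ : forall v w, is_succ le v w -> S w = upd K t (S v) (g v).
Hypothesis S_lim : forall w, is_limit le w -> rlim le S w (S w).

(** Its failure is the signal for a loop. As long as it holds, adding [2 ^ m] in [upd] inserts a new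
    element without a carry. *)
Definition fresh w := forall v, before le v w -> ~~ mem (S v) (m v).

Definition sound w := forall d, mem (S w) d -> exists s,
  [/\ before le s w, m s = d, vanish K t (g s) &
    forall u, le s u -> before le u w -> d %| m u].

Definition chained w := forall d d', mem (S w) d -> mem (S w) d' -> d %| d' \/ d' %| d.

Definition stable w d := evt le w (fun u => mem (S u) d).

Lemma mem_upd v w d : is_succ le v w -> ~~ mem (S v) (m v) -> mem (S w) d =
  (mem (S v) d && (d %| m v)) || [&& d == m v, vanish K t (g v) & filt (S v) (m v) == S v].
Proof.
move=> vw nd; rewrite (S_succ vw) /upd; case: ifP => h; last first.
  by rewrite mem_filt andbF orbF.
have /andP[_ /eqP E] := h; rewrite andbT mem_add // -mem_filt E orbC.
by [].
Qed.

(** Consider the least element [u] that occurs after [x] and is not stable, at its first removal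
    after an occurrence. Survivors divide the current code and [u] does not, so in the chain each of
    them divides [u] and is smaller; minimality makes them stable. Nothing is pushed at a removal,
    so only survivors remain. *)
Lemma limit_unstable w : is_limit le w ->
  (forall v, before le v w -> sound v /\ chained v) -> fresh w ->
  forall x, before le x w -> exists2 x', le x x' /\ before le x' w &
    forall d, mem (S x') d -> stable w d.
Proof.
move=> lw inv fr x xw.
pose U u := `[< exists x1, [/\ le x x1, before le x1 w, mem (S x1) u & ~ stable w u] >].
have [exU|noU] := EM (exists u, U u); last first.
  exists x; first by split=> //; exact: wo_refl.
  move=> d dx; apply: contrapT => nd; apply: noU; exists d; apply/asboolP.
  by exists x; split=> //; exact: wo_refl.
have [u /asboolP[x1 [xx1 x1w ux1 nu]] umin] := ex_minnP exU.
have [|x2 [x12 x2w nux2] x2min] :=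
    @wo_min _ _ wo (fun z => [/\ le x1 z, before le z w & ~~ mem (S z) u]).
  apply: contrapT => n; apply: nu; exists x1 => // z x1z zw.
  by apply: contrapT => /negP nz; apply: n; exists z.
have bel z : le x1 z -> before le z x2 -> mem (S z) u.
  move=> x1z zx2; apply: contrapT => /negP nz.
  apply: (before_le_false wo zx2); apply: x2min; split=> //.
  exact: (before_trans wo zx2).
have x12' : before le x1 x2.
  by have [E|//] := le_before x12; rewrite -E ux1 in nux2.
exists x2; first by split=> //; exact: (wo_trans wo xx1).
move=> d dx2.
case: (@wo_cases _ le x2) => [/(_ _ x12')//|[v vx2]|lx2].
  have vx2' : before le v x2 by case: vx2.
  have x1v := before_succ wo vx2 x12'.
  have uv := bel _ x1v vx2'.
  have vw := before_trans wo vx2' x2w.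
  move: nux2; rewrite (mem_upd _ vx2) ?fr // uv /= => /norP[num nfilt].
  have dv : mem (S v) d && (d %| m v).
    move: dx2; rewrite (mem_upd _ vx2) ?fr // => /orP[//|/and3P[_ _ /eqP E]].
    by case/negP: num; have := uv; rewrite -{1}E mem_filt => /andP[].
  case/andP: dv => dv dm.
  have [_ ch] := inv _ vw; have [sd _] := inv _ x2w.
  have du : d < u.
    case: (ch _ _ dv uv) => [du|ud]; last by case/negP: num; exact: dvdn_trans dm.
    have [sv _] := inv _ vw; have [s [_ su _ _]] := sv _ uv.
    rewrite ltn_neqAle; apply/andP; split.
      by apply/eqP => E; rewrite E in dm; case/negP: num.
    by apply: dvdn_leq du; rewrite -su code_gt0.
  apply: contrapT => nd; have : U d.
    by apply/asboolP; exists x2; split=> //; exact: (wo_trans wo xx1).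
  by move=> /umin; rewrite leqNgt du.
(* The element [u] cannot be lost at a limit: a finite liminf is the code of an earlier stack
   containing [u], and overflow leaves the empty stack, which has no element [d]. *)
case: (S_lim lx2) => [[_ c]|[E _]]; last by rewrite E mem0 in dx2.
have [z [x1z zx2 Ez]] := c _ x12'.
by case/negP: nux2; rewrite -Ez; exact: bel.
Qed.

(** At a time [x] from [limit_unstable] the stack has only stable elements, and these all lie in
    [S w], so [S x] is at most [S w]. The liminf gives the converse inequality for late [x], so the
    two codes coincide. *)
Lemma limit_stable w : is_limit le w ->
  (forall v, before le v w -> sound v /\ chained v) -> fresh w ->
  forall d, mem (S w) d -> stable w d.
Proof.
move=> lw inv fr d dw; case: (S_lim lw) => [[e c]|[E _]]; last by rewrite E mem0 in dw.
have [v vw ev] := e.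
have [x [vx xw] xst] := limit_unstable lw inv fr vw.
have St_sub d' : stable w d' -> mem (S w) d'.
  by move=> st; have [u _ [h <-]] := evt_cof st c.
have E : S x = S w.
  apply/eqP; rewrite eqn_leq ev // andbT; apply: mem_sub_le => d' /xst; exact: St_sub.
by apply: xst; rewrite E.
Qed.

Lemma stable_dvd w d : is_limit le w ->
  (forall v, before le v w -> sound v /\ chained v) ->
  stable w d -> evt le w (fun u => d %| m u).
Proof.
move=> lw inv [v vw st]; exists v => // u vu uw.
have [s us sw] := succ_ex wo uw.
have sw' := limit_succ wo lw uw us.
have us' : before le u s by case: us.
have ds : mem (S s) d by apply: st => //; exact: (wo_trans wo vu (beforeW us')).
have [sd _] := inv _ sw'; have [z [zs _ _ zd]] := sd _ ds.
by apply: zd => //; exact: (before_succ wo us zs).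
Qed.

Lemma stack_inv w : fresh w -> sound w /\ chained w.
Proof.
elim/(@wo_ind _ _ wo): w => w IH fr.
have inv v : before le v w -> sound v /\ chained v.
  by move=> vw; apply: IH => // u uv; apply: fr; exact: (before_trans wo uv).
case: (@wo_cases _ le w) => [fw|[v vw]|lw].
- by split=> d; rewrite (S_first fw) mem0.
- have vw' : before le v w by case: vw.
  have nd := fr _ vw'; have [sv cv] := inv _ vw'.
  split.
    move=> d; rewrite (mem_upd _ vw) // => /orP[/andP[dv dm]|/and3P[/eqP-> van _]].
      have [s [sv' Es van sd]] := sv _ dv.
      exists s; split=> //; first exact: (before_trans wo sv').
      move=> u su uw; have [->//|uv] := le_before (before_succ wo vw uw).
      exact: sd.
    exists v; split=> // u vu uw.
    by rewrite (wo_anti wo vu (before_succ wo vw uw)).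
  move=> d d'; rewrite !(mem_upd _ vw) //.
  (* A pushed code is divisible by all elements present, as none of them was removed; so the chain
     persists. *)
  move=> /orP[/andP[dv dm]|/and3P[/eqP-> _ /eqP E]] /orP[/andP[dv' dm']|/and3P[/eqP-> _ /eqP E']].
  + exact: cv.
  + by left.
  + by right.
  + by left.
- have st := limit_stable lw inv fr.
  split=> [d dw|d d' dw dw'].
    have sd := st _ dw; have [x xw xd] := sd.
    have [sx _] := inv _ xw.
    have [s [sx' Es van hs]] := sx _ (xd _ (wo_refl wo x) xw).
    exists s; split=> //; first exact: (before_trans wo sx').
    move=> u su uw; have [xu|ux] := le_or_before wo x u; last exact: hs.
    have [z us zw] := succ_ex wo uw; have zw' := limit_succ wo lw uw us.
    have uz : before le u z by case: us.
    have [sz _] := inv _ zw'.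
    have [s' [sz' _ _ hs']] := sz _ (xd _ (wo_trans wo xu (beforeW uz)) zw').
    by apply: hs' => //; exact: (before_succ wo us sz').
  have [v vw h] := evtI wo (st _ dw) (st _ dw').
  have [h1 h2] := h v (wo_refl wo v) vw.
  by have [_ cv] := inv _ vw; exact: cv.
Qed.

(** A state which is never undercut stays on the stack of its own zero set: the
    registers overflowing at a limit are 0 there, so the elements of this stack
    vanish on them, and the stack cannot overflow. *)
Lemma stack_persistent s w : (forall v, fresh v) ->
  (forall v, le s v -> le v w -> forall j, g s j <= g v j) ->
  (forall v, before le s v -> is_limit le v -> forall j, j < K ->
     rlim le (fun u => g u j) v (g v j)) ->
  (forall j, j < K -> g s j = 0 -> mem t j) ->
  (forall v, is_succ le s v -> mem (S v) (m s)) ->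
  forall v, before le s v -> le v w -> mem (S v) (m s).
Proof.
move=> fr above glim zt base v; elim/(@wo_ind _ _ wo): v => v IH sv vw.
have inv u := stack_inv (fr u).
case: (@wo_cases _ le v) => [/(_ _ sv)//|[u uv]|lv].
  have [E|su] := le_before (before_succ wo uv sv); first by apply: base; rewrite E.
  have uv' : before le u v by case: uv.
  have uw := wo_trans wo (beforeW uv') vw.
  rewrite (mem_upd _ uv); last exact: fr uv'.
  apply/orP; left; rewrite IH //=.
  by apply/code_dvd => j _; apply: above => //; exact: beforeW.
have [b sb bv] := limit_dense wo lv sv.
have fromb u : le b u -> before le u v -> mem (S u) (m s).
  move=> bu uv; apply: IH => //; first exact: (before_le_trans wo sb).
  exact: (wo_trans wo (beforeW uv)).
case: (S_lim lv) => [[_ c]|[_ big]].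
  by have [u [bu uv <-]] := c _ bv; exact: fromb.
have bound d : stable v d -> d < (m v).+1.
  move=> st; rewrite ltnS; apply: dvdn_leq; first exact: code_gt0.
  have [x xv xd] := st; have [sx _] := inv x.
  have [z [_ Ez van _]] := sx _ (xd _ (wo_refl wo x) xv).
  rewrite -Ez; apply/code_dvd => j jK.
  have ev : evt le v (fun u => g z j <= g u j).
    apply: evt_mono (stable_dvd lv (fun u _ => inv u) st) => u _.
    by rewrite -Ez => /code_dvd; apply.
  case: (glim _ sv lv _ jK) => [[_ c]|[g0 _]].
    by have [u _ [h <-]] := evt_cof ev c.
  have gs0 : g s j = 0.
    by apply/eqP; rewrite -leqn0 -g0; apply: above => //; exact: beforeW.
  have /vanishP h := van.
  by rewrite h //; exact: zt.
(* [mkset (m v).+1 predT] is the largest code of a set with elements at most [m v]. Overflow drives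
   all late codes beyond it, whereas some late stack has only stable elements. *)
have [x xv hx] := big (mkset (m v).+1 predT).+1.
have [y [xy yv] yst] := limit_unstable lv (fun u _ => inv u) (fr v) xv.
have := hx _ xy yv; rewrite ltnNge mem_bound // => d /yst; exact: bound.
Qed.

End Stack.

(** * Deciding halting problems *)

Fixpoint lift (c d : nat) (e : expr) : expr :=
  match e with
  | Var i => Var (if i < c then i else d + i)
  | Nil0 => Nil0
  | Suc e => Suc (lift c d e)
  | Orc e => Orc (lift c d e)
  | Ifeq e1 e2 e3 e4 => Ifeq (lift c d e1) (lift c d e2) (lift c d e3) (lift c d e4)
  | Rec n a b => Rec (lift c d n) (lift c d a) (lift c.+2 d b)
  end.

Lemma evalRec y env n a b f :
  (forall i acc, eval y [:: acc, i & env] b = f i acc) ->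
  eval y env (Rec n a b) = iteri (eval y env n) f (eval y env a).
Proof. by move=> bf /=; elim: (eval y env n) => //= k ->; rewrite bf. Qed.

Lemma eval_Ifeq y env a b c d : eval y env (Ifeq a b c d) =
  if eval y env a == eval y env b then eval y env c else eval y env d.
Proof. by []. Qed.

Lemma eval_Var y env i : eval y env (Var i) = nth 0 env i.
Proof. by []. Qed.

Lemma eval_lift y e1 e2 e3 e :
  eval y (e1 ++ e2 ++ e3) (lift (size e1) (size e2) e) = eval y (e1 ++ e3) e.
Proof.
elim: e e1 => //= [i|e IH|e IH|a IHa b IHb c IHc d IHd|n IHn a IHa b IHb] e1.
- case: (ltnP i (size e1)) => h; rewrite !nth_cat; first by rewrite h.
  do 3 (rewrite ifF; last by lia).
  by congr nth; lia.
- by rewrite IH.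
- by rewrite IH.
- by rewrite IHa IHb IHc IHd.
- rewrite IHn IHa; elim: (eval y (e1 ++ e3) n) => //= k ->.
  exact: (IHb [:: _, _ & e1]).
Qed.

Lemma eval_lift0 y e1 e2 e : eval y (e1 ++ e2) (lift 0 (size e1) e) = eval y e2 e.
Proof. exact: (@eval_lift y [::] e1 e2 e). Qed.

Definition lift2 := lift 0 2.
Lemma eval_lift2 y a i env e : eval y [:: a, i & env] (lift2 e) = eval y env e.
Proof. exact: (@eval_lift0 y [:: a; i] env e). Qed.

(** * Arithmetic by expressions *)

Definition eCst n := iter n Suc Nil0.
Definition eAdd a b := Rec b a (Suc (Var 0)).
Definition eMul a b := Rec b Nil0 (eAdd (Var 0) (lift2 a)).
Definition ePow a b := Rec b (eCst 1) (eMul (lift2 a) (Var 0)).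
Definition eDvd d m := Rec (Suc m) Nil0
  (Ifeq (eMul (lift2 d) (Var 1)) (lift2 m) (eCst 1) (Var 0)).
Definition eOdd a := Rec a Nil0 (Ifeq (Var 0) Nil0 (eCst 1) Nil0).
(** Half of [a], rounded down, is the number of odd numbers below [a]. *)
Definition eHalf a := Rec a Nil0 (eAdd (Var 0) (eOdd (Var 1))).
Definition eMem S d := eOdd (Rec d S (eHalf (Var 0))).
Definition eFilt S m := Rec S Nil0
  (Ifeq (eMem (lift2 S) (Var 1)) Nil0 (Var 0)
    (Ifeq (eDvd (Var 1) (lift2 m)) Nil0 (Var 0)
      (eAdd (Var 0) (ePow (eCst 2) (Var 1))))).

Lemma eval_cst y env n : eval y env (eCst n) = n.
Proof. by elim: n => //= n ->. Qed.

Lemma eval_add y env a b : eval y env (eAdd a b) = eval y env a + eval y env b.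
Proof. by rewrite /=; elim: (eval y env b) => [|n IH] /=; rewrite ?addn0 // IH addnS. Qed.

Lemma eval_mul y env a b : eval y env (eMul a b) = eval y env a * eval y env b.
Proof.
rewrite (@evalRec _ _ _ _ _ (fun _ acc => acc + eval y env a)); last first.
  by move=> i acc; rewrite eval_add eval_lift2.
by elim: (eval y env b) => [|n IH] /=; rewrite ?muln0 // IH mulnS addnC.
Qed.

Lemma eval_odd y env a : eval y env (eOdd a) = odd (eval y env a).
Proof. by rewrite /=; elim: (eval y env a) => //= n ->; case: (odd n). Qed.

Lemma eval_pow y env a b : eval y env (ePow a b) = eval y env a ^ eval y env b.
Proof.
rewrite (@evalRec _ _ _ _ _ (fun _ acc => eval y env a * acc)); last first.
  by move=> i acc; rewrite eval_mul eval_lift2.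
by elim: (eval y env b) => [|n IH] //=; rewrite IH expnS.
Qed.

Lemma eval_dvd y env d m : eval y env (eDvd d m) = (eval y env d %| eval y env m).
Proof.
set D := eval y env d; set M := eval y env m.
rewrite (@evalRec _ _ _ _ _ (fun i acc => if D * i == M then 1 else acc)); last first.
  by move=> i acc; rewrite eval_Ifeq eval_mul !eval_lift2 eval_cst.
have aux n : iteri n (fun i acc => if D * i == M then 1 else acc) 0 =
    [exists i : 'I_n, D * i == M].
  elim: n => [|n IH] /=; first by symmetry; apply/eqP; rewrite eqb0; apply/existsP => -[[]].
  rewrite IH; case: eqP => E.
    by suff -> : [exists i : 'I_n.+1, D * i == M] by []; apply/existsP; exists ord_max; apply/eqP.
  congr nat_of_bool; apply/existsP/existsP => -[i iE].
    by exists (widen_ord (leqnSn n) i).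
  have ni : i < n.
    rewrite ltn_neqAle -ltnS ltn_ord andbT; apply/eqP => h; apply: E; rewrite -h; exact/eqP.
  by exists (Ordinal ni).
rewrite aux -/M; congr nat_of_bool; apply/existsP/dvdnP => [[i /eqP E]|[q E]].
  by exists i; rewrite mulnC.
(* If the divisor is 0, so is [M], and the given quotient may lie outside the search range; 0 serves
   instead. *)
have [D0|D0] := posnP D; first by exists ord0; rewrite E D0 !muln0.
have qM : q < M.+1 by rewrite ltnS E leq_pmulr.
by exists (Ordinal qM); rewrite /= mulnC E.
Qed.

Lemma eval_half y env a : eval y env (eHalf a) = (eval y env a)./2.
Proof.
rewrite (@evalRec _ _ _ _ _ (fun i acc => acc + odd i)); last first.
  by move=> i acc; rewrite eval_add eval_odd.
elim: (eval y env a) => //= n ->; rewrite uphalf_half; lia.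
Qed.

Lemma eval_mem y env S d : eval y env (eMem S d) = mem (eval y env S) (eval y env d).
Proof.
rewrite eval_odd (@evalRec _ _ _ _ _ (fun _ => half)); last first.
  by move=> i acc; rewrite eval_half.
by [].
Qed.

Lemma eval_filt y env S m :
  eval y env (eFilt S m) = filt (eval y env S) (eval y env m).
Proof.
set s := eval y env S; set M := eval y env m.
rewrite (@evalRec _ _ _ _ _ (fun i acc => if mem s i && (i %| M) then acc + 2 ^ i else acc)).
  have aux n : iteri n (fun i acc => if mem s i && (i %| M) then acc + 2 ^ i else acc) 0 =
      mkset n (fun d => mem s d && (d %| M)).
    elim: n => [|n IH]; first by rewrite /mkset big_ord0.
    by rewrite mksetS /= IH; case: ifP; rewrite ?addn0.
  exact: aux.
move=> i acc; set e := [:: acc, i & env].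
have E1 : eval y e (eMem (lift2 S) (Var 1)) = mem s i by rewrite eval_mem eval_lift2.
have E2 : eval y e (eDvd (Var 1) (lift2 m)) = (i %| M) by rewrite eval_dvd eval_lift2.
have E3 : eval y e (eAdd (Var 0) (ePow (eCst 2) (Var 1))) = acc + 2 ^ i.
  by rewrite eval_add eval_pow eval_cst.
rewrite !eval_Ifeq E1 E2 E3 /=; by case: (mem s i); case: (i %| M).
Qed.

(** Halting of the abstract machine with update [gs] and test [hx], at any ordinal time. [checker]
    and [doneE] are the instance to which it is applied. *)
Definition ghalts (gs : seq expr) (hx : expr) (y : cantor_space) : Prop :=
  exists (W : Type) (le : rel W) (g : W -> state) (w : W),
    [/\ well_order le, mrun le (mstep y gs) g & eval y (mkseq (g w) (size gs)) hx <> 0].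

(** * The decider and its correctness *)

Section Decider.
Variables (gs : seq expr) (hx : expr).
Let K := size gs.
Let off := 2 + 2 ^ K.

Fixpoint codeE (k : nat) : expr :=
  if k is k'.+1 then eMul (codeE k') (ePow (eCst (pr k')) (Var (off + k'))) else eCst 1.

Fixpoint sumE (t k : nat) : expr :=
  if k is k'.+1 then
    if mem t k' then eAdd (sumE t k') (Var (off + k')) else sumE t k'
  else Nil0.

Definition updE (t : nat) : expr :=
  let S := Var (2 + t) in let F := eFilt S (codeE K) in
  Ifeq (sumE t K) Nil0 (Ifeq F S (eAdd S (ePow (eCst 2) (codeE K))) F) F.

Fixpoint detectE (n : nat) : expr :=
  if n is n'.+1 then Ifeq (eMem (Var (2 + n')) (codeE K)) Nil0 (detectE n') (eCst 1)
  else lift 0 off hx.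

(** Registers: answer, flag, the stacks, and the simulated machine. *)
Definition decider : seq expr :=
  [:: Ifeq (lift 0 off hx) Nil0 Nil0 (eCst 1); detectE (2 ^ K)] ++
  mkseq updE (2 ^ K) ++ map (lift 0 off) gs.

Lemma size_decider : size decider = off + K.
Proof. by rewrite /decider size_cat size_cat size_mkseq size_map /= addnA. Qed.

Lemma decider_ge2 : 1 < size decider.
Proof. by rewrite size_decider. Qed.

Section Sem.
Variables (y : cantor_space) (r : state).
Let g : state := fun j => r (off + j).
Let env := mkseq r (off + K).

Lemma env_split : env = mkseq r off ++ mkseq g K.
Proof.
by rewrite /env /mkseq iotaD map_cat add0n -[in iota off K](addn0 off) iotaDl -map_comp.
Qed.

Lemma eval_off e : eval y env (lift 0 off e) = eval y (mkseq g K) e.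
Proof. by have := eval_lift0 y (mkseq r off) (mkseq g K) e; rewrite size_mkseq -env_split. Qed.

Lemma eval_g j : j < K -> eval y env (Var (off + j)) = g j.
Proof. by move=> jK; rewrite eval_Var nth_mkseq // ltn_add2l. Qed.

Lemma eval_S t : t < 2 ^ K -> eval y env (Var (2 + t)) = r (2 + t).
Proof. by move=> tK; rewrite eval_Var nth_mkseq // /off; lia. Qed.

Lemma eval_code k : k <= K -> eval y env (codeE k) = code k g.
Proof.
elim: k => [|k IH] kK; first by rewrite /code big_ord0.
have -> : codeE k.+1 = eMul (codeE k) (ePow (eCst (pr k)) (Var (off + k))) by [].
rewrite /code big_ord_recr -/(code k g).
by rewrite eval_mul IH ?eval_pow ?eval_cst ?eval_g // ltnW.
Qed.

Lemma eval_sum t k : k <= K -> eval y env (sumE t k) = \sum_(j < k | mem t j) g j.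
Proof.
elim: k => [|k IH] kK; first by rewrite big_ord0.
have -> : sumE t k.+1 =
  if mem t k then eAdd (sumE t k) (Var (off + k)) else sumE t k by [].
rewrite big_mkcond big_ord_recr -big_mkcond [nat_of_ord _]/=; case: ifP => tk.
  by rewrite eval_add IH ?eval_g //; exact: ltnW.
by rewrite IH ?(ltnW kK) //; exact: (esym (addn0 _)).
Qed.

Lemma eval_upd t : t < 2 ^ K -> eval y env (updE t) = upd K t (r (2 + t)) g.
Proof.
move=> tK; rewrite /updE !eval_Ifeq eval_sum // eval_filt eval_add eval_pow eval_cst.
rewrite eval_code // eval_S // /upd /vanish.
by rewrite [eval y env Nil0]/=; case: eqP => //= _; case: eqP.
Qed.

Lemma eval_detect n : n <= 2 ^ K -> eval y env (detectE n) <> 0 <->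
  eval y (mkseq g K) hx <> 0 \/ exists t, t < n /\ mem (r (2 + t)) (code K g).
Proof.
elim: n => [|n IH] nK.
  by rewrite /detectE eval_off; split=> [h|[//|[t []]]]; by [left|].
have -> : detectE n.+1 =
  Ifeq (eMem (Var (2 + n)) (codeE K)) Nil0 (detectE n) (eCst 1) by [].
rewrite eval_Ifeq eval_mem eval_code // eval_S // eval_cst [eval y env Nil0]/=.
case: (boolP (mem _ _)) => h /=; first by split=> // _; right; exists n; rewrite ltnSn.
rewrite IH ?(ltnW nK) //; split=> [[h'|[t [tn ht]]]|[h'|[t [tn ht]]]]; [by left| |by left|].
  by right; exists t; split=> //; lia.
right; exists t; split=> //; rewrite ltn_neqAle -ltnS tn andbT.
by apply: contraNneq h => E; rewrite -E.
Qed.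

Lemma decider_answer : mstep y decider r 0 = (eval y (mkseq g K) hx != 0).
Proof.
have -> : mstep y decider r 0 = eval y env (Ifeq (lift 0 off hx) Nil0 Nil0 (eCst 1)).
  by rewrite /mstep size_decider.
by rewrite eval_Ifeq eval_off /=; case: eqP.
Qed.

Lemma decider_flag : mstep y decider r 1 <> 0 <->
  eval y (mkseq g K) hx <> 0 \/ exists t, t < 2 ^ K /\ mem (r (2 + t)) (code K g).
Proof.
have -> : mstep y decider r 1 = eval y env (detectE (2 ^ K)).
  by rewrite /mstep size_decider.
exact: eval_detect.
Qed.

Lemma decider_stack t : t < 2 ^ K -> mstep y decider r (2 + t) = upd K t (r (2 + t)) g.
Proof.
move=> tK; rewrite /mstep size_decider -/env -eval_upd //.
have -> : nth Nil0 decider (2 + t) = nth Nil0 (mkseq updE (2 ^ K) ++ map (lift 0 off) gs) t by [].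
rewrite nth_cat size_mkseq tK nth_mkseq // ifT // /off; lia.
Qed.

Lemma decider_sim j : j < K -> mstep y decider r (off + j) = mstep y gs g j.
Proof.
move=> jK; rewrite /mstep size_decider -/env ltn_add2l -/K jK -eval_off; congr eval.
have -> : off + j = 2 + (2 ^ K + j) by rewrite /off addnA.
have -> : nth Nil0 decider (2 + (2 ^ K + j)) =
  nth Nil0 (mkseq updE (2 ^ K) ++ map (lift 0 off) gs) (2 ^ K + j) by [].
rewrite nth_cat size_mkseq ifF; last by lia.
by rewrite addKn (nth_map Nil0).
Qed.

End Sem.

Section Run.
Variables (y : cantor_space) (W : Type) (le : rel W) (wo : well_order le).
Variable C : W -> state.
Hypothesis rC : mrun le (mstep y decider) C.
Let g w : state := fun j => if j < K then C w (off + j) else 0.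

Lemma code_g w : code K (fun j => C w (off + j)) = code K (g w).
Proof. by rewrite /code; apply: eq_bigr => j _; rewrite /g ltn_ord. Qed.

Lemma mkseq_g w : mkseq (fun j => C w (off + j)) K = mkseq (g w) K.
Proof. by apply/eq_in_map => j; rewrite mem_iota add0n /g => /andP[_ ->]. Qed.

Lemma upd_g t S w : upd K t S (fun j => C w (off + j)) = upd K t S (g w).
Proof.
rewrite /upd code_g; congr (if _ && _ then _ else _).
by rewrite /vanish; congr (_ == 0); apply: eq_bigr => j _; rewrite /g ltn_ord.
Qed.

Lemma sim_mrun : mrun le (mstep y gs) g.
Proof.
have [a [fa Ca rCa]] := rC; exists a; split=> //.
  by apply/funext => j; rewrite /g Ca; case: ifP.
split=> [v w av vw|w aw lw i].
  apply/funext => j; rewrite /g; case: ifP => jK; last by rewrite /mstep -/K jK.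
  rewrite (rrun_succ rCa av vw) decider_sim // /mstep -/K jK.
  by rewrite mkseq_g.
rewrite /g; case: ltnP => iK; first exact: (rrun_lim rCa).
by left; split; [exists a|move=> v vw; exists v; split=> //; exact: wo_refl].
Qed.

Let first_all : exists2 a, is_first le a & C a = (fun=> 0) /\ rrun le (mstep y decider) C a.
Proof. by have [a [fa Ca rCa]] := rC; exists a. Qed.

Lemma run_first w i : is_first le w -> C w i = 0.
Proof. by have [a fa [Ca _]] := first_all => fw; rewrite (first_uniq wo fw fa) Ca. Qed.

Lemma run_succ v w : is_succ le v w -> C w = mstep y decider (C v).
Proof.
by have [a fa [_ rCa]] := first_all; apply: (rrun_succ rCa); exact: first_le.
Qed.

Lemma run_lim w i : is_limit le w -> rlim le (fun v => C v i) w (C w i).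
Proof.
have [a fa [_ rCa]] := first_all => lw; have [v vw] := limit_ex lw.
by apply: (rrun_lim rCa) => //; apply: (le_before_trans wo _ vw); exact: first_le.
Qed.

Lemma flag_succ v w : is_succ le v w -> C w 1 <> 0 <->
  eval y (mkseq (g v) K) hx <> 0 \/
  exists t, t < 2 ^ K /\ mem (C v (2 + t)) (code K (g v)).
Proof. by move=> vw; rewrite (run_succ vw) decider_flag mkseq_g code_g. Qed.

Lemma unflagged_fresh t w : t < 2 ^ K -> (forall u, before le u w -> C u 1 = 0) ->
  forall v, before le v w -> fresh (le := le) K g (fun u => C u (2 + t)) v.
Proof.
move=> tK nf v vw u uv; apply/negP => h.
have [s us sv] := succ_ex wo uv.
have : C s 1 <> 0 by apply/(flag_succ us); right; exists t.
by apply; apply: nf; exact: (le_before_trans wo sv).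
Qed.

Lemma stack_first t w : is_first le w -> C w (2 + t) = 0.
Proof. exact: run_first. Qed.

Lemma stack_succ t v w : t < 2 ^ K -> is_succ le v w ->
  C w (2 + t) = upd K t (C v (2 + t)) (g v).
Proof. by move=> tK vw; rewrite (run_succ vw) decider_stack // upd_g. Qed.

Lemma code_eq u v : code K (g u) = code K (g v) -> g u = g v.
Proof.
move=> E; apply/funext => j; rewrite {1}/g [in RHS]/g; case: (ltnP j K) => // jK.
have := logn_code (g u) jK; rewrite E logn_code // /g jK; exact: esym.
Qed.

(** If the flag was not raised by the halting test, it was raised by a stack entry; by [sound] this
    entry stems from an earlier time and has not been undercut since, which is a loop.
    [loop_capture] then confines every run to states that have already failed the test. *)
Lemma answer_correct w : C w 1 <> 0 -> (forall u, before le u w -> C u 1 = 0) ->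
  C w 0 = `[< ghalts gs hx y >].
Proof.
move=> fw nf; case: (@wo_cases _ le w) => [fiw|[v vw]|lw].
- by rewrite run_first in fw.
- have vw' : before le v w by case: vw.
  rewrite (run_succ vw) decider_answer mkseq_g; congr nat_of_bool.
  case: eqP => [h|h] /=; last first.
    by symmetry; apply/asboolP; exists W, le, g, v; split=> //; exact: sim_mrun.
  symmetry; apply/asboolP => -[W' [le' [g' [w' [wo' [a' [fa' ga' ra']] hw']]]]].
  have /(flag_succ vw)[//|[t [tK tS]]] := fw.
  have inv := stack_inv wo (@stack_first t) (fun v w => @stack_succ t v w tK)
    (fun w => @run_lim w (2 + t)) (unflagged_fresh tK nf vw').
  have [sv _] := inv; have [s [sv' Es _ sd]] := sv _ tS.
  have [a [fa ga ra]] := sim_mrun.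
  have L : loop le g s v.
    split=> //; first exact: code_eq.
    move=> u su uv j; have [->|uv'] := le_before uv; first by rewrite (code_eq Es).
    have [jK|jK] := ltnP j K; last by rewrite /g ltnNge jK.
    by have := sd _ su uv'; rewrite -Es => /code_dvd; apply.
  have [] := loop_capture (w' := w') wo wo' ra ra' _ _ L _.
  + by rewrite ga ga'.
  + exact: first_le.
  + exact: first_le.
  move=> u [_ uv gu]; have [z uz zv] := succ_ex wo uv.
  have : C z 1 <> 0 by apply/(flag_succ uz); left; rewrite gu.
  by apply; apply: nf; exact: (le_before_trans wo zv).
- have exw := limit_ex lw; case: fw.
  apply: (rlim_const wo exw _ (run_lim 1 lw)).
  by case: exw => v vw; exists v => // u _ /nf.
Qed.

(** Otherwise the simulated run loops between the times of [Cl]. A state recurring there is pushed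
    on the stack of its own zero set, stays on it by [stack_persistent], and is found again at a
    later time of [Cl]. *)
Lemma flag_raised : omega1 le -> exists w, C w 1 <> 0.
Proof.
move=> om; apply: contrapT => n.
have nf w : C w 1 = 0 by apply: contrapT => h; apply: n; exists w.
have fr t v : t < 2 ^ K -> fresh (le := le) K g (fun u => C u (2 + t)) v.
  move=> tK; have [b hb] := om_bdd om (fun=> v).
  exact: (unflagged_fresh tK (fun u _ => nf u) (hb 0)).
have [a [fa ga ra]] := sim_mrun.
have [Cl [unb clo lim L]] := run_loops om ra.
have [w0] := om_inh om.
(* The state [g l] occurs cofinally below the limit [l], so all entries stable at [l] divide its
   code: nothing is removed in the step after [l], and the state is pushed. *)
have [s [_ sCl sinc]] := om_next unb w0.
have [l [ll sl lmin]] := om_sup om sinc.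
have Cll : Cl l by exact: (clo s).
pose t := mkset K (fun j => g l j == 0).
have tK : t < 2 ^ K by exact: mkset_lt.
have mt j : mem t j = (j < K) && (g l j == 0) by rewrite mem_mkset.
have [w Clw lw] := unb l.
have [_ gE gge] := L _ _ Cll Clw lw.
have inv u := stack_inv wo (@stack_first t) (fun v w => @stack_succ t v w tK)
    (fun w => @run_lim w (2 + t)) (fr t u tK).
have push v : is_succ le l v -> mem (C v (2 + t)) (code K (g l)).
  move=> lv; rewrite (mem_upd (fun v w => @stack_succ t v w tK) _ lv).
    apply/orP; right; rewrite eqxx /=; apply/andP; split.
      by apply/vanishP => j jK; rewrite mt jK /= => /eqP.
    apply/eqP/mem_ext => d; rewrite mem_filt; case: (boolP (mem _ d)) => //= dl.
    have st := limit_stable wo (fun v w => @stack_succ t v w tK)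
      (fun w => @run_lim w (2 + t)) ll (fun u _ => inv u) (fr t l tK) dl.
    have dv := stable_dvd wo ll (fun u _ => inv u) st.
    have cs : cof le l (fun u => g u = g l).
      move=> x /lmin[k xk]; exists (s k); split=> //; first exact: beforeW.
      by case: (L _ _ (sCl k) Cll (sl k)).
    by have [u _ [h E]] := evt_cof dv cs; rewrite -E.
  have [b hb] := om_bdd om (fun=> l).
  by apply: (fr t b tK); exact: (hb 0).
have := stack_persistent wo (@stack_first t) (fun v w => @stack_succ t v w tK)
    (fun w => @run_lim w (2 + t)) (s := l) (w := w) (fun v => fr t v tK) _ _ _ push lw.
move=> /(_ (fun v lv vw j => gge v lv vw j)) H.
have {H} : mem (C w (2 + t)) (code K (g l)).
  apply: H; last exact: wo_refl.
  - move=> v lv lv' j jK; apply: (rrun_lim ra) => //.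
    by apply: (le_before_trans wo _ lv); exact: first_le.
  - by move=> j jK /eqP; rewrite mt jK.
rewrite gE; apply/negP; have [b hb] := om_bdd om (fun=> w).
by apply: (fr t b tK); exact: (hb 0).
Qed.

End Run.

Theorem halting_decidable : ITRM_decidable [set y | ghalts gs hx y].
Proof.
exists (machine decider) => y.
have H : yields (machine decider) y 0 `[< ghalts gs hx y >].
  apply: (machine_yields decider_ge2) => W le C.
    by move=> wo rC w; exact: (answer_correct wo rC).
  by move=> om rC; exact: (flag_raised (om_wo om) rC om).
by split=> h; [rewrite asboolT in H|rewrite asboolF in H].
Qed.

End Decider.

(** * Checking all bits of an oracle *)

Arguments eCst : simpl never.

Definition max_reg_instr (x : instr) := match x with
  | Zero i | Succ i | Oracle i => i.+1
  | Transfer i j | Jump i j _ => maxn i.+1 j.+1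
  end.
Definition num_regs (P : program) := foldr (fun x m => maxn (max_reg_instr x) m) 1 P.

Lemma onth_regs (P : program) l x : onth P l = Some x -> max_reg_instr x <= num_regs P.
Proof.
rewrite /num_regs; elim: P l => [|z P IH] [|l] //= => [[->]|/IH h]; first by rewrite leq_max leqnn.
by rewrite leq_max h orbT.
Qed.

Lemma num_regs_gt0 P : 0 < num_regs P.
Proof. by rewrite /num_regs; elim: P => //= x P IH; rewrite leq_max IH orbT. Qed.

Lemma onth_size (T : Type) (s : seq T) i : i < size s -> exists x, onth s i = Some x.
Proof. by elim: s i => [|x s IH] [|i] //=; [exists x|exact: IH]. Qed.

Lemma onth_default (T : Type) (s : seq T) i : size s <= i -> onth s i = None.
Proof. by elim: s i => [|x s IH] [|i] //=; exact: IH. Qed.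

Definition ePred a := Rec a Nil0 (Var 1).
Definition eSub a b := Rec b a (ePred (Var 0)).

Lemma eval_pred y env a : eval y env (ePred a) = (eval y env a).-1.
Proof. by rewrite /=; case: (eval y env a). Qed.

Lemma eval_sub y env a b : eval y env (eSub a b) = eval y env a - eval y env b.
Proof.
rewrite (@evalRec _ _ _ _ _ (fun _ acc => acc.-1)); last by move=> i acc; rewrite eval_pred.
by elim: (eval y env b) => [|n IH] /=; rewrite ?subn0 // IH subnS.
Qed.

Section Checker.
Variable P : program.
Let N := num_regs P.

(** Registers 0 and 1 hold the value 1 once the machine has been started and
    the successor of the bit [n] being checked; register 1 is thus 0 only
    initially and when all bits have been checked. The others hold the line and
    the registers of the simulation of [P] on input [n]. *)
Definition eN := ePred (Var 1).
Definition eR i := Var (3 + i).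

Fixpoint haltE (k : nat) : expr :=
  if k is k'.+1 then Ifeq (Var 2) (eCst k') Nil0 (haltE k') else eCst 1.

(** Mode 0 stands still, after acceptance or a wrong answer; mode 1 starts the next bit, initially
    or after a right answer; mode 2 performs a step of [P]. *)
Definition modeE : expr :=
  Ifeq (Var 1) Nil0 (Ifeq (Var 0) Nil0 (eCst 1) Nil0)
    (Ifeq (haltE (size P)) Nil0 (eCst 2) (Ifeq (eR 0) (Orc eN) (eCst 1) Nil0)).

Definition delE (e : expr) : expr := Ifeq (eSub eN e) Nil0 (Orc (Suc e)) (Orc e).

Definition instr_line (l : nat) (x : instr) : expr :=
  if x is Jump i j q then Ifeq (eR i) (eR j) (eCst q) (eCst l.+1) else eCst l.+1.

Definition instr_reg (i : nat) (x : instr) : expr :=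
  match x with
  | Zero j => if i == j then Nil0 else eR i
  | Succ j => if i == j then Suc (eR i) else eR i
  | Transfer j k => if i == k then eR j else eR i
  | Oracle j => if i == j then delE (eR i) else eR i
  | Jump _ _ _ => eR i
  end.

Fixpoint caseE (f : nat -> instr -> expr) (d : expr) (l : nat) (p : program) : expr :=
  if p is x :: p' then Ifeq (Var 2) (eCst l) (f l x) (caseE f d l.+1 p') else d.

Definition withmode (stay reset run : expr) : expr :=
  Ifeq modeE Nil0 stay (Ifeq modeE (eCst 1) reset run).

Definition checker : seq expr :=
  [:: eCst 1; Ifeq modeE (eCst 1) (Suc (Var 1)) (Var 1);
      withmode (Var 2) Nil0 (caseE instr_line (Var 2) 0 P)] ++
  mkseq (fun i => withmode (eR i) (if i == 0 then Var 1 else Nil0)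
    (caseE (fun _ => instr_reg i) (eR i) 0 P)) N.

Definition doneE : expr := Ifeq (Var 1) Nil0 (Var 0) Nil0.

Lemma size_checker : size checker = 3 + N.
Proof. by rewrite /checker size_cat size_mkseq. Qed.

Definition mode (y : cantor_space) (r : state) : nat :=
  if r 1 == 0 then (if r 0 == 0 then 1 else 0)
  else if r 2 < size P then 2
  else if r 3 == y (r 1).-1 then 1 else 0.

Definition cfg (r : state) : config := Config (r 2) (fun i => if i < N then r (3 + i) else 0).

Section Sem.
Variables (y : cantor_space) (r : state).
Let env := mkseq r (size checker).
Let n := (r 1).-1.

Lemma eval_env i : i < 3 + N -> eval y env (Var i) = r i.
Proof. by move=> h; rewrite eval_Var nth_mkseq // size_checker. Qed.

Let N0 : 0 < N := num_regs_gt0 P.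

Lemma eval_R i : i < N -> eval y env (eR i) = r (3 + i).
Proof. by move=> h; rewrite /eR eval_env // ltn_add2l. Qed.

Lemma eval_N : eval y env eN = n.
Proof. by rewrite eval_pred eval_env. Qed.

Lemma eval_Orc e : eval y env (Orc e) = y (eval y env e).
Proof. by []. Qed.

Lemma eval_Suc e : eval y env (Suc e) = (eval y env e).+1.
Proof. by []. Qed.

Lemma eval_Nil0 : eval y env Nil0 = 0.
Proof. by []. Qed.

Lemma eval_halt k : eval y env (haltE k) = ~~ (r 2 < k).
Proof.
elim: k => [|k IH]; first by rewrite eval_cst.
have -> : haltE k.+1 = Ifeq (Var 2) (eCst k) Nil0 (haltE k) by [].
rewrite eval_Ifeq eval_env // eval_cst IH eval_Nil0 ltnS (leq_eqVlt (r 2) k).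
by case: eqP.
Qed.

Lemma eval_mode : eval y env modeE = mode y r.
Proof.
rewrite /modeE !eval_Ifeq eval_R // !eval_env // eval_halt eval_Orc eval_N !eval_cst !eval_Nil0.
by rewrite /mode; case: eqP => // _; case: ltnP.
Qed.

Lemma eval_del i : i < N -> eval y env (delE (eR i)) = delete_bit y n (r (3 + i)).
Proof.
move=> iN; rewrite /delE eval_Ifeq eval_sub !eval_Orc eval_Suc eval_N eval_R // eval_Nil0.
by rewrite subn_eq0 /delete_bit leqNgt; case: ltnP.
Qed.

Lemma eval_case f d l p : l <= r 2 -> eval y env (caseE f d l p) =
  if onth p (r 2 - l) is Some x then eval y env (f (r 2) x) else eval y env d.
Proof.
elim: p l => [|x p IH] l lr; first by case: (r 2 - l).
have -> : caseE f d l (x :: p) = Ifeq (Var 2) (eCst l) (f l x) (caseE f d l.+1 p) by [].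
rewrite eval_Ifeq eval_env // eval_cst; case: eqP => [->|E]; first by rewrite subnn.
have lr' : l < r 2 by rewrite ltn_neqAle lr andbT; apply/eqP => h; apply: E.
by rewrite IH // -(subnSK lr').
Qed.

Lemma eval_withmode a b c : eval y env (withmode a b c) =
  if mode y r == 0 then eval y env a else
  if mode y r == 1 then eval y env b else eval y env c.
Proof. by rewrite /withmode eval_Ifeq eval_mode eval_Ifeq eval_mode eval_cst. Qed.

Lemma checker0 : mstep y checker r 0 = 1.
Proof. by rewrite /mstep size_checker. Qed.

Lemma checker1 : mstep y checker r 1 = if mode y r == 1 then (r 1).+1 else r 1.
Proof.
have -> : mstep y checker r 1 = eval y env (Ifeq modeE (eCst 1) (Suc (Var 1)) (Var 1)).
  by rewrite /mstep -/env size_checker.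
by rewrite eval_Ifeq eval_mode eval_cst eval_Suc eval_env.
Qed.

Lemma checker2 : mstep y checker r 2 = eval y env
  (withmode (Var 2) Nil0 (caseE instr_line (Var 2) 0 P)).
Proof. by rewrite /mstep -/env size_checker. Qed.

Lemma checker3 i : i < N -> mstep y checker r (3 + i) = eval y env
  (withmode (eR i) (if i == 0 then Var 1 else Nil0)
    (caseE (fun _ => instr_reg i) (eR i) 0 P)).
Proof.
move=> iN; rewrite /mstep -/env size_checker ltn_add2l iN; congr eval.
by rewrite -[LHS]/(nth Nil0 (mkseq _ N) i) nth_mkseq.
Qed.

(** The counter holds the successor of the bit being checked and is just being incremented, so its
    old value [r 1] is the bit to be checked next, hence the input. *)
Lemma checker_reset : mode y r = 1 -> cfg (mstep y checker r) = init (r 1).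
Proof.
move=> m1; rewrite /cfg checker2 eval_withmode m1 /init; congr Config.
apply/funext => i /=; case: ltnP => iN; last by rewrite gtn_eqF // (leq_trans N0 iN).
by rewrite checker3 // eval_withmode m1 /=; case: eqP => // _; rewrite eval_env.
Qed.

(** In mode 0 with a bit under check [P] has halted, and standing still is what [step] does then; so
    the simulation remains a run of [P] even after a wrong answer. *)
Lemma checker_step : mode y r != 1 -> r 1 != 0 ->
  cfg (mstep y checker r) = step P (delete_bit y n) (cfg r).
Proof.
move=> m1 r1; rewrite /cfg /step checker2 eval_withmode (negbTE m1).
have [m0|m0] := eqVneq (mode y r) 0.
  have sz : size P <= r 2.
    by rewrite leqNgt; apply/negP => h; rewrite /mode (negbTE r1) h in m0.
  rewrite onth_default // eval_env //; congr Config; apply/funext => i.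
  by case: ltnP => // iN; rewrite checker3 // eval_withmode m0 eqxx eval_R.
rewrite eval_case // subn0.
have sz : r 2 < size P.
  by move: m0 m1; rewrite /mode (negbTE r1); case: ifP => // _; case: ifP.
have [x Px] := onth_size sz; rewrite Px; have xN := onth_regs Px.
have regE i : i < N -> mstep y checker r (3 + i) = eval y env (instr_reg i x).
  move=> iN; rewrite checker3 // eval_withmode (negbTE m1) (negbTE m0) eval_case // subn0 Px.
  by [].
have regF f : (forall i, i < N -> eval y env (instr_reg i x) = f i) ->
    (forall i, N <= i -> 0 = f i) ->
    (fun i => if i < N then mstep y checker r (3 + i) else 0) = f.
  by move=> f1 f2; apply/funext => i; case: ltnP => iN; [rewrite regE ?f1|rewrite -f2].
case: x Px xN {regE} regF => [i|i|i j|i|i j q] Px xN regF;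
  rewrite [instr_line _ _]/=; rewrite /= in xN.
- rewrite eval_cst; congr Config; apply: regF => k kN /=; last first.
    by rewrite ltnNge kN; case: eqP.
  by rewrite kN; case: eqP => // _; rewrite eval_R.
- rewrite eval_cst; congr Config; apply: regF => k kN /=; last first.
    by rewrite gtn_eqF ?(leq_trans xN kN) // ltnNge kN.
  by rewrite kN; case: eqP => [<-|_]; rewrite ?eval_Suc ?eval_R // kN.
- move: xN; rewrite geq_max => /andP[iN jN].
  rewrite eval_cst; congr Config; apply: regF => k kN /=; last first.
    by rewrite gtn_eqF ?(leq_trans jN kN) // ltnNge kN.
  by rewrite kN; case: eqP => [_|_]; rewrite eval_R // ?iN.
- rewrite eval_cst; congr Config; apply: regF => k kN /=; last first.
    by rewrite gtn_eqF ?(leq_trans xN kN) // ltnNge kN.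
  by rewrite kN; case: eqP => [<-|_]; rewrite ?eval_del ?eval_R // kN.
- move: xN; rewrite geq_max => /andP[iN jN].
  rewrite eval_Ifeq !eval_cst !eval_R // iN jN; congr Config.
  apply: regF => k kN; first by rewrite [instr_reg _ _]/= kN eval_R.
  by rewrite ltnNge kN.
Qed.

Lemma eval_done : eval y env doneE <> 0 <-> r 0 <> 0 /\ r 1 = 0.
Proof.
rewrite /doneE eval_Ifeq !eval_env // eval_Nil0.
by case: eqP => [->|E]; split=> // -[].
Qed.

End Sem.

Lemma cfg_rrun {W : Type} (le : rel W) (wo : well_order le) y n (C : W -> state) a :
  rrun le (mstep y checker) C a -> (forall w, le a w -> C w 1 = n.+1) ->
  rrun le (pstep P (delete_bit y n)) (fun w => encode (cfg (C w))) a.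
Proof.
move=> rC Cn; split=> [v w av vw|w aw lw i].
  rewrite /pstep encodeK (rrun_succ rC av vw) checker_step ?Cn //.
  apply/eqP => m1; have := Cn w (wo_trans wo av (beforeW (proj1 vw))).
  by rewrite (rrun_succ rC av vw) checker1 m1 eqxx Cn //; lia.
have exw : exists v, before le v w by exists a.
case: i => [|i] /=; first exact: (rrun_lim rC).
case: ltnP => iN; first exact: (rrun_lim rC).
left; split; first by exists a.
by move=> v vw; exists v; split=> //; exact: wo_refl.
Qed.

Section Run.
Variables (y : cantor_space) (W : Type) (le : rel W) (wo : well_order le).
Variable C : W -> state.
Hypothesis rC : mrun le (mstep y checker) C.

Definition acc w := C w 0 <> 0 /\ C w 1 = 0.

Let first_all : exists2 a, is_first le a & C a = (fun=> 0) /\ rrun le (mstep y checker) C a.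
Proof. by have [a [fa Ca rCa]] := rC; exists a. Qed.

Lemma ck_first w i : is_first le w -> C w i = 0.
Proof. by have [a fa [Ca _]] := first_all => fw; rewrite (first_uniq wo fw fa) Ca. Qed.

Lemma ck_rrun u : rrun le (mstep y checker) C u.
Proof.
have [a fa [_ r]] := first_all; have au := @first_le _ _ wo a u fa.
split=> [v w uv vw|w uw lw]; first exact: (rrun_succ r (wo_trans wo au uv) vw).
exact: (rrun_lim r (le_before_trans wo au uw) lw).
Qed.

Lemma ck_succ v w : is_succ le v w -> C w = mstep y checker (C v).
Proof. exact: (rrun_succ (ck_rrun v) (wo_refl wo v)). Qed.

Lemma ck_lim w i : is_limit le w -> rlim le (fun v => C v i) w (C w i).
Proof. by move=> lw; have [v vw] := limit_ex lw; exact: (rrun_lim (ck_rrun v) vw). Qed.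

Lemma ck_started w : ~ is_first le w -> C w 0 = 1.
Proof.
elim/(@wo_ind _ _ wo): w => w IH nfw.
case: (@wo_cases _ le w) => [//|[v vw]|lw]; first by rewrite (ck_succ vw) checker0.
have exw := limit_ex lw; have [v vw] := exw.
have [u vu uw] := limit_dense wo lw vw.
apply: (rlim_const wo exw _ (ck_lim 0 lw)); exists u => // x ux xw.
by apply: IH => // fx; exact: (fx _ (before_le_trans wo vu ux)).
Qed.

Lemma ck_pos w : ~ is_first le w -> ~ acc w -> 0 < C w 1.
Proof.
move=> nfw na; rewrite lt0n; apply/eqP => w1; apply: na; split=> //.
by rewrite ck_started.
Qed.

(** The counter can fall only by overflowing, and an overflow is acceptance, as register 0 holds 1
    at every time but the first. *)
Lemma ck_mono u v : (forall x, le x v -> ~ acc x) -> le u v -> C u 1 <= C v 1.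
Proof.
elim/(@wo_ind _ _ wo): v => v IH na uv.
have [->//|uv'] := le_before uv.
case: (@wo_cases _ le v) => [/(_ _ uv')//|[p pv]|lv].
  have pv' : before le p v by case: pv.
  apply: (@leq_trans (C p 1)).
    apply: IH => //; last exact: (before_succ wo pv).
    by move=> x xp; apply: na; exact: (wo_trans wo xp (beforeW pv')).
  by rewrite (ck_succ pv) checker1; case: ifP.
have IH' x : le u x -> before le x v -> C u 1 <= C x 1.
  move=> ux xv; apply: IH => // z zx; apply: na; exact: (wo_trans wo zx (beforeW xv)).
case: (ck_lim 1 lv) => [[_ c]|[v1 _]].
  by have [x [ux xv <-]] := c _ uv'; exact: IH'.
have := @ck_pos v _ (na _ (wo_refl wo v)); rewrite v1 => h.
by have : 0 < 0 by apply: h => /(_ _ uv').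
Qed.

(** A liminf never exceeds all earlier values, so the counter first passes [n] at a successor time,
    where mode 1 has just started the check of bit [n]. *)
Lemma ck_reach n t : (forall x, le x t -> ~ acc x) -> n < C t 1 ->
  exists p s, [/\ is_succ le p s, le s t, C p 1 = n /\ C s 1 = n.+1, mode y (C p) = 1 &
    cfg (C s) = init n].
Proof.
move=> na nt.
have [|s ns smin] := @wo_min _ _ wo (fun s => n < C s 1); first by exists t.
have st := smin _ nt.
have bel x : before le x s -> C x 1 <= n.
  by move=> xs; rewrite leqNgt; apply/negP => /smin; exact: (before_le_false wo xs).
case: (@wo_cases _ le s) => [fs|[p ps]|ls].
- by rewrite ck_first in ns.
- have pn : C p 1 <= n by apply: bel; case: ps.
  have m1 : mode y (C p) = 1.
    apply/eqP/contraT => m1; move: ns.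
    by rewrite (ck_succ ps) checker1 (negbTE m1) ltnNge pn.
  have E : C s 1 = (C p 1).+1 by rewrite (ck_succ ps) checker1 m1.
  have pn' : C p 1 = n by move: ns; rewrite E; lia.
  exists p, s; split=> //; first by rewrite E pn'.
  by rewrite (ck_succ ps) checker_reset // pn'.
- have [v vs] := limit_ex ls.
  case: (ck_lim 1 ls) => [[_ c]|[s1 _]]; last by rewrite s1 in ns.
  have [u [_ us E]] := c _ vs.
  by have := bel _ us; rewrite E leqNgt ns.
Qed.

(** From the start [s] of bit [n] to the time [q] just before the start of the next bit the counter
    is constant; this closed interval is a computation of [P] that has halted at [q], and mode 1 at
    [q] certifies the answer. *)
Lemma ck_sound w n : acc w -> yields P (delete_bit y n) n (y n).
Proof.
move=> aw; have [|z az zmin] := @wo_min _ _ wo acc; first by exists w.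
have na x : before le x z -> ~ acc x.
  by move=> xz /zmin; exact: (before_le_false wo xz).
have na' x v : before le v z -> le x v -> ~ acc x.
  by move=> vz xv; apply: na; exact: (le_before_trans wo xv).
have [z0 z1] := az.
(* The counter is positive between the first time and [z], and no step makes it 0, so [z] is a
   limit. A finite liminf 0 would need an earlier value 0; hence the counter overflows at [z]. *)
have [b bz bn] : exists2 b, before le b z & n.+1 < C b 1.
  case: (@wo_cases _ le z) => [fz|[v vz]|lz].
  - by rewrite ck_first in z0.
  - have vz' : before le v z by case: vz.
    move: z1; rewrite (ck_succ vz) checker1; case: eqP => [//|m1 v1].
    have [fv|nfv] := EM (is_first le v).
      by case: m1; rewrite /mode !ck_first.
    by have := ck_pos nfv (na _ vz'); rewrite v1.
  - have [v vz] := limit_ex lz; have [u vu uz] := limit_dense wo lz vz.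
    case: (ck_lim 1 lz) => [[_ c]|[_ big]].
      rewrite z1 in c; have [x [ux xz x1]] := c _ uz.
      have := @ck_pos x _ (na _ xz); rewrite x1 => h.
      by have : 0 < 0 by apply: h => /(_ _ (before_le_trans wo vu ux)).
    by have [x xz h] := big n.+2; exists x => //; apply: h => //; exact: wo_refl.
have [q [b' [qb bb' [qn b'n] mq _]]] := ck_reach (fun x => na' x _ bz) bn.
have b'z := le_before_trans wo bb' bz.
have [p [s [ps sb' [pn sn] _ cs]]] := ck_reach (t := b') (n := n) (fun x => na' x _ b'z)
  (leq_trans (leqnSn _) (eq_leq (esym b'n))).
have qb' : before le q b' by case: qb.
have qz := before_trans wo qb' b'z.
have sq : le s q.
  apply: (before_succ wo qb); have [E|//] := le_before sb'.
  by rewrite E b'n in sn; lia.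
have [fa rI] := rrun_interval wo sq (ck_rrun s).
set M := fun w => le s w /\ le w q in fa rI.
set so := subord (le := le) (M := M) in fa rI.
have soW : well_order so := subord_wo wo (M := M).
have rP := @cfg_rrun _ so soW y n _ _ rI.
have {}rP := rP _.
have cn (x : {w | M w}) : C (sval x) 1 = n.+1.
  case: x => x [sx xq] /=.
  have xz := le_before_trans wo xq qz.
  have h1 := ck_mono (fun u => na' u _ xz) sx.
  have h2 := ck_mono (fun u => na' u _ qz) xq.
  by apply/eqP; rewrite eqn_leq -{1}qn h2 -sn h1.
have {}rP := rP (fun w _ => cn w).
have cC := rrun_computation (c0 := init n) soW fa _ _ rP.
exists {w | M w}, so.
exists (fun w => decode (encode (cfg (C (sval w))))).
have Mq : M q by split=> //; exact: wo_refl.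
exists (exist _ q Mq); split=> //.
- by apply: cC => //; rewrite encodeK.
- rewrite encodeK /halted /=; move: mq; rewrite /mode qn /=.
  by case: leqP.
- rewrite encodeK /= num_regs_gt0; move: mq; rewrite /mode qn /=.
  by case: leqP => // _; case: eqP.
Qed.

End Run.

Lemma checker_sound y n : ghalts checker doneE y -> yields P (delete_bit y n) n (y n).
Proof.
move=> [W [le [g [w [wo rg /eval_done h]]]]].
exact: (ck_sound wo rg (w := w)).
Qed.

(** If the counter stalled at [n.+1], the simulation would go on for ever and loop; by
    [loop_capture] it would contain the halting configuration given by [yn], after which the counter
    advances. So every [n] is passed, and at the first time where this is achieved the counter
    overflows, which is acceptance. *)
Lemma checker_complete y : (forall n, yields P (delete_bit y n) n (y n)) ->
  ghalts checker doneE y.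
Proof.
move=> yn; have [W [le om]] := omega1_ex; have wo := om_wo om.
have [C [Cf rC]] := rrun_ex wo (mstep y checker) (fun=> 0).
have [w0] := om_inh om; have [a fa _] := first_ex wo w0.
have mC : mrun le (mstep y checker) C by exists a; split=> //; exact: Cf.
apply: contrapT => nh.
have na w : ~ acc C w.
  by move=> aw; apply: nh; exists W, le, C, w; split=> //; apply/eval_done.
have sc v : exists s, is_succ le v s.
  have [b hb] := om_bdd om (fun=> v).
  by have [s vs _] := succ_ex wo (hb 0); exists s.
have big n : exists t, n < C t 1.
  elim: n => [|n [t nt]].
    have [s as_] := sc a; exists s.
    by rewrite (ck_succ wo mC as_) checker1 /mode !Cf.
  apply: contrapT => nex.
  have [p [s [ps st [pn sn] mp cs]]] := ck_reach wo mC (fun x _ => na x) nt.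
  have sn' w : le s w -> C w 1 = n.+1.
    move=> sw; apply/eqP; rewrite eqn_leq -{2}sn (ck_mono wo mC (fun x _ => na x) sw) andbT.
    by rewrite leqNgt; apply/negP => h; apply: nex; exists w.
  have rP := cfg_rrun wo (ck_rrun wo mC s) sn'.
  have [Cl [unb _ lim L]] := run_loops om rP.
  have [u Cu _] := unb s; have [v Cv uv] := unb u.
  have [W' [le' [C' [w' [wo' cC' hw' rw']]]]] := yn n.
  have [a' fa' _] := first_ex wo' w'.
  have [C'a rC'] := computation_rrun wo' fa' cC'.
  have [|||x [sx xv E]] := loop_capture (w' := w') wo wo' rP rC' _ _ (L _ _ Cu Cv uv) _.
  - by rewrite cs C'a.
  - by have [_ su] := lim _ Cu; exact: beforeW.
  - exact: first_le.
  have Ex : cfg (C x) = C' w' by rewrite -[LHS]encodeK E encodeK.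
  have [z xz] := sc x.
  have m1 : mode y (C x) = 1.
    rewrite /mode (sn' _ sx) /= ltnNge; move: hw' rw'; rewrite -Ex /halted /= => -> /=.
    by rewrite num_regs_gt0 => ->; rewrite eqxx.
  apply: nex; exists z.
  by rewrite (ck_succ wo mC xz) checker1 m1 eqxx (sn' _ sx).
have [t ht] := choice big.
have [b hb] := om_bdd om t.
pose Q l := forall n, exists2 u, before le u l & n < C u 1.
have [|l Ql lmin] := @wo_min _ _ wo Q; first by exists b => n; exists (t n).
case: (@wo_cases _ le l) => [fl|[v vl]|ll].
- by have [u ul] := Ql 0; case: (fl _ ul).
- have [u ul] := Ql (C v 1).
  by rewrite ltnNge (ck_mono wo mC (fun x _ => na x)) // (before_succ wo vl).
- have := @ck_pos _ _ _ wo _ mC l _ (na l).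
  case: (ck_lim wo mC 1 ll) => [[_ c]|[-> _]] h; last first.
    have [v vl] := limit_ex ll.
    by have : 0 < 0 by apply: h => /(_ _ vl).
  have [u ul un] := Ql (C l 1).
  have [x [ux _ Ex]] := c _ ul.
  by have := ck_mono wo mC (fun z _ => na z) ux; rewrite Ex leqNgt un.
Qed.

End Checker.

(** * Smallness of the set of autoreduced reals *)

Section Measurability.
Variable fr : frame cantor_space.
Hypothesis bits : forall k b, meas fr [set y : cantor_space | y k = b].

Definition mfun (f : cantor_space -> nat) := forall k, meas fr [set y | f y = k].

Lemma mfun_cst k : mfun (fun=> k).
Proof. by move=> j; exact: meas_cst. Qed.

Lemma mfun_pred f (P : nat -> Prop) : mfun f -> meas fr [set y | P (f y)].
Proof.
move=> mf; apply: (@meas_ext _ _ [set y | exists k, f y = k /\ P k]).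
  by move=> x; split=> [[_ [<-]]//|Px]; exists (f x).
by apply: meas_ex => k; apply: meas_and; [exact: mf|exact: meas_cst].
Qed.

Lemma mfun_bind f (h : nat -> cantor_space -> nat) :
  mfun f -> (forall j, mfun (h j)) -> mfun (fun y => h (f y) y).
Proof.
move=> mf mh k; apply: (@meas_ext _ _ [set y | exists j, f y = j /\ h j y = k]).
  by move=> x; split=> [[_ [<-]]//|Px]; exists (f x).
by apply: meas_ex => j; apply: meas_and; [exact: mf|exact: mh].
Qed.

Lemma mfun_bit k : mfun (fun y => nat_of_bool (y k)).
Proof.
move=> j; apply: (@meas_ext _ _ [set y | exists b : bool, y k = b /\ nat_of_bool b = j]).
  by move=> x; split=> [[_ [<-]]//|Px]; exists (x k).
by apply: meas_ex => b; apply: meas_and; [exact: bits|exact: meas_cst].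
Qed.

Lemma mfun_eval e (env : cantor_space -> seq nat) :
  (forall i, mfun (fun y => nth 0 (env y) i)) -> mfun (fun y => eval y (env y) e).
Proof.
elim: e env => [i||e IH|e IH|a IHa b IHb c IHc d IHd|n IHn a IHa b IHb] env menv /=.
- exact: menv.
- exact: mfun_cst.
- by apply: (mfun_bind (h := fun j _ => j.+1)) => [|j]; [exact: IH|exact: mfun_cst].
- by apply: (mfun_bind (h := fun j y => y j)) => [|j]; [exact: IH|exact: mfun_bit].
- apply: (mfun_bind (h := fun p y => if p == eval y (env y) b
    then eval y (env y) c else eval y (env y) d)) => [|p]; first exact: IHa.
  apply: (mfun_bind (h := fun q y => if p == q
    then eval y (env y) c else eval y (env y) d)) => [|q]; first exact: IHb.
  by case: (p == q); [exact: IHc|exact: IHd].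
- apply: (mfun_bind (h := fun m y => iteri m (fun i acc => eval y [:: acc, i & env y] b)
    (eval y (env y) a))) => [|m]; first exact: IHn.
  elim: m => [|m IHm] /=; first exact: IHa.
  apply: (mfun_bind (h := fun acc y => eval y [:: acc, m & env y] b)) => // acc.
  by apply: IHb => -[|[|i]] /=; [exact: mfun_cst|exact: mfun_cst|exact: menv].
Qed.

Lemma mfun_mkseq (f : cantor_space -> state) K : (forall i, mfun (fun y => f y i)) ->
  forall i, mfun (fun y => nth 0 (mkseq (f y) K) i).
Proof.
move=> mf i; have [iK|Ki] := ltnP i K.
  by move=> k; apply: meas_ext (mf i k) => y /=; rewrite nth_mkseq.
by move=> k; apply: meas_ext (mfun_cst 0 k) => y /=; rewrite nth_default ?size_mkseq.
Qed.

Variables (gs : seq expr) (hx : expr).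

(** At each time every register is a measurable function of the oracle, by induction along countable
    segments. An oracle that halts, but not before the stage [v] given by [stabilize], has no loop
    from [u] to [v]; such oracles form a small, hence measurable, set. *)
Lemma ghalts_meas : meas fr [set y | ghalts gs hx y].
Proof.
have [W [le om]] := omega1_ex; have wo := om_wo om.
have [D hD] := choice (fun y => rrun_ex wo (mstep y gs) (fun=> 0)).
have [w0] := om_inh om; have [a fa _] := first_ex wo w0.
have ale w := @first_le _ _ wo a w fa.
have mD w i : mfun (fun y => D y w i).
  elim/(@wo_ind _ _ wo): w i => w IH i.
  case: (@wo_cases _ le w) => [fw|[v vw]|lw].
  - by move=> k; apply: meas_ext (mfun_cst 0 k) => y /=; rewrite (hD y).1.
  - have mv : forall i, mfun (fun y => D y v i) by move=> j; apply: IH; case: vw.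
    have me : mfun (fun y => mstep y gs (D y v) i).
      rewrite /mstep; case: (i < size gs); last exact: mfun_cst.
      by apply: mfun_eval; exact: mfun_mkseq.
    by move=> k; apply: meas_ext (me k) => y /=;
      rewrite (rrun_succ ((hD y).2 a) (ale v) vw).
  - have [v vw] := limit_ex lw; have aw := le_before_trans wo (ale v) vw.
    have exw : exists v, before le v w by exists v.
    move=> k; apply: (@meas_ext _ _ [set y | rlim le (fun v => D y v i) w k]) => [y /=|].
      split=> [h|<-]; last exact: (rrun_lim ((hD y).2 a)).
      exact: (rlim_uniq exw (rrun_lim ((hD y).2 a) aw lw i) h).
    have mevt (P : nat -> Prop) : meas fr [set y | evt le w (fun u => P (D y u i))].
      apply: (@meas_ext _ _ [set y | exists2 x, before le x w &
          forall u, before le u w -> le x u -> P (D y u i)]).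
        by move=> y; split=> -[x xw h]; exists x => // u ? ?; exact: h.
      apply: (meas_ex_seg om) => x xw; apply: (meas_all_seg om) => u uw.
      by apply: meas_imp => _; exact: (mfun_pred P (IH u uw i)).
    apply: meas_or.
      apply: meas_and; first exact: (mevt (fun m => k <= m)).
      apply: (@meas_ext _ _ (~` [set y | evt le w (fun u => D y u i <> k)])).
        move=> y; split=> [h|c [x xw h]].
          by apply: cof_mono (not_evt h) => u _ /contrapT.
        by have [u [xu uw E]] := c _ xw; exact: h E.
      exact: (measC (mevt (fun m => m <> k))).
    apply: meas_and; first exact: meas_cst.
    by apply: meas_all => j; exact: (mevt (fun m => j <= m)).
have [||Cl [unb _ lim L]] := @stabilize _ fr _ _ om a D.
- by move=> w i k; exact: mD.
- by move=> y w aw lw i; exact: (rrun_lim ((hD y).2 a)).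
have [u Cu _] := unb a; have [v Cv uv] := unb u.
pose Y := [set y | exists2 x, before le x v & eval y (mkseq (D y x) (size gs)) hx <> 0].
have mY : meas fr Y.
  apply: (meas_ex_seg om) => x _; apply: (mfun_pred (fun m => m <> 0)).
  by apply: mfun_eval; apply: mfun_mkseq => i; exact: mD.
apply: (@meas_ext _ _ [set y | Y y \/ (ghalts gs hx y /\ ~ loop le (D y) u v)]).
  move=> y; split=> [[[x xv h]|[]//]|].
    exists W, le, (D y), x; split=> //; exists a; split=> //; last exact: (hD y).2.
    exact: (hD y).1.
  move=> gh; have [Ly|nL] := EM (loop le (D y) u v); [left|by right].
  have [W' [le' [g' [w' [wo' [a' [fa' ga' ra']] hw']]]]] := gh.
  have [|||x [_ xv E]] := loop_capture (w' := w') wo wo' ((hD y).2 a) ra' _ _ Ly _.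
  + by rewrite ga' (hD y).1.
  + exact: ale.
  + exact: first_le.
  by exists x; rewrite ?E.
apply: meas_or; first exact: mY.
apply: small_meas; apply: small_sub (L _ _ Cu Cv uv).
by move=> y [].
Qed.

End Measurability.

Definition flip (n : nat) (x : cantor_space) : cantor_space := fun k => x k (+) (k == n).

Lemma flipK n : involutive (flip n).
Proof. by move=> x; apply/funext => k; rewrite /flip -addbA addbb addbF. Qed.

Lemma delete_bit_flip n x : delete_bit (flip n x) n = delete_bit x n.
Proof.
apply/funext => k; rewrite /delete_bit /flip; case: ltnP => kn.
  by rewrite ltn_eqF // addbF.
by rewrite gtn_eqF // addbF.
Qed.

Lemma halted_stay {W : Type} (le : rel W) (wo : well_order le) P y (C : W -> state) u :
  rrun le (pstep P y) C u -> halted P (decode (C u)) -> forall w, le u w -> C w = C u.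
Proof.
move=> rC hu; elim/(@wo_ind _ _ wo) => w IH uw.
have [<-//|uw'] := le_before uw.
case: (@wo_cases _ le w) => [/(_ _ uw')//|[v vw]|lw].
  have uv := before_succ wo vw uw'.
  rewrite (rrun_succ rC uv vw) IH //; last by case: vw.
  by rewrite /pstep /step /= onth_default // -[RHS]decodeK.
apply/funext => i; apply: (rlim_const wo _ _ (rrun_lim rC uw' lw i)); first by exists u.
by exists u => // v uv vw; rewrite IH.
Qed.

(** The time type is left free by [yields]; along [sametime] the shorter computation is part of the
    longer one, which no longer changes once halted. *)
Lemma yields_uniq P y n m m' : yields P y n m -> yields P y n m' -> m = m'.
Proof.
move=> [W [le [C [w [wo cC hw <-]]]]] [W' [le' [C' [w' [wo' cC' hw' <-]]]]].
have [a fa _] := first_ex wo w; have [a' fa' _] := first_ex wo' w'.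
have [Ca rC] := computation_rrun wo fa cC; have [Ca' rC'] := computation_rrun wo' fa' cC'.
have aw := @first_le _ _ wo a w fa; have aw' := @first_le _ _ wo' a' w' fa'.
have sub V (l : rel V) (wl : well_order l) (B : V -> state) z u : rrun l (pstep P y) B z -> l z u ->
    rrun l (pstep P y) B u.
  move=> rB zu; split=> [p q up pq|q uq lq]; first exact: (rrun_succ rB (wo_trans wl zu up) pq).
  exact: (rrun_lim rB (le_before_trans wl zu uq) lq).
suff E : encode (C w) = encode (C' w').
  by have := congr1 (fun r => r 1) E.
have inst := sametime_state wo wo' rC rC' (congr1 encode (etrans Ca (esym Ca'))).
case: (sametime_total wo wo' a a' w w') => [h|[v [av vw h]]|[v [av vw h]]].
- exact: inst.
- have E := inst _ _ aw av h.
  rewrite E; symmetry; apply: (halted_stay wo' (sub _ _ wo' _ _ _ rC' av) _ (beforeW vw)).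
  by rewrite -E encodeK.
- have E := inst _ _ av aw' h.
  rewrite -E; apply: (halted_stay wo (sub _ _ wo _ _ _ rC av) _ (beforeW vw)).
  by rewrite E encodeK.
Qed.

(** The measurable set on which [P] recovers every bit cannot be big in a
    cylinder [s], since flipping a bit beyond [s] maps it off itself. *)
Lemma autoreducible_small (fr : frame cantor_space) (P : program) :
  (forall k b, meas fr [set y : cantor_space | y k = b]) ->
  (forall s : basic fr, exists n, forall A, big A s -> big (flip n @^-1` A) s) ->
  small fr [set y | ghalts (checker P) doneE y].
Proof.
move=> bits hflip; apply: contrapT => ns.
have mX := ghalts_meas bits (checker P) doneE.
have [s bs] := big_ex mX ns; have [n hn] := hflip s.
have [y [/= Xy Xy']] := big_meet mX bs (hn _ bs).
have := yields_uniq (checker_sound n Xy).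
have := checker_sound n Xy'; rewrite delete_bit_flip => h /(_ _ h).
by rewrite /flip eqxx; case: (y n).
Qed.

Theorem frame_incompressible (fr : frame cantor_space) (x : cantor_space) :
  (forall k b, meas fr [set y : cantor_space | y k = b]) ->
  (forall s : basic fr, exists n, forall A, big A s -> big (flip n @^-1` A) s) ->
  ITRM_autoreducible x ->
  exists X, [/\ ITRM_decidable X, small fr X & X x].
Proof.
move=> bits hflip [P hP]; exists [set y | ghalts (checker P) doneE y]; split.
- exact: halting_decidable.
- exact: autoreducible_small.
- exact: checker_complete.
Qed.

(** * Category and measure *)

Lemma cylinder_nth (s : seq bool) : cylinder s (fun i => nth false s i).
Proof. by []. Qed.

Lemma cylinder_sub s t : cylinder t `<=` cylinder s ->
  forall i, i < size s -> nth false t i = nth false s i.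
Proof. by move=> ts i si; have /(_ i si) := ts _ (@cylinder_nth t). Qed.

Lemma cylinder_cat s t : cylinder (s ++ t) `<=` cylinder s.
Proof.
by move=> x xs i si; rewrite xs ?nth_cat ?si // size_cat ltn_addr.
Qed.

Lemma cylinder_dichotomy s t : size s <= size t ->
  cylinder t `<=` cylinder s \/ forall x, cylinder t x -> ~ cylinder s x.
Proof.
move=> st; have [h|n] := EM (forall i, i < size s -> nth false t i = nth false s i).
  by left=> x xt i si; rewrite xt ?h //; exact: leq_trans st.
by right=> x xt xs; apply: n => i si; rewrite -xs // -xt //; exact: leq_trans st.
Qed.

Lemma cylinder_extend s t : exists2 t', cylinder t' `<=` cylinder t &
  cylinder t' `<=` cylinder s \/ forall x, cylinder t' x -> ~ cylinder s x.
Proof.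
exists (t ++ nseq (size s) false); first exact: cylinder_cat.
by apply: cylinder_dichotomy; rewrite size_cat size_nseq leq_addl.
Qed.

Definition flip_seq n (s : seq bool) := mkseq (fun i => nth false s i (+) (i == n)) (size s).

Lemma cylinder_flip n s x : cylinder s x -> cylinder (flip_seq n s) (flip n x).
Proof.
move=> xs i; rewrite size_mkseq => si; rewrite nth_mkseq // /flip; congr (_ (+) _).
exact: xs.
Qed.

Lemma flip_seqK n s : flip_seq n (flip_seq n s) = s.
Proof.
apply: (@eq_from_nth _ false); rewrite !size_mkseq // => i si.
by rewrite !nth_mkseq ?size_mkseq // -addbA addbb addbF.
Qed.

Lemma cylinder_flip_beyond n s x : size s <= n -> cylinder s x -> cylinder s (flip n x).
Proof.
move=> sn xs i si; rewrite /flip ltn_eqF ?addbF ?xs //; exact: leq_trans sn.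
Qed.

Section Category.

(** Nowhere dense and meager sets. *)
Definition rare (A : set cantor_space) := forall s, exists2 t,
  cylinder t `<=` cylinder s & forall x, cylinder t x -> ~ A x.
Definition lean (A : set cantor_space) :=
  exists2 F : nat -> set cantor_space, forall k, rare (F k) & A `<=` \bigcup_k F k.
(** Equivalent to the Baire property: the cylinders on which the set is meager or comeager are
    dense. In this form complements are immediate. *)
Definition baire_meas (A : set cantor_space) := forall s, exists2 t,
  cylinder t `<=` cylinder s & lean (cylinder t `&` A) \/ lean (cylinder t `&` ~` A).
Definition comeager_in (A : set cantor_space) (s : seq bool) := lean (cylinder s `&` ~` A).

Lemma rare0 : rare set0.
Proof. by move=> s; exists s => // x _ []. Qed.

Lemma rare_lean A : rare A -> lean A.
Proof. by move=> rA; exists (fun=> A) => // x Ax; exists 0. Qed.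

Lemma lean_sub A B : A `<=` B -> lean B -> lean A.
Proof. by move=> AB [F rF BF]; exists F => // x /AB /BF. Qed.

Lemma lean_bigcup (I : countType) (A : I -> set cantor_space) : (forall i, lean (A i)) ->
  lean [set x | exists i, A i x].
Proof.
move=> lA; have ex i : exists F : nat -> set cantor_space,
    (forall k, rare (F k)) /\ A i `<=` \bigcup_k F k.
  by have [F rF AF] := lA i; exists F.
have [F hF] := choice ex.
exists (fun m => if @unpickle (I * nat)%type m is Some (i, k) then F i k else set0).
  by move=> m; case: unpickle => [[i k]|]; [exact: (hF i).1|exact: rare0].
move=> x [i /((hF i).2)[k _ Fx]]; exists (pickle (i, k)) => //.
by rewrite pickleK.
Qed.

Lemma lean_seq (A : nat -> set cantor_space) : (forall n, lean (A n)) -> lean (\bigcup_n A n).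
Proof. by move=> /lean_bigcup; apply: lean_sub => x [n _ An]; exists n. Qed.

Lemma leanU A B : lean A -> lean B -> lean (A `|` B).
Proof.
move=> lA lB; apply: (lean_sub _ (lean_bigcup (A := fun b : bool => if b then A else B) _)).
  by move=> x [Ax|Bx]; [exists true|exists false].
by case.
Qed.

(** Banach category theorem. There are countably many cylinders, so the parts of [A] in those where
    it is lean form a lean set; the rest of [A] misses some cylinder inside each cylinder and is
    rare. *)
Lemma dense_lean A : (forall s, exists2 t, cylinder t `<=` cylinder s &
  lean (cylinder t `&` A)) -> lean A.
Proof.
move=> dA.
pose B (t : seq bool) : set cantor_space :=
  [set x | lean (cylinder t `&` A) /\ (cylinder t `&` A) x].
have lB : lean [set x | exists t, B t x].
  apply: lean_bigcup => t; have [lt|nlt] := EM (lean (cylinder t `&` A)).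
    by apply: lean_sub lt => x [].
  by apply: lean_sub (rare_lean rare0) => x [].
have rR : lean [set x | A x /\ forall t, lean (cylinder t `&` A) -> ~ cylinder t x].
  apply: rare_lean => s; have [t ts lt] := dA s.
  by exists t => // x xt [_ /(_ _ lt)].
apply: lean_sub (leanU lB rR) => x Ax.
have [[t [lt tx]]|n] := EM (exists t, lean (cylinder t `&` A) /\ cylinder t x).
  by left; exists t.
by right; split=> // t lt tx; apply: n; exists t.
Qed.

(** Baire category theorem for cylinders. *)
Lemma cylinder_not_lean s : ~ lean (cylinder s).
Proof.
move=> [F rF sF].
have ex (p : nat * seq bool) : exists t, [/\ cylinder t `<=` cylinder p.2,
    p.1 < size t & forall x, cylinder t x -> ~ F p.1 x].
  have [t ts tF] := rF p.1 p.2.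
  have ct := @cylinder_cat t (nseq p.1.+1 false).
  (* The padding makes the cylinder of stage [k.+1] fix bit [k], so that the nested cylinders
     determine a point. *)
  exists (t ++ nseq p.1.+1 false); split.
  - exact: subset_trans ts.
  - by rewrite size_cat size_nseq leq_addl.
  - by move=> x /ct /tF.
have [f hf] := choice ex.
pose t := fix t k := if k is k'.+1 then f (k', t k') else s.
have tS k : cylinder (t k.+1) `<=` cylinder (t k) by case: (hf (k, t k)).
have tmono j k : j <= k -> cylinder (t k) `<=` cylinder (t j).
  move=> jk; rewrite -(subnK jk); elim: (k - j) => // n IH.
  by apply: subset_trans IH; exact: tS.
have tsize k : k < size (t k.+1) by case: (hf (k, t k)).
pose x : cantor_space := fun i => nth false (t i.+1) i.
have xt k : cylinder (t k) x.
  move=> i ik; rewrite /x; have [h|h] := leqP i.+1 k.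
    by rewrite (cylinder_sub (tmono _ _ h)) //; exact: tsize.
  by rewrite (cylinder_sub (tmono _ _ (ltnW h))).
have [k _ Fk] := sF _ (xt 0).
by case: (hf (k, t k)) => _ _ /(_ _ (xt k.+1)).
Qed.

Lemma baire_measC A : baire_meas A -> baire_meas (~` A).
Proof.
by move=> mA s; have [t ts [h|h]] := mA s; exists t => //; [right|left]; rewrite ?setCK.
Qed.

(** Unless some [A k] is comeager in a subcylinder of [s], every [A n] is lean on densely many
    subcylinders, hence lean on [s] by [dense_lean], and so is the union. *)
Lemma baire_meas_bigcup (A : nat -> set cantor_space) : (forall n, baire_meas (A n)) ->
  baire_meas (\bigcup_n A n).
Proof.
move=> mA s.
have [[k [t [ts lt]]]|no] := EM (exists k t, cylinder t `<=` cylinder s /\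
    lean (cylinder t `&` ~` A k)).
  exists t => //; right; apply: lean_sub lt => x [tx nA]; split=> // Ak.
  by apply: nA; exists k.
exists s => //; left.
apply: (lean_sub (B := \bigcup_n (cylinder s `&` A n))).
  by move=> x [sx [n _ An]]; exists n.
apply: lean_seq => n; apply: dense_lean => u.
have [u' u'u [u's|dis]] := cylinder_extend s u; last first.
  exists u' => //; apply: lean_sub (rare_lean rare0) => x [u'x [sx _]].
  exact: (dis _ u'x).
have [t tu' [lt|lt]] := mA n u'.
  exists t; first exact: subset_trans u'u.
  by apply: lean_sub lt => x [tx [_ An]].
by case: no; exists n, t; split=> //; exact: subset_trans u's.
Qed.

Lemma lean_baire_meas A : lean A -> baire_meas A.
Proof. by move=> lA s; exists s => //; left; apply: lean_sub lA => x []. Qed.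

Lemma comeager_mono A B s : lean (A `\` B) -> comeager_in A s -> comeager_in B s.
Proof.
move=> lAB lA; apply: lean_sub (leanU lAB lA) => x [sx nB].
by have [Ax|nA] := EM (A x); [left|right].
Qed.

Lemma comeager_meet A B s : baire_meas A -> comeager_in A s -> comeager_in B s ->
  exists x, A x /\ B x.
Proof.
move=> _ lA lB; apply: contrapT => n; apply: (@cylinder_not_lean s).
apply: lean_sub (leanU lA lB) => x sx.
by have [Ax|nA] := EM (A x); [right; split=> // Bx; apply: n; exists x|left].
Qed.

Lemma comeager_ex A : baire_meas A -> ~ lean A -> exists s, comeager_in A s.
Proof.
move=> mA nA; apply: contrapT => n; apply: nA; apply: dense_lean => s.
have [t ts [lt|lt]] := mA s; first by exists t.
by case: n; exists t.
Qed.

Definition category_frame : frame cantor_space :=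
  Frame baire_measC baire_meas_bigcup lean_baire_meas (rare_lean rare0)
    lean_sub lean_seq comeager_mono comeager_meet comeager_ex.

Lemma category_bits k b : baire_meas [set y | y k = b].
Proof.
move=> s; pose t := s ++ nseq k.+1 false.
have kt : k < size t by rewrite size_cat size_nseq leq_addl.
exists t; first exact: cylinder_cat.
have [E|nE] := EM (nth false t k = b).
  by right; apply: lean_sub (rare_lean rare0) => x [tx nx]; case: nx; rewrite /= (tx k kt).
by left; apply: lean_sub (rare_lean rare0) => x [tx xk]; case: nE; rewrite -(tx k kt).
Qed.

Lemma lean_flip n A : lean A -> lean (flip n @^-1` A).
Proof.
move=> [F rF AF]; exists (fun k => flip n @^-1` F k).
  move=> k s; have [t ts tF] := rF k (flip_seq n s).
  exists (flip_seq n t); last first.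
    move=> x /(cylinder_flip (n := n)); rewrite flip_seqK; exact: tF.
  move=> x /(cylinder_flip (n := n)); rewrite flip_seqK => /ts /(cylinder_flip (n := n)).
  by rewrite flip_seqK flipK.
by move=> x /AF[k _ Fk]; exists k.
Qed.

Lemma category_flip s : exists n, forall A, comeager_in A s -> comeager_in (flip n @^-1` A) s.
Proof.
exists (size s) => A lA; apply: lean_sub (lean_flip (size s) lA) => x [sx nA].
by split=> //; exact: cylinder_flip_beyond.
Qed.

Lemma nbhs_bit (x : cantor_space) i : nbhs x [set y : cantor_space | y i = x i].
Proof.
have c := @proj_continuous nat (fun=> bool) i x.
by have := c _ (discrete_set1 (x i)).
Qed.

Lemma nbhs_cylinder (x : cantor_space) s : cylinder s x -> nbhs x (cylinder s).
Proof.
move=> xs.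
have h n : nbhs x [set y : cantor_space | forall i, i < n -> y i = x i].
  elim: n => [|n IH]; first by apply: filterS filterT => y.
  apply: filterS (filterI IH (nbhs_bit x n)) => y [h hn] i.
  by rewrite ltnS leq_eqVlt => /orP[/eqP->//|/h].
by apply: filterS (h (size s)) => y ys i si; rewrite ys // xs.
Qed.

(** The sets containing a cylinder around [x] form a filter. Its convergence in the product topology
    is tested on single coordinates, and coordinate [i] is fixed by [i.+1] bits. *)
Lemma cylinder_basis (x : cantor_space) (B : set cantor_space) : nbhs x B ->
  exists2 s, cylinder s x & cylinder s `<=` B.
Proof.
pose F : set_system cantor_space :=
  [set A | exists n, forall y, (forall i, i < n -> y i = x i) -> A y].
have FF : Filter F.
  split; first by exists 0.
    move=> A1 A2 [n1 h1] [n2 h2]; exists (maxn n1 n2) => y hy.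
    by split; [apply: h1|apply: h2] => i ilt; apply: hy; rewrite leq_max ilt ?orbT.
  by move=> A1 A2 sA [n1 h1]; exists n1 => y /h1 /sA.
have cF : F --> x.
  apply/cvg_sup => i A /= [_ [[U _ <-] Ux] sUA].
  by exists i.+1 => y /(_ i (ltnSn i)) yi; apply: sUA; rewrite /= yi.
move=> /cF[n hn]; exists (mkseq x n).
  by move=> i; rewrite size_mkseq => ik; rewrite nth_mkseq.
by move=> y ys; apply: hn => i i_n; rewrite ys ?size_mkseq ?nth_mkseq.
Qed.

Lemma rare_nowhere_dense A : rare A -> nowhere_dense A.
Proof.
move=> rA; apply/seteqP; split=> // x /cylinder_basis[s xs sA].
have [t ts tA] := rA s.
have /sA cl := ts _ (@cylinder_nth t).
have [y [Ay ty]] := cl _ (nbhs_cylinder (@cylinder_nth t)).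
exact: tA ty Ay.
Qed.

(** [meager] asks for equality with the union, so the rare sets are cut down to [A]. *)
Lemma lean_meager A : lean A -> meager A.
Proof.
move=> [F rF AF]; exists (fun k => F k `&` A).
  move=> k; apply: rare_nowhere_dense => s; have [t ts tF] := rF k s.
  by exists t => // x /tF nF [].
apply/seteqP; split=> [x Ax|x [k _ []//]].
by have [k _ Fk] := AF _ Ax; exists k.
Qed.

End Category.

Theorem meager_incompressible (x : cantor_space) :
  ITRM_random_meager x -> totally_incompressible x.
Proof.
move=> rx ax; apply: rx.
have [|X [dX lX Xx]] := @frame_incompressible category_frame x category_bits _ ax.
  exact: category_flip.
by exists X; split=> //; exact: lean_meager.
Qed.

Import GRing.Theory Num.Theory.

(** * The fair-coin outer measure *)

Section Measure.
Variable R : realType.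
Local Open Scope ereal_scope.

Definition weight (s : seq bool) : \bar R := ((2^-1 : R) ^+ size s)%:E.

(** Cheapest cylinder containing [A]. As every set is made measurable below,
    the generic outer measure [mu_ext] of [cyl_content] is the fair-coin outer
    measure, with the empty set as an allowed covering set. *)
Definition cyl_content (A : set cantor_space) : \bar R :=
  ereal_inf [set weight s | s in [set s | A `<=` cylinder s]].

Lemma weight_ge0 s : 0 <= weight s.
Proof. by rewrite lee_fin exprn_ge0 // invr_ge0 ler0n. Qed.

Lemma cyl_content_ge0 A : 0 <= cyl_content A.
Proof. by apply: le_ereal_inf_tmp => _ [s _ <-]; exact: weight_ge0. Qed.

Lemma cyl_content_le A s : A `<=` cylinder s -> cyl_content A <= weight s.
Proof. by move=> As; apply: ereal_inf_lbound; exists s. Qed.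

Lemma cyl_content_fin A : cyl_content A \is a fin_num.
Proof.
rewrite ge0_fin_numE ?cyl_content_ge0 //.
by apply: (le_lt_trans (cyl_content_le (s := [::]) _)); rewrite // ltry.
Qed.

Lemma cyl_content0 : cyl_content set0 = 0.
Proof.
apply/eqP; rewrite eq_le cyl_content_ge0 andbT; apply/lee_addgt0Pr => e e0.
rewrite add0e; have [n _ /(_ n (leqnn n)) /= hn] := near_infty_natSinv_expn_lt (PosNum e0).
apply: (le_trans (cyl_content_le (s := nseq n false) _)) => //.
by rewrite /weight size_nseq lee_fin exprVn -div1r ltW.
Qed.

Let discrete := g_sigma_algebraType [set: set cantor_space].

Let discrete_measurable (A : set discrete) : measurable A.
Proof. exact: sub_sigma_algebra. Qed.

Definition coin_outer (A : set cantor_space) : \bar R :=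
  @mu_ext _ discrete R cyl_content A.

HB.instance Definition _ := isOuterMeasure.Build R cantor_space coin_outer
  (@mu_ext0 _ discrete R _ cyl_content0 cyl_content_ge0)
  (@mu_ext_ge0 _ discrete R _ cyl_content_ge0)
  (@le_mu_ext _ discrete R cyl_content)
  (@mu_ext_sigma_subadditive _ discrete R _ cyl_content_ge0).

(** Each covering set is replaced by a cylinder at the extra cost [e / 2 ^ k.+1], in total [e]; from
    then on covers may be taken to consist of cylinders. *)
Lemma lebesgue_outer_le A : lebesgue_outer R A <= coin_outer A.
Proof.
apply: le_ereal_inf_tmp => _ [F [_ AF] <-].
apply/lee_addgt0Pr => e e0.
have ex k : exists s, F k `<=` cylinder s /\
    weight s <= cyl_content (F k) + (e / (2 ^ k.+1)%:R)%:E.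
  have e' : (0 < e / (2 ^ k.+1)%:R)%R by rewrite divr_gt0 // ltr0n expn_gt0.
  have [_ [s Fs <-] ws] := lb_ereal_inf_adherent e' (cyl_content_fin (F k)).
  by exists s; split=> //; exact: ltW.
have [s hs] := choice ex.
apply: le_trans (epsilon_trick _ (fun k => cyl_content_ge0 (F k)) (ltW e0)).
apply: (@le_trans _ _ (\sum_(0 <= k <oo) weight (s k))).
  apply: ereal_inf_lbound; exists s => // x /AF[k _ Fk].
  by exists k => //; exact: (hs k).1.
by apply: lee_nneseries => k *; [exact: weight_ge0|exact: (hs k).2].
Qed.

Lemma coin_outer_cylinder s : coin_outer (cylinder s) <= weight s.
Proof.
pose F k : set cantor_space := if k is 0%N then cylinder s else set0.
apply: (@le_trans _ _ (\sum_(0 <= k <oo) cyl_content (F k))).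
  by apply: ereal_inf_lbound; exists F => //; split=> // x sx; exists 0%N.
rewrite nneseries_recl //; last by move=> k _; exact: cyl_content_ge0.
rewrite eseries0 ?adde0; first exact: cyl_content_le.
by move=> [|k] //= _ _; exact: cyl_content0.
Qed.

Lemma coin_outer_fin A : coin_outer A \is a fin_num.
Proof.
rewrite ge0_fin_numE ?outer_measure_ge0 //.
apply: (@le_lt_trans _ _ (coin_outer (cylinder [::]))); first exact: le_outer_measure.
by apply: (le_lt_trans (coin_outer_cylinder _)); rewrite ltry.
Qed.

Lemma weight_rcons s b : weight (rcons s b) + weight (rcons s (~~ b)) = weight s.
Proof.
by rewrite /weight !size_rcons -EFinD exprS -mulrDl -[(_ + _)%R]mulr2n -[(_ *+ 2)%R]mulr_natr mulVf ?mul1r.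
Qed.

Lemma cylinder_rcons s : cylinder s `<=` cylinder (rcons s false) `|` cylinder (rcons s true).
Proof.
move=> x sx; have [E|E] : x (size s) = false \/ x (size s) = true.
- by case: (x _); [right|left].
- left => i; rewrite size_rcons ltnS leq_eqVlt nth_rcons => /orP[/eqP->|h].
    by rewrite ltnn eqxx.
  by rewrite h sx.
- right => i; rewrite size_rcons ltnS leq_eqVlt nth_rcons => /orP[/eqP->|h].
    by rewrite ltnn eqxx.
  by rewrite h sx.
Qed.

(** A cylinder longer than [k] lies in [A] or in its complement; a shorter one is halved until bit
    [k] is fixed, and the weights of the halves add up. *)
Lemma cylinder_split k b s (A := [set y : cantor_space | y k = b]) :
  coin_outer (cylinder s `&` A) + coin_outer (cylinder s `&` ~` A) <= weight s.
Proof.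
have long t : (k < size t)%N ->
    coin_outer (cylinder t `&` A) + coin_outer (cylinder t `&` ~` A) <= weight t.
  move=> kt; have [E|nE] := EM (nth false t k = b).
    have -> : cylinder t `&` ~` A = set0.
      by apply/seteqP; split=> // x [tx nA]; case: nA; rewrite /A /= (tx k kt).
    rewrite outer_measure0 adde0; apply: le_trans (coin_outer_cylinder t).
    by apply: le_outer_measure => x [].
  have -> : cylinder t `&` A = set0.
    by apply/seteqP; split=> // x [tx Ax]; case: nE; rewrite -(tx k kt).
  rewrite outer_measure0 add0e; apply: le_trans (coin_outer_cylinder t).
  by apply: le_outer_measure => x [].
have [n] : exists n, (k < size s + n)%N by exists k.+1; rewrite addnS ltnS leq_addl.
elim: n s => [|n IH] s; first by rewrite addn0; exact: long.
move=> kn.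
have h c : coin_outer (cylinder (rcons s c) `&` A) +
    coin_outer (cylinder (rcons s c) `&` ~` A) <= weight (rcons s c).
  by apply: IH; rewrite size_rcons addSnnS.
have sub B : coin_outer (cylinder s `&` B) <=
    coin_outer (cylinder (rcons s false) `&` B) + coin_outer (cylinder (rcons s true) `&` B).
  apply: le_trans (outer_measureU2 _ _ _); apply: le_outer_measure => x [/cylinder_rcons[]sx Bx].
    by left.
  by right.
rewrite -(weight_rcons s false); apply: le_trans (leeD (h false) (h true)).
by rewrite addeACA; exact: leeD.
Qed.

Lemma coin_bits k b : caratheodory_measurable coin_outer [set y : cantor_space | y k = b].
Proof.
apply: le_caratheodory_measurable => X.
set A := [set y | _]; apply: le_trans (lebesgue_outer_le X).
apply: le_ereal_inf_tmp => _ [s Xs <-].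
have sub B : coin_outer (X `&` B) <= \sum_(0 <= j <oo) coin_outer (cylinder (s j) `&` B).
  apply: le_trans (outer_measure_sigma_subadditive _ _); apply: le_outer_measure.
  by move=> x [/Xs[j _ sx] Bx]; exists j.
apply: le_trans (leeD (sub A) (sub (~` A))) _.
rewrite -nneseriesD; [|by move=> *; exact: outer_measure_ge0..].
by apply: lee_nneseries => [j _ _|j _]; [apply: adde_ge0; exact: outer_measure_ge0|exact: cylinder_split].
Qed.

Lemma coin_outer_flip n A : coin_outer (flip n @^-1` A) <= coin_outer A.
Proof.
apply: le_ereal_inf_tmp => _ [F [_ AF] <-].
apply: (@le_trans _ _ (\sum_(0 <= k <oo) cyl_content (flip n @^-1` F k))).
  apply: ereal_inf_lbound; exists (fun k => flip n @^-1` F k) => //; split=> //.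
  by move=> x /AF[k _ Fk]; exists k.
apply: lee_nneseries => [k _ _|k _]; first exact: cyl_content_ge0.
apply: le_ereal_inf_tmp => _ [s Fs <-].
have -> : weight s = weight (flip_seq n s) by rewrite /weight size_mkseq.
apply: cyl_content_le => x /Fs /(cylinder_flip (n := n)); by rewrite flipK.
Qed.

Definition coin_meas := caratheodory_measurable coin_outer.
Definition coin_null (A : set cantor_space) := coin_outer A = 0.
(** 1/2 is the least density beyond which two sets in the same cylinder, one of them measurable,
    must meet. *)
Definition coin_big (A : set cantor_space) (s : seq bool) :=
  (2^-1)%:E * weight s < coin_outer (cylinder s `&` A).

Lemma coin_null_sub A B : A `<=` B -> coin_null B -> coin_null A.
Proof.
move=> AB B0; apply/eqP; rewrite eq_le outer_measure_ge0 andbT -B0.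
exact: le_outer_measure.
Qed.

Lemma coin_null_meas A : coin_null A -> coin_meas A.
Proof.
move=> A0; apply: le_caratheodory_measurable => X.
have E : coin_null (X `&` A) by apply: coin_null_sub A0 => x [].
rewrite [X in X + _]E add0e.
by apply: le_outer_measure => x [].
Qed.

Lemma coin_null_bigcup (A : nat -> set cantor_space) : (forall n, coin_null (A n)) ->
  coin_null (\bigcup_n A n).
Proof.
move=> A0; apply/eqP; rewrite eq_le outer_measure_ge0 andbT.
apply: le_trans (outer_measure_sigma_subadditive coin_outer A) _.
by rewrite eseries0 // => i _ _; exact: A0.
Qed.

Lemma coin_big_mono A B s : coin_null (A `\` B) -> coin_big A s -> coin_big B s.
Proof.
move=> AB0 /lt_le_trans; apply; rewrite -[leRHS]adde0 -AB0.
apply: le_trans (outer_measureU2 _ _ _); apply: le_outer_measure => x [sx Ax].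
by have [Bx|nB] := EM (B x); [left|right].
Qed.

Lemma coin_big_meet A B s : coin_meas A -> coin_big A s -> coin_big B s ->
  exists x, A x /\ B x.
Proof.
move=> mA bA bB; apply: contrapT => n.
have le1 : coin_outer (cylinder s `&` A) + coin_outer (cylinder s `&` B) <= weight s.
  apply: le_trans (coin_outer_cylinder s); rewrite (mA (cylinder s)); apply: leeD => //.
  apply: le_outer_measure => x [sx Bx]; split=> // Ax; apply: n; by exists x.
have := lteD bA bB; rewrite -EFinM -EFinD -mulrDl.
have -> : (2^-1 + 2^-1 = 1 :> R)%R by rewrite -[(_ + _)%R]mulr2n -[(_ *+ 2)%R]mulr_natr mulVf.
by rewrite mul1r => /lt_le_trans/(_ le1); rewrite ltxx.
Qed.

(** An elementary density argument: if [A] filled at most half of every cylinder, each cover by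
    cylinders would bound its outer measure by half of the weight of the cover. So this outer
    measure is finite and at most half of itself, hence 0. *)
Lemma coin_big_ex A : coin_meas A -> ~ coin_null A -> exists s, coin_big A s.
Proof.
move=> _ nA; apply: contrapT => n; apply: nA.
have small s : coin_outer (cylinder s `&` A) <= (2^-1)%:E * weight s.
  by rewrite leNgt; apply/negP => h; apply: n; exists s.
have half : (2%:R)%:E * coin_outer A <= coin_outer A.
  apply: le_trans (lebesgue_outer_le A); apply: le_ereal_inf_tmp => _ [s As <-].
  have : coin_outer A <= (2^-1)%:E * \sum_(0 <= k <oo) weight (s k).
    rewrite -nneseriesZl; last by move=> *; exact: weight_ge0.
    apply: (@le_trans _ _ (\sum_(0 <= k <oo) coin_outer (cylinder (s k) `&` A))).
      apply: le_trans (outer_measure_sigma_subadditive _ _); apply: le_outer_measure.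
      by move=> x Ax; have [k _ sx] := As _ Ax; exists k.
    by apply: lee_nneseries => [k _ _|k _]; [exact: outer_measure_ge0|exact: small].
  move=> h; have := lee_wpmul2l (x := (2%:R : R)%:E) _ h; rewrite muleA -EFinM mulfV // mul1e.
  by apply; rewrite lee_fin ler0n.
apply/eqP; rewrite eq_le outer_measure_ge0 andbT.
move: half; rewrite -(fineK (coin_outer_fin A)) -EFinM !lee_fin.
by rewrite mulr_natl mulr2n gerDl.
Qed.

Definition measure_frame : frame cantor_space :=
  Frame (@caratheodory_measurable_setC _ _ coin_outer)
    (@caratheodory_measurable_bigcup _ _ coin_outer) coin_null_meas
    (outer_measure0 coin_outer) coin_null_sub coin_null_bigcup
    coin_big_mono coin_big_meet coin_big_ex.

Lemma coin_flip s : exists n, forall A, coin_big A s -> coin_big (flip n @^-1` A) s.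
Proof.
exists (size s) => A /lt_le_trans; apply.
apply: le_trans (coin_outer_flip (size s) _); apply: le_outer_measure => x [sx Ax].
by split; [exact: cylinder_flip_beyond|rewrite /preimage /= flipK].
Qed.

Theorem measure_incompressible (x : cantor_space) :
  ITRM_random_measure R x -> totally_incompressible x.
Proof.
move=> rx ax; apply: rx.
have [|X [dX X0 Xx]] := @frame_incompressible measure_frame x coin_bits _ ax.
  exact: coin_flip.
exists X; split=> //; apply/eqP; rewrite eq_le; apply/andP; split.
  by rewrite -(X0 : coin_outer X = 0); exact: lebesgue_outer_le.
by apply: le_ereal_inf_tmp => _ [s _ <-]; apply: nneseries_ge0 => *; exact: weight_ge0.
Qed.

End Measure.

Theorem theorem5 (R : realType) (x : cantor_space) :
  (ITRM_random_measure R x -> totally_incompressible x) /\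
  (ITRM_random_meager x -> totally_incompressible x).
Proof. by split; [exact: measure_incompressible | exact: meager_incompressible]. Qed.
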